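(* Let $\mathbf{k}$ be a field with $\operatorname{char}(\mathbf{k})\neq 2$, let $g\geq 3$, and let $\mathcal{T}\subseteq\mathbf{P}^g$ be the tangential variety of the rational normal curve of degree $g$. Then for each $i=1,\ldots,g-3$ there is a natural identification (isomorphism of $\mathbf{k}$-vector spaces) $$K_{i,2}\bigl(\mathcal{T},\mathcal{O}_{\mathcal{T}}(1)\bigr)=W^{(i+2)}_{g-3-i},$$ where $W^{(i+2)}_{g-3-i}$ is the degree $g-3-i$ component of the Weyman module $W^{(i+2)}$.
   Context: Tangential variety: the rational normal curve $\Gamma\subseteq\mathbf{P}^g$ is the image of $\mathbf{P}^1$ under $[a:b]\mapsto[a^g:a^{g-1}b:\cdots:b^g]$, and $\mathcal{T}$ is the surface swept out by its tangent lines, with reduced structure; in homogeneous coordinates $z_0,\ldots,z_g$ its homogeneous ideal is the kernel of $\mathbf{k}[z_0,\ldots,z_g]\to\mathbf{k}[t,u,v]$, $z_i\mapsto u\,t^i+i\,v\,t^{i-1}$. Koszul cohomology: for a very ample line bundle $L$ on a projective variety $X$, with $S=\operatorname{Sym}H^0(X,L)$ and $\Gamma_X(L)=\bigoplus_{n\geq 0}H^0(X,L^{n})$, $K_{i,j}(X,L):=\operatorname{Tor}_i^S(\Gamma_X(L),\mathbf{k})_{i+j}$. Here $H^0(\mathcal{T},\mathcal{O}_{\mathcal{T}}(1))$ is the span of $z_0,\ldots,z_g$. Koszul modules: for a finite-dimensional vector space $V$ and a subspace $K\subseteq\bigwedge^2V$, $$W_q(V,K)=\frac{\ker\bigl(V\otimes\operatorname{Sym}^{q+1}V\to\operatorname{Sym}^{q+2}V\bigr)}{\delta_2\bigl(K\otimes\operatorname{Sym}^qV\bigr)},\qquad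 \delta_2((v\wedge w)\otimes f)=v\otimes wf-w\otimes vf .$$ Weyman modules: let $U$ be a $2$-dimensional $\mathbf{k}$-vector space with basis $(x_1,x_2)$. The divided power $\mathrm{D}^dU$ is the space of symmetric tensors in $U^{\otimes d}$, with basis $x^{(0)},\ldots,x^{(d)}$, where $x^{(i)}$ is the sum of all distinct permutations of $x_1^{\otimes i}\otimes x_2^{\otimes(d-i)}$. For $d\geq 1$ define $\Delta_1:\mathrm{D}^{2d-2}U\to\bigwedge^2\mathrm{D}^dU$ by $\Delta_1(x^{(t)})=\sum_{i+j=t+1,\ d\geq i>j\geq 0}(i-j)\,x^{(i)}\wedge x^{(j)}$; it is injective when $\operatorname{char}(\mathbf{k})\neq2$ (it is dual to the Gaussian--Wahl map of $\mathcal{O}_{\mathbf{P}^1}(d)$). Then $W^{(d)}:=W(\mathrm{D}^dU,\mathrm{D}^{2d-2}U)$, with $\mathrm{D}^{2d-2}U$ viewed as a subspace of $\bigwedge^2\mathrm{D}^dU$ via $\Delta_1$, and $W^{(d)}_q$ is its degree $q$ component. *)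

(* Defs.v *)
From HB Require Import structures.
From mathcomp Require Import all_boot all_order all_algebra.
From mathcomp Require Import boolp.
From mathcomp Require Import mpoly.

Set Implicit Arguments.
Unset Strict Implicit.
Unset Printing Implicit Defensive.

Import GRing.Theory.
Local Open Scope ring_scope.
Local Open Scope quotient_scope.

Section Subspace.
Variables (k : fieldType) (V : lmodType k).

Definition is_subspace (P : V -> Prop) : Prop :=
  P 0 /\ forall (a : k) x y, P x -> P y -> P (a *: x + y).

Variables (P : V -> Prop) (hP : is_subspace P).

Definition subspace_pred of is_subspace P : V -> bool := fun x => `[< P x >].

Fact subspace_pred_closed : submod_closed (subspace_pred hP).
Proof.
case: (hP) => P0 PD; split; first exact/asboolP.
by move=> a x y /asboolP Px /asboolP Py; apply/asboolP; apply: PD.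
Qed.

Definition subspace_of : submodClosed V := HB.pack (subspace_pred hP)
  (GRing.isSubmodClosed.Build k V (subspace_pred hP) subspace_pred_closed).

Lemma subspace_ofP x : reflect (P x) (x \in subspace_of).
Proof. exact: asboolP. Qed.

End Subspace.

(* [subquotient Z B] is the k-vector space Z / (Z :&: B); below, B is always  *)
(* contained in Z.                                                            *)
Section Subquotient.
Variables (k : fieldType) (V : lmodType k) (Z B : submodClosed V).

Definition subv : Type := {x : V | x \in Z}.

HB.instance Definition _ := SubChoice.on subv.
HB.instance Definition _ := [SubChoice_isSubLmodule of subv by <:].

Definition den_pred : subv -> bool := fun x => \val x \in B.

Fact den_pred_closed : submod_closed den_pred.
Proof.
split=> [|a x y].
  by change (\val (0 : subv) \in B); rewrite linear0 rpred0.
move=> Bx By; change (\val (a *: x + y) \in B); rewrite linearP rpredD //.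
by rewrite rpredZ.
Qed.

Definition den : zmodClosed subv := HB.pack den_pred
  (GRing.isSubmodClosed.Build k subv den_pred den_pred_closed).

Definition subquotient : Type := Quotient.quot den.

HB.instance Definition _ := GRing.Zmodule.on subquotient.

Definition subquotient_pi (x : subv) : subquotient := \pi_(Quotient.quot den) x.

Definition subquotient_scale (a : k) (x : subquotient) : subquotient :=
  subquotient_pi (a *: repr (x : Quotient.quot den)).

Lemma subquotient_piP x y :
  reflect (subquotient_pi x = subquotient_pi y) (\val x - \val y \in B).
Proof.
apply: (iffP idP) => [h|/eqP].
  apply/eqP; rewrite -Quotient.idealrBE; change (\val (x - y) \in B).
  by rewrite linearB.
by rewrite -Quotient.idealrBE => h; rewrite -linearB; exact: h.
Qed.

Lemma subquotient_piZ a x :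
  subquotient_pi (a *: x) = subquotient_scale a (subquotient_pi x).
Proof.
apply/subquotient_piP; rewrite -linearB -scalerBr linearZ rpredZ // linearB.
by apply/subquotient_piP; rewrite /subquotient_pi reprK.
Qed.

Lemma subquotient_pi_surj (x : subquotient) : exists y, x = subquotient_pi y.
Proof. by exists (repr (x : Quotient.quot den)); rewrite /subquotient_pi reprK. Qed.

Lemma subquotient_piD x y :
  subquotient_pi (x + y) = subquotient_pi x + subquotient_pi y.
Proof. exact: raddfD. Qed.

Fact subquotient_scaleA a b x :
  subquotient_scale a (subquotient_scale b x) = subquotient_scale (a * b) x.
Proof.
by have [y ->] := subquotient_pi_surj x; rewrite -!subquotient_piZ scalerA.
Qed.

Fact subquotient_scale1 : left_id 1 subquotient_scale.
Proof.
by move=> x; have [y ->] := subquotient_pi_surj x;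
  rewrite -subquotient_piZ scale1r.
Qed.

Fact subquotient_scaleDr : right_distributive subquotient_scale +%R.
Proof.
move=> a x y; have [x' ->] := subquotient_pi_surj x.
have [y' ->] := subquotient_pi_surj y.
by rewrite -subquotient_piD -!subquotient_piZ scalerDr subquotient_piD.
Qed.

Fact subquotient_scaleDl x :
  {morph subquotient_scale^~ x : a b / a + b}.
Proof.
move=> a b /=; have [y ->] := subquotient_pi_surj x.
by rewrite -!subquotient_piZ scalerDl subquotient_piD.
Qed.

HB.instance Definition _ := GRing.Zmodule_isLmodule.Build k subquotient
  subquotient_scaleA subquotient_scale1 subquotient_scaleDr subquotient_scaleDl.

End Subquotient.

Definition free_map (R : comNzRingType) (I J : finType) (D : I -> J -> R)
    (w : {ffun I -> R}) : {ffun J -> R} :=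
  [ffun c => \sum_b w b * D b c].

Section Tor.
Variables (k : fieldType) (n : nat).

(* A graded resolution of k = S / (x_0, ..., x_(n-1)) by graded free modules  *)
(* of finite rank over S = k[x_0, ..., x_(n-1)].  The i-th module is free on  *)
(* [rbasis i], with b in degree [rdeg b]; [rdiff] is the matrix of the        *)
(* differential and [raug] the value of the augmentation on the basis of the  *)
(* 0-th module, S acting on k through constant terms.                         *)
Record free_resolution := FreeResolution {
  rbasis : nat -> finType;
  rdeg : forall i, rbasis i -> nat;
  rdiff : forall i, rbasis i.+1 -> rbasis i -> {mpoly k[n]};
  raug : rbasis 0%N -> k;
  rdiff_homog : forall i (b : rbasis i.+1) (c : rbasis i) m,
    m \in msupp (rdiff b c) -> (mdeg m + rdeg c)%N = rdeg b;
  raug_homog : forall b, raug b != 0 -> rdeg b = 0%N;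
  raug_surj : exists b, raug b != 0;
  rexact0 : forall v : {ffun rbasis 0%N -> {mpoly k[n]}},
    \sum_b (v b)@_0%MM * raug b = 0 <->
    exists w, v = free_map (@rdiff 0%N) w;
  rexactS : forall i (v : {ffun rbasis i.+1 -> {mpoly k[n]}}),
    free_map (@rdiff i) v = 0 <-> exists w, v = free_map (@rdiff i.+1) w
}.

(* [phi] makes the k-algebra A an S-module, and [G e] is the degree e part of *)
(* a graded S-submodule G of A.  [tor phi G F i d] is the degree d part of    *)
(* the i-th homology of F (x)_S G, i.e. Tor_i^S(G, k)_d; an element of        *)
(* F_i (x)_S G is a family of elements of G indexed by the basis of F_i.      *)
Variables (A : comAlgType k) (phi : {mpoly k[n]} -> A).
Variables (G : nat -> submodClosed A) (F : free_resolution).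

Definition tensor_chain i (d : nat) (v : {ffun rbasis F i -> A}) : Prop :=
  forall b, if (rdeg b <= d)%N then (v b \in G (d - rdeg b)%N : Prop)
            else v b = 0.

Definition tensor_diff i : {ffun rbasis F i.+1 -> A} -> {ffun rbasis F i -> A} :=
  free_map (fun b c => phi (rdiff b c)).

Definition tor_cycle i d (v : {ffun rbasis F i -> A}) : Prop :=
  tensor_chain d v /\
  match i return {ffun rbasis F i -> A} -> Prop with
  | 0%N => fun=> True
  | i'.+1 => fun v => tensor_diff v = 0
  end v.

Definition tor_boundary i d (v : {ffun rbasis F i -> A}) : Prop :=
  exists2 w : {ffun rbasis F i.+1 -> A}, tensor_chain d w & v = tensor_diff w.

Fact tensor_diff_linear i a (x y : {ffun rbasis F i.+1 -> A}) :
  tensor_diff (a *: x + y) = a *: tensor_diff x + tensor_diff y.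
Proof.
apply/ffunP=> c; rewrite !ffunE scaler_sumr -big_split /=.
by apply: eq_bigr => b _; rewrite !ffunE mulrDl scalerAl.
Qed.

Fact tensor_chain_subspace i d : is_subspace (@tensor_chain i d).
Proof.
split=> [b|a x y hx hy b]; rewrite !ffunE; first by case: ifP => _ //; apply: rpred0.
move: (hx b) (hy b); case: ifP => _; last by move=> -> ->; rewrite scaler0 addr0.
by move=> ? ?; rewrite rpredD ?rpredZ.
Qed.

Fact tor_cycle_subspace i d : is_subspace (@tor_cycle i d).
Proof.
have [h0 hD] := tensor_chain_subspace i d.
split=> [|a x y [hx dx] [hy dy]]; (split; first by [exact: h0|exact: hD]).
  case: i {h0 hD} => // i.
  by have := tensor_diff_linear 1 0 (0 : {ffun rbasis F i.+1 -> A});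
    rewrite scaler0 add0r scale1r -[LHS]addr0 => /addrI.
case: i x y {h0 hD hx hy} dx dy => // i x y dx dy.
by rewrite tensor_diff_linear dx dy scaler0 addr0.
Qed.

Fact tor_boundary_subspace i d : is_subspace (@tor_boundary i d).
Proof.
have [h0 hD] := tensor_chain_subspace i.+1 d.
split=> [|a x y [x' hx ->] [y' hy ->]].
  exists 0; first exact: h0.
  by have := tensor_diff_linear 1 0 (0 : {ffun rbasis F i.+1 -> A});
    rewrite scaler0 add0r scale1r -[LHS]addr0 => /addrI.
by exists (a *: x' + y'); [exact: hD|rewrite tensor_diff_linear].
Qed.

Definition tor i d : lmodType k :=
  subquotient (subspace_of (tor_cycle_subspace i d))
              (subspace_of (tor_boundary_subspace i d)).

End Tor.

Section TangentialVariety.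
Variables (k : fieldType) (g : nat).

(* The field k(t, u, v), with t = 'X_0, u = 'X_1, v = 'X_2. *)
Definition tuv_field : Type := {fraction {mpoly k[3]}}.

HB.instance Definition _ := GRing.Field.on tuv_field.

Definition tuv_inj : {mpoly k[3]} -> tuv_field := @tofrac _.

HB.instance Definition _ := GRing.RMorphism.on tuv_inj.

Definition tuv_scale (a : k) (f : tuv_field) : tuv_field := tuv_inj a%:MP * f.

Fact tuv_scaleA a b f : tuv_scale a (tuv_scale b f) = tuv_scale (a * b) f.
Proof. by rewrite /tuv_scale mulrA -rmorphM -mpolyCM. Qed.

Fact tuv_scale1 : left_id 1 tuv_scale.
Proof. by move=> f; rewrite /tuv_scale mpolyC1 rmorph1 mul1r. Qed.

Fact tuv_scaleDr : right_distributive tuv_scale +%R.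
Proof. by move=> a x y; rewrite /tuv_scale mulrDr. Qed.

Fact tuv_scaleDl f : {morph tuv_scale^~ f : a b / a + b}.
Proof. by move=> a b /=; rewrite /tuv_scale mpolyCD rmorphD mulrDl. Qed.

HB.instance Definition _ := GRing.Zmodule_isLmodule.Build k tuv_field
  tuv_scaleA tuv_scale1 tuv_scaleDr tuv_scaleDl.

Fact tuv_scaleAl (a : k) (x y : tuv_field) : a *: (x * y) = (a *: x) * y.
Proof. exact: mulrA. Qed.

HB.instance Definition _ :=
  GRing.Lmodule_isLalgebra.Build k tuv_field tuv_scaleAl.
HB.instance Definition _ :=
  GRing.Lalgebra_isComAlgebra.Build k tuv_field.

Definition tangent_coord (i : 'I_g.+1) : {mpoly k[3]} :=
  let t := 'X_(inord 0) in let u := 'X_(inord 1) in let v := 'X_(inord 2) in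
  u * t ^+ i + i%:R * v * t ^+ i.-1.

(* The kernel of this morphism k[z_0, ..., z_g] -> k[t, u, v] is the ideal of *)
(* the tangential variety T, so its image is the homogeneous coordinate ring. *)
Definition tangent_param : {mpoly k[g.+1]} -> {mpoly k[3]} :=
  mmap (@mpolyC 3 k) tangent_coord.

HB.instance Definition _ := GRing.RMorphism.on tangent_param.

Definition tangent_param_fraction : {mpoly k[g.+1]} -> tuv_field :=
  tuv_inj \o tangent_param.

HB.instance Definition _ := GRing.RMorphism.on tangent_param_fraction.

(* H^0(T, O_T(m)): since T is integral and the z_i generate its coordinate    *)
(* ring R = S / I in degree 1, the sections of O_T(m) are the elements of     *)
(* Frac R lying in the degree m part of R[1/z_i] for every i.  The image of S *)
(* in k[t, u, v] identifies Frac R with a subfield of k(t, u, v).             *)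
Definition is_section (m : nat) (f : tuv_field) : Prop :=
  forall i : 'I_g.+1, exists N : nat, exists2 p : {mpoly k[g.+1]},
    p \is (m + N).-homog &
    f * tangent_param_fraction 'X_i ^+ N = tangent_param_fraction p.

Fact tangent_paramZ a p :
  tangent_param_fraction (a *: p) = a *: tangent_param_fraction p.
Proof.
rewrite -mul_mpolyC rmorphM /=; congr (_ * _).
by congr tuv_inj; exact: (mmapC _ (@mpolyC 3 k)).
Qed.

Fact is_section_subspace m : is_subspace (is_section m).
Proof.
split=> [i|a x y hx hy i].
  by exists 0%N, 0; rewrite ?dhomog0 // mul0r rmorph0.
have [M [p hp ep]] := hx i; have [N [q hq eq']] := hy i.
have hX (e : nat) : ('X_i ^+ e : {mpoly k[g.+1]}) \is e.-homog.
  have h1 : ('X_i : {mpoly k[g.+1]}) \is 1.-homog by rewrite dhomogX /= mdeg1.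
  by have := dhomogMn e h1; rewrite mul1n.
exists (M + N)%N, (a *: (p * 'X_i ^+ N) + q * 'X_i ^+ M).
  rewrite rpredD ?rpredZ //; first by rewrite addnA dhomogM.
  by rewrite [(M + N)%N]addnC addnA dhomogM.
rewrite rmorphD /= tangent_paramZ !rmorphM /= !rmorphXn /= -ep -eq'.
rewrite mulrDl -scalerAl exprD -!mulrA; congr (_ + _ * _).
by rewrite mulrC.
Qed.

Definition sections (m : nat) : submodClosed tuv_field :=
  subspace_of (is_section_subspace m).

(* K_{i,j}(T, O_T(1)) = Tor_i^S(sum_m H^0(T, O_T(m)), k)_{i+j}, computed with *)
(* the resolution F of k over S = Sym H^0(T, O_T(1)) = k[z_0, ..., z_g].      *)
Definition tangential_koszul (F : free_resolution k g.+1) (i j : nat) :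
    lmodType k :=
  tor tangent_param_fraction sections F i (i + j).

End TangentialVariety.

Section KoszulModule.
Variables (k : fieldType) (n : nat).

(* For V = k^n with standard basis e_i: a family f stands for the element     *)
(* \sum_i e_i (x) f_i of V (x) Sym V, and /\^2 V is the space of alternating  *)
(* matrices, e_i /\ e_j being the elementary difference E_ij - E_ji.          *)
Definition wedge (v w : 'rV[k]_n) : 'M[k]_n := v^T *m w - w^T *m v.

(* By linearity, [delta2 (wedge v w) f] is v (x) wf - w (x) vf. *)
Definition delta2 (M : 'M[k]_n) (f : {mpoly k[n]}) :
    {ffun 'I_n -> {mpoly k[n]}} :=
  [ffun i => \sum_j M i j *: ('X_j * f)].

Variables (K : {vspace 'M[k]_n}) (q : nat).

Definition koszul_num (f : {ffun 'I_n -> {mpoly k[n]}}) : Prop :=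
  (forall i, f i \is q.+1.-homog) /\ \sum_i 'X_i * f i = 0.

Definition koszul_den (f : {ffun 'I_n -> {mpoly k[n]}}) : Prop :=
  exists2 s : seq ('M[k]_n * {mpoly k[n]}),
    {in s, forall x, x.1 \in K /\ x.2 \is q.-homog} &
    f = \sum_(x <- s) delta2 x.1 x.2.

Fact koszul_num_subspace : is_subspace koszul_num.
Proof.
split=> [|a x y [hx ex] [hy ey]]; split.
- by move=> i; rewrite ffunE dhomog0.
- by apply: big1 => i _; rewrite ffunE mulr0.
- by move=> i; rewrite !ffunE rpredD ?rpredZ.
transitivity (a *: (\sum_i 'X_i * x i) + \sum_i 'X_i * y i); last first.
  by rewrite ex ey scaler0 addr0.
rewrite scaler_sumr -big_split; apply: eq_bigr => i _ /=.
by rewrite !ffunE mulrDr scalerAr.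
Qed.

Fact koszul_den_subspace : is_subspace koszul_den.
Proof.
split=> [|a _ _ [s hs ->] [r hr ->]]; first by exists [::]; rewrite ?big_nil.
exists ([seq (x.1, a *: x.2) | x <- s] ++ r).
  move=> x; rewrite mem_cat => /orP[/mapP[y ys ->]|/hr //] /=.
  by have [? ?] := hs y ys; split=> //; rewrite rpredZ.
rewrite big_cat big_map scaler_sumr; congr (_ + _); apply: eq_bigr => x _ /=.
apply/ffunP=> i; rewrite !ffunE scaler_sumr; apply: eq_bigr => j _.
by rewrite -scalerAr !scalerA mulrC.
Qed.

Definition koszul_module : lmodType k :=
  subquotient (subspace_of koszul_num_subspace) (subspace_of koszul_den_subspace).

End KoszulModule.

Section WeymanModule.
Variables (k : fieldType) (d : nat).

(* D^d U is k^(d+1), its basis x^(0), ..., x^(d) being the standard one. *)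
Definition dpow (i : 'I_d.+1) : 'rV[k]_d.+1 := delta_mx 0 i.

Definition Delta1 (t : nat) : 'M[k]_d.+1 :=
  \sum_(i < d.+1) \sum_(j < d.+1 | (i + j == t.+1)%N && (j < i)%N)
    (i - j)%N%:R *: wedge (dpow i) (dpow j).

(* The image of D^(2d-2) U, whose basis is x^(0), ..., x^(2d-2). *)
Definition weyman_space : {vspace 'M[k]_d.+1} :=
  <<[seq Delta1 t | t <- iota 0 (2 * d).-1]>>%VS.

Definition weyman (q : nat) : lmodType k := koszul_module weyman_space q.

End WeymanModule.

(* Main.v *)
(* Koszul cohomology is computed with the Koszul resolution, so K_{i,2} is the
   middle homology of
     /\^(i+1) (x) H^0(O_T(1)) -> /\^i (x) H^0(O_T(2)) -> /\^(i-1) (x) H^0(O_T(3)).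
   For u = 1, a section of O_T(m) is a polynomial F_0 + F_0' v + F_2 v^2 + ...
   over k[t].  Let R_n = k[X_0, ..., X_n] and P_n = X_0 + X_1 t + ... + X_n t^n.
   Hermite reciprocity /\^n k^(g+1) = (R_n)_(g+1-n) turns families of sections
   indexed by n-subsets of {0, ..., g} into polynomials in t over R_n.  The
   v-free part of the Koszul differential becomes f |-> P_n rho(f), where
   rho : R_(n+1)[t] -> R_n[t] is the substitution P_(n+1)(x) |-> (x - t) P_n(x),
   whose kernel is generated by P_(n+1).  It follows that every cycle is
   homologous to v^2 P_i^2 r with deg r <= 2q + 2, where q = g - 3 - i, and that
   such a cycle is a boundary if and only if r = (rho s)' - 2 rho(s') for some s
   of degree at most q + 2.
   An element F of the kernel defining W_q, written as a polynomial F^ in t of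
   degree d = i + 2, satisfies [t^d](P_d F^) = 0, and it is sent to
   r = rho(rho(H)), where H collects the coefficients of P_d F^ above t^d.  That
   this induces an isomorphism from W_q to the homology is a Cech computation on
   P^1: the two halves of P_d F^ play the role of the local data, and the rows of
   Delta_1 produce exactly the cocycles P_d (2 t P_d' C + P_d (t C' - N C))
   = t (P_d^2 C)' - N P_d^2 C, whose coefficient of t^N vanishes. *)

Require Import Defs.
From HB Require Import structures.
From mathcomp Require Import all_boot all_order all_algebra.
From mathcomp Require Import boolp.
From mathcomp Require Import mpoly zify ring.

Set Implicit Arguments.
Unset Strict Implicit.
Unset Printing Implicit Defensive.

Import GRing.Theory.
Local Open Scope ring_scope.

(** A power t^N replaces the gluing of charts: a polynomial f stands for the Laurent polynomial f /
    t^N, so the coefficient of t^N is a constant term, and t d/dt always has constant term 0.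
    Homogeneity of degree e in the X_j controls the behaviour at infinity, because each [rho] raises
    the degree in t by at most e.

    The bounds fit without slack. The sections v^2 f of O_T(2) are those with deg f <= 2g - 4, and
    2g - 4 = 2i + 2q + 2 leaves deg r <= 2q + 2 after the factor P_i^2; the same bound makes the
    lift of r at infinity miss the coefficient of t^N that must vanish on the kernel defining W_q.

    The cycle condition is tested on polynomials in t and v, so H^0(O_T(3)) need not be determined.
    Characteristic different from 2 enters where anticommuting contractions must have square zero,
    and where t^j v^2 with j odd is shown to be a section by a quadric whose image is 2 t^j v^2.
    Since Tor may be taken with any graded free resolution, a comparison theorem that respects
    degrees is proved as well. *)

Lemma mpoly_alg_ind (n : nat) (R : fieldType) (P : {mpoly R[n]} -> Prop) :
  (forall c, P c%:MP) -> (forall i, P 'X_i) ->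
  (forall p q, P p -> P q -> P (p + q)) ->
  (forall p q, P p -> P q -> P (p * q)) -> forall p, P p.
Proof.
move=> PC PX PD PM p; rewrite (mpolyE p).
elim/big_ind: _ => [|//|m _]; first by rewrite -mpolyC0.
rewrite -mul_mpolyC; apply: (PM) => //; rewrite mpolyXE_id.
elim/big_ind: _ => [|//|i _]; first by rewrite -mpolyC1.
by elim: (m i) => [|e ih]; rewrite ?expr0 -?mpolyC1 // exprS; apply: PM.
Qed.

Lemma poly_mpoly_ind (n : nat) (R : fieldType)
    (P : {poly {mpoly R[n]}} -> Prop) :
  (forall c, P (c%:MP)%:P) -> (forall i, P ('X_i)%:P) -> P 'X ->
  (forall p q, P p -> P q -> P (p + q)) ->
  (forall p q, P p -> P q -> P (p * q)) -> forall p, P p.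
Proof.
move=> PC PX PT PD PM; elim/poly_ind => [|p c ihp]; first by rewrite -polyC0 -mpolyC0.
apply: (PD); first exact: PM.
elim/mpoly_alg_ind: c => [//|//|c d hc hd|c d hc hd]; first by rewrite polyCD; apply: PD.
by rewrite polyCM; apply: PM.
Qed.

(** * The substitution rho *)

HB.lock Definition xv (k : fieldType) n (j : nat) : {mpoly k[n.+1]} :=
  if (j < n.+1)%N then 'X_(inord j) else 0.

(* X_0 + X_1 t + ... + X_n t^n, for n + 1 variables X_0, ..., X_n. *)
HB.lock Definition gpoly (k : fieldType) n : {poly {mpoly k[n.+1]}} :=
  \poly_(j < n.+1) xv k n j.

(* X_j |-> X_(j-1) - t X_j, so that the generic polynomial of degree n + 1 at x
   goes to (x - t) times the generic polynomial of degree n at x. *)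
HB.lock Definition rho0 (k : fieldType) n : {mpoly k[n.+2]} -> {poly {mpoly k[n.+1]}} :=
  mmap (polyC \o @mpolyC n.+1 k)
    (fun j : 'I_n.+2 => ((0 < j)%N%:R * xv k n j.-1)%:P - (xv k n j)%:P * 'X).

HB.lock Definition rho (k : fieldType) n (f : {poly {mpoly k[n.+2]}}) :
    {poly {mpoly k[n.+1]}} := (map_poly (@rho0 k n) f).['X].

(* A section of rho: X_j |-> X_(j+1) + X_(j+2) t + ... + X_(n+1) t^(n-j). *)
HB.lock Definition lam0 (k : fieldType) n : {mpoly k[n.+1]} -> {poly {mpoly k[n.+2]}} :=
  mmap (polyC \o @mpolyC n.+2 k)
    (fun j : 'I_n.+1 => drop_poly j.+1 (gpoly k n.+1)).

HB.lock Definition lam (k : fieldType) n (f : {poly {mpoly k[n.+1]}}) :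
    {poly {mpoly k[n.+2]}} := (map_poly (@lam0 k n) f).['X].

Arguments xv {k} n j.
Arguments gpoly {k} n.
Arguments rho0 {k n} _.
Arguments rho {k n} f.
Arguments lam0 {k n} _.
Arguments lam {k n} f.

Section Rho.
Variable k : fieldType.

Local Notation R n := {mpoly k[n.+1]}.

Fact rho0_zmod n : zmod_morphism (@rho0 k n).
Proof. by move=> f g; rewrite !rho0.unlock rmorphB. Qed.

Fact rho0_monoid n : monoid_morphism (@rho0 k n).
Proof. by rewrite !rho0.unlock; split=> [|f g]; rewrite ?rmorph1 ?rmorphM. Qed.

HB.instance Definition _ n :=
  GRing.isZmodMorphism.Build (R n.+1) {poly R n} (@rho0 k n) (@rho0_zmod n).
HB.instance Definition _ n :=
  GRing.isMonoidMorphism.Build (R n.+1) {poly R n} (@rho0 k n) (@rho0_monoid n).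

Fact rho_zmod n : zmod_morphism (@rho k n).
Proof. by move=> f g; rewrite !rho.unlock rmorphB hornerD hornerN. Qed.

Fact rho_monoid n : monoid_morphism (@rho k n).
Proof.
by rewrite !rho.unlock; split=> [|f g]; rewrite ?rmorph1 ?hornerC // rmorphM hornerM.
Qed.

HB.instance Definition _ n :=
  GRing.isZmodMorphism.Build {poly R n.+1} {poly R n} (@rho k n) (@rho_zmod n).
HB.instance Definition _ n :=
  GRing.isMonoidMorphism.Build {poly R n.+1} {poly R n} (@rho k n) (@rho_monoid n).

Fact lam0_zmod n : zmod_morphism (@lam0 k n).
Proof. by move=> f g; rewrite !lam0.unlock rmorphB. Qed.

Fact lam0_monoid n : monoid_morphism (@lam0 k n).
Proof. by rewrite !lam0.unlock; split=> [|f g]; rewrite ?rmorph1 ?rmorphM. Qed.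

HB.instance Definition _ n :=
  GRing.isZmodMorphism.Build (R n) {poly R n.+1} (@lam0 k n) (@lam0_zmod n).
HB.instance Definition _ n :=
  GRing.isMonoidMorphism.Build (R n) {poly R n.+1} (@lam0 k n) (@lam0_monoid n).

Fact lam_zmod n : zmod_morphism (@lam k n).
Proof. by move=> f g; rewrite !lam.unlock rmorphB hornerD hornerN. Qed.

Fact lam_monoid n : monoid_morphism (@lam k n).
Proof.
by rewrite !lam.unlock; split=> [|f g]; rewrite ?rmorph1 ?hornerC // rmorphM hornerM.
Qed.

HB.instance Definition _ n :=
  GRing.isZmodMorphism.Build {poly R n} {poly R n.+1} (@lam k n) (@lam_zmod n).
HB.instance Definition _ n :=
  GRing.isMonoidMorphism.Build {poly R n} {poly R n.+1} (@lam k n) (@lam_monoid n).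

Lemma rhoD n f h : rho (f + h) = rho f + rho h :> {poly R n}.
Proof. exact: rmorphD. Qed.

Lemma rhoB n f h : rho (f - h) = rho f - rho h :> {poly R n}.
Proof. exact: rmorphB. Qed.

Lemma rhoM n f h : rho (f * h) = rho f * rho h :> {poly R n}.
Proof. exact: rmorphM. Qed.

Lemma lamD n f h : lam (f + h) = lam f + lam h :> {poly R n.+1}.
Proof. exact: rmorphD. Qed.

Lemma lamB n f h : lam (f - h) = lam f - lam h :> {poly R n.+1}.
Proof. exact: rmorphB. Qed.

Lemma lamM n f h : lam (f * h) = lam f * lam h :> {poly R n.+1}.
Proof. exact: rmorphM. Qed.

Lemma rhoC n c : rho (c%:P) = rho0 c :> {poly R n}.
Proof. by rewrite rho.unlock map_polyC hornerC. Qed.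

Lemma rhoX n : rho 'X = 'X :> {poly R n}.
Proof. by rewrite rho.unlock map_polyX hornerX. Qed.

Lemma rhoXn n e : rho ('X^e) = 'X^e :> {poly R n}.
Proof. by rewrite rmorphXn /= rhoX. Qed.

Lemma rhoE n (f : {poly R n.+1}) :
  rho f = \sum_(j < size f) rho0 f`_j * 'X^j.
Proof.
rewrite -{1}[f]coefK poly_def rmorph_sum; apply: eq_bigr => j _.
by rewrite -mul_polyC rmorphM /= rhoC rhoXn.
Qed.

Lemma lamC n c : lam (c%:P) = lam0 c :> {poly R n.+1}.
Proof. by rewrite lam.unlock map_polyC hornerC. Qed.

Lemma lamX n : lam 'X = 'X :> {poly R n.+1}.
Proof. by rewrite lam.unlock map_polyX hornerX. Qed.

Lemma rho0C n (c : k) : rho0 (c%:MP) = (c%:MP)%:P :> {poly R n}.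
Proof. by rewrite rho0.unlock mmapC. Qed.

Lemma lam0C n (c : k) : lam0 (c%:MP) = (c%:MP)%:P :> {poly R n.+1}.
Proof. by rewrite lam0.unlock mmapC. Qed.

Lemma rho0_xv n j : (j < n.+2)%N ->
  rho0 (xv n.+1 j) = ((0 < j)%N%:R * xv n j.-1)%:P - (xv n j)%:P * 'X :> {poly R n}.
Proof. by move=> jn; rewrite {1}xv.unlock jn rho0.unlock mmapX mmap1U inordK. Qed.

Lemma lam0_xv n j : (j < n.+1)%N ->
  lam0 (xv n j) = drop_poly j.+1 (gpoly n.+1) :> {poly R n.+1}.
Proof. by move=> jn; rewrite {1}xv.unlock jn lam0.unlock mmapX mmap1U inordK. Qed.

Lemma xvX n (i : 'I_n.+1) : 'X_i = xv n i :> R n.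
Proof. by rewrite xv.unlock ltn_ord inord_val. Qed.

Lemma xv_ge n j : (n < j)%N -> xv n j = 0 :> R n.
Proof. by move=> nj; rewrite xv.unlock; case: ifP => //; lia. Qed.

Lemma coef_gpoly n j : (gpoly n)`_j = xv n j :> R n.
Proof. by rewrite gpoly.unlock coef_poly xv.unlock; case: (j < n.+1)%N. Qed.

Lemma mcoeff_xv n j : (j < n.+1)%N -> xv n j != 0 :> R n.
Proof.
move=> jn; rewrite xv.unlock jn; apply/eqP => /(congr1 (mcoeff U_(inord j))).
by rewrite mcoeffX eqxx mcoeff0 => /eqP; rewrite oner_eq0.
Qed.

Lemma size_gpoly n : size (gpoly n : {poly R n}) = n.+1.
Proof. by rewrite gpoly.unlock size_poly_eq //= mcoeff_xv. Qed.

Lemma gpoly_neq0 n : gpoly n != 0 :> {poly R n}.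
Proof. by rewrite -size_poly_gt0 size_gpoly. Qed.

(** The outer variable x is kept apart from t here: P_(n+1)(x) goes to (x - t) P_n(x). Its Taylor
    expansion at x = t yields the values of [rho] on P_(n+1) and on its first two derivatives. *)
Lemma map_rho_gpoly n :
  map_poly (@rho k n \o polyC) (gpoly n.+1) =
  ('X - ('X)%:P) * map_poly polyC (gpoly n).
Proof.
apply/polyP => j; rewrite coef_map /= coef_gpoly rhoC mulrBl coefB coefXM coefCM.
rewrite !coef_map /= !coef_gpoly.
case: (ltnP j n.+2) => jn; last first.
  rewrite [xv n.+1 j]xv_ge // rmorph0 [xv n j]xv_ge; last by lia.
  rewrite polyC0 mulr0 subr0; case: eqP => // _.
  by rewrite xv_ge //; lia.
by rewrite rho0_xv //; case: j jn => [|j] jn /=; rewrite ?mul0r ?mul1r ['X * _]mulrC.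
Qed.

Lemma rho_derivn n m :
  rho ((gpoly n.+1)^`(m)) = ((map_poly (@rho k n \o polyC) (gpoly n.+1))^`(m)).['X].
Proof.
rewrite derivn_map /= {1}rho.unlock.
congr (horner _ 'X); apply/polyP => j.
by rewrite !coef_map /= rhoC.
Qed.

Lemma rho_gpoly n : rho (gpoly n.+1) = 0 :> {poly R n}.
Proof.
have := rho_derivn n 0; rewrite !derivn0 => ->.
by rewrite map_rho_gpoly hornerM !hornerE subrr mul0r.
Qed.

Lemma horner_map_polyC n (f : {poly R n}) : (map_poly polyC f).['X] = f.
Proof.
rewrite -[RHS]coefK poly_def horner_coef size_map_polyC; apply: eq_bigr => i _.
by rewrite coef_map /= mul_polyC.
Qed.

Lemma rho_gpoly' n : rho (gpoly n.+1)^`() = gpoly n :> {poly R n}.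
Proof.
have := rho_derivn n 1; rewrite !derivn1 => ->.
rewrite map_rho_gpoly derivM derivB derivX derivC subr0 mul1r.
by rewrite hornerD hornerM !hornerE subrr mul0r addr0 horner_map_polyC.
Qed.

Lemma rho_gpoly'' n : rho (gpoly n.+1)^`()^`() = (gpoly n)^`() *+ 2 :> {poly R n}.
Proof.
have := rho_derivn n 2; rewrite !derivnS !derivn0 => ->.
rewrite map_rho_gpoly derivM derivB derivX derivC subr0 mul1r.
rewrite derivD derivM derivB derivX derivC subr0 mul1r.
set P := map_poly _ _; rewrite !hornerD hornerM hornerXsubC subrr mul0r addr0.
by rewrite deriv_map horner_map_polyC mulr2n.
Qed.

Lemma drop_gpolyS n j :
  drop_poly j (gpoly n) = (xv n j)%:P + drop_poly j.+1 (gpoly n) * 'X :> {poly R n}.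
Proof.
apply/polyP => m; rewrite coefD coefC coefMX !coef_drop_poly !coef_gpoly.
by case: m => [|m] /=; rewrite ?addr0 // ?add0r addSnnS.
Qed.

(** Downward recursion on j: X_(j+1) + t (X_(j+2) + ...) goes to X_j - t X_(j+1) + t X_(j+1), which
    telescopes to X_j. *)
Lemma rho_drop_gpoly n j : rho (drop_poly j.+1 (gpoly n.+1)) = (xv n j)%:P :> {poly R n}.
Proof.
have [m le_m] := ubnP (n.+1 - j)%N.
elim: m j le_m => [//|m ihm] j le_m; case: (ltnP j n.+1) => jn; last first.
  by rewrite xv_ge // drop_poly_eq0 ?rmorph0 // size_gpoly; lia.
rewrite drop_gpolyS rmorphD rmorphM /= rhoX rhoC rho0_xv; last by lia.
by rewrite ihm; [rewrite mul1r subrK | lia].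
Qed.

Lemma rho_lam n (f : {poly R n}) : rho (lam f) = f.
Proof.
elim/poly_mpoly_ind: f => [c|i||f g hf hg|f g hf hg].
- by rewrite lamC lam0C rhoC rho0C.
- by rewrite xvX lamC lam0_xv // rho_drop_gpoly.
- by rewrite lamX rhoX.
- by rewrite lamD rhoD hf hg.
- by rewrite lamM rhoM hf hg.
Qed.

(** Among the generators only X_0 fails to be fixed by [lam] after [rho]: it returns as -t (X_1 +
    X_2 t + ...), which differs from X_0 by P_(n+1). Hence the kernel of [rho] is generated by
    P_(n+1). *)
Lemma lam_rho n (f : {poly R n.+1}) : exists q, f - lam (rho f) = gpoly n.+1 * q.
Proof.
elim/poly_mpoly_ind: f => [c|i||f g [p hp] [q hq]|f g [p hp] [q hq]].
- by exists 0; rewrite rhoC rho0C lamC lam0C subrr mulr0.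
- rewrite xvX rhoC rho0_xv // lamB lamM lamX !lamC.
  have key j : (0 < j)%N -> lam0 (xv n j.-1) =
      drop_poly j (gpoly n.+1) :> {poly R n.+1}.
    move=> j0; case: (ltnP j.-1 n.+1) => jn; first by rewrite lam0_xv // prednK.
    by rewrite xv_ge // rmorph0 drop_poly_eq0 // size_gpoly; lia.
  rewrite (key i.+1 isT).
  case: (posnP i) => [i0|i0].
    exists 1; rewrite i0 mul0r rmorph0 sub0r opprK mulr1.
    by rewrite -[RHS]drop_poly0l [RHS]drop_gpolyS.
  exists 0; rewrite mul1r key // [drop_poly i _]drop_gpolyS addrK subrr mulr0 //.
- by exists 0; rewrite rhoX lamX subrr mulr0.
- by exists (p + q); rewrite rhoD lamD mulrDr -hp -hq; ring.
- exists (p * g + lam (rho f) * q); rewrite rhoM lamM mulrDr mulrA -hp.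
  by rewrite mulrCA -hq; ring.
Qed.

Lemma rho_eq0 n (f : {poly R n.+1}) : rho f = 0 -> exists q, f = gpoly n.+1 * q.
Proof. by move=> h; have [q] := lam_rho f; rewrite h rmorph0 subr0; exists q. Qed.

End Rho.

(** * Induction on homogeneous polynomials *)

Lemma homog_ind (k : fieldType) n (P : nat -> {mpoly k[n]} -> Prop) :
  (forall d, P d 0) -> (forall c, P 0%N c%:MP) -> (forall i, P 1%N 'X_i) ->
  (forall d p q, P d p -> P d q -> P d (p + q)) ->
  (forall d b p q, P d p -> P b q -> P (d + b)%N (p * q)) ->
  forall d p, p \is d.-homog -> P d p.
Proof.
move=> P0 PC PX PD PM d p /dhomogP hp; rewrite (mpolyE p) big_seq.
elim/big_ind: _ => [//|x y hx hy|m mp]; first exact: PD.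
rewrite -mul_mpolyC -[d]add0n; apply: (PM); first exact: PC.
rewrite -(hp m mp) /= mdegE mpolyXE_id.
elim/big_rec2: _ => [|i e q _ hq]; first by rewrite -mpolyC1.
apply: (PM) => //; elim: (m i) => [|l ih]; first by rewrite expr0 -mpolyC1.
by rewrite exprS -add1n; apply: (PM).
Qed.

Lemma size_mul_leqS (A : idomainType) (p q : {poly A}) m l :
  (size p <= m.+1)%N -> (size q <= l.+1)%N -> (size (p * q)%R <= (m + l).+1)%N.
Proof. by move=> sp sq; rewrite (leq_trans (size_polyMleq _ _)) //; lia. Qed.

Lemma size_add_leq (A : nzRingType) (p q : {poly A}) m :
  (size p <= m)%N -> (size q <= m)%N -> (size (p + q)%R <= m)%N.
Proof. by move=> sp sq; rewrite (leq_trans (size_polyD _ _)) // geq_max sp. Qed.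

(** * Homogeneous coefficients and lifts along rho *)

Section Homogeneous.
Variable k : fieldType.
Local Notation R n := {mpoly k[n.+1]}.

Definition phomog n (d : nat) (f : {poly R n}) : Prop :=
  forall j, f`_j \is d.-homog.

Lemma phomog0 n d : phomog d (0 : {poly R n}).
Proof. by move=> j; rewrite coef0 rpred0. Qed.

Lemma phomogD n d (f h : {poly R n}) : phomog d f -> phomog d h -> phomog d (f + h).
Proof. by move=> hf hh j; rewrite coefD rpredD. Qed.

Lemma phomogN n d (f : {poly R n}) : phomog d f -> phomog d (- f).
Proof. by move=> hf j; rewrite coefN rpredN. Qed.

Lemma phomogB n d (f h : {poly R n}) : phomog d f -> phomog d h -> phomog d (f - h).
Proof. by move=> hf hh j; rewrite coefB rpredB. Qed.

Lemma phomogMn n d (f : {poly R n}) m : phomog d f -> phomog d (f *+ m).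
Proof. by move=> hf j; rewrite coefMn rpredMn. Qed.

Lemma phomogM n d b (f h : {poly R n}) :
  phomog d f -> phomog b h -> phomog (d + b)%N (f * h).
Proof. by move=> hf hh j; rewrite coefM rpred_sum // => i _; apply: dhomogM. Qed.

Lemma phomogC n d (c : R n) : c \is d.-homog -> phomog d c%:P.
Proof. by move=> hc j; rewrite coefC; case: eqP => _; rewrite ?rpred0. Qed.

Lemma phomogX n : phomog 0 ('X : {poly R n}).
Proof. by move=> j; rewrite coefX; case: eqP => _; rewrite ?rpred0 ?dhomog1. Qed.

Lemma phomogXn n m : phomog 0 ('X^m : {poly R n}).
Proof. by move=> j; rewrite coefXn; case: eqP => _; rewrite ?rpred0 ?dhomog1. Qed.

Lemma phomogXM n d (f : {poly R n}) : phomog d f -> phomog d ('X * f).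
Proof. by move=> hf; rewrite -[d]add0n; apply: phomogM; first exact: phomogX. Qed.

Lemma phomogXnM n d m (f : {poly R n}) : phomog d f -> phomog d ('X^m * f).
Proof. by move=> hf; rewrite -[d]add0n; apply: phomogM; first exact: phomogXn. Qed.

Lemma phomog_deriv n d (f : {poly R n}) : phomog d f -> phomog d f^`().
Proof. by move=> hf j; rewrite coef_deriv rpredMn. Qed.

Lemma phomog_drop n d m (f : {poly R n}) : phomog d f -> phomog d (drop_poly m f).
Proof. by move=> hf j; rewrite coef_drop_poly. Qed.

Lemma phomog_take n d m (f : {poly R n}) : phomog d f -> phomog d (take_poly m f).
Proof. by move=> hf j; rewrite coef_take_poly; case: ifP => _; rewrite ?rpred0. Qed.

Lemma phomog_sum n d I r (P : pred I) (F : I -> {poly R n}) :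
  (forall i, P i -> phomog d (F i)) -> phomog d (\sum_(i <- r | P i) F i).
Proof. by move=> hF; elim/big_ind: _ => //; [exact: phomog0|exact: phomogD]. Qed.

Lemma homog_xv n j : (xv n j : R n) \is 1.-homog.
Proof. by rewrite xv.unlock; case: ifP => _; rewrite ?rpred0 // dhomogX /= mdeg1. Qed.

Lemma phomog_gpoly n : phomog 1 (gpoly n : {poly R n}).
Proof. by move=> j; rewrite coef_gpoly homog_xv. Qed.

Lemma phomog_gpolyM n d (f : {poly R n}) : phomog d f -> phomog d.+1 (gpoly n * f).
Proof. by rewrite -add1n => hf; apply: phomogM => //; apply: phomog_gpoly. Qed.

(** Each variable brings at most one factor t; all later size bounds start from this. *)
Lemma phomog_rho0 n d (c : R n.+1) :
  c \is d.-homog -> phomog d (rho0 c) /\ (size (rho0 c) <= d.+1)%N.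
Proof.
move: d c; apply: homog_ind => [d|c|i|d p q [hp sp] [hq sq]|d b p q [hp sp] [hq sq]].
- by rewrite rmorph0 size_poly0; split=> //; apply: phomog0.
- rewrite rho0C; split; last by rewrite (leq_trans (size_polyC_leq1 _)).
  by apply: phomogC; rewrite -[_%:MP]mulr1 mul_mpolyC rpredZ // dhomog1.
- rewrite xvX rho0_xv //; split.
    apply: phomogB; first by apply: phomogC; case: posnP => _;
      rewrite ?mul0r ?mul1r ?rpred0 ?homog_xv.
    rewrite -[1%N]addn0; apply: phomogM; last exact: phomogX.
    by apply: phomogC; rewrite homog_xv.
  rewrite (leq_trans (size_polyD _ _)) // geq_max size_polyN.
  rewrite (leq_trans (size_polyC_leq1 _)) //=.
  by rewrite (leq_trans (size_polyMleq _ _)) // size_polyX addn2 ltnS size_polyC_leq1.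
- rewrite rmorphD; split; first exact: phomogD.
  by rewrite (leq_trans (size_polyD _ _)) // geq_max sp sq.
rewrite rmorphM; split; first exact: phomogM.
exact: size_mul_leqS.
Qed.

Lemma phomog_rho n d (f : {poly R n.+1}) : phomog d f -> phomog d (rho f).
Proof.
move=> hf; rewrite rhoE; apply: phomog_sum => j _.
rewrite -[d]addn0; apply: phomogM; last exact: phomogXn.
by apply: (phomog_rho0 _).1.
Qed.

Lemma size_rho n d (f : {poly R n.+1}) :
  phomog d f -> (size (rho f) <= size f + d)%N.
Proof.
move=> hf; rewrite rhoE; apply: (leq_trans (size_sum _ _ _)); apply/bigmax_leqP => j _.
apply: (leq_trans (size_mul_leqS (m := d) (l := j) _ _)).
- exact: (phomog_rho0 (hf j)).2.
- by rewrite size_polyXn.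
by rewrite [leqRHS]addnC -addnS leq_add2l ltn_ord.
Qed.

Lemma homog_lam0 n d (c : R n) : c \is d.-homog -> phomog d (lam0 c).
Proof.
move: d c; apply: homog_ind => [d|c|i|d p q hp hq|d b p q hp hq].
- by rewrite rmorph0; apply: phomog0.
- rewrite lam0C; apply: phomogC.
  by rewrite -[_%:MP]mulr1 mul_mpolyC rpredZ // dhomog1.
- by rewrite xvX lam0_xv //; apply: phomog_drop; apply: phomog_gpoly.
- by rewrite rmorphD; apply: phomogD.
by rewrite rmorphM; apply: phomogM.
Qed.

Lemma phomog_lam n d (f : {poly R n}) : phomog d f -> phomog d (lam f).
Proof.
move=> hf; rewrite -[f]coefK poly_def rmorph_sum; apply: phomog_sum => j _ /=.
rewrite -mul_polyC lamM lamC rmorphXn /= lamX -[d]addn0; apply: phomogM.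
  exact: homog_lam0.
exact: phomogXn.
Qed.

Lemma gpolyI n (f h : {poly R n}) : gpoly n * f = gpoly n * h -> f = h.
Proof. by move/(mulfI (gpoly_neq0 k n)). Qed.

Lemma size_gpolyM n (f : {poly R n}) : f != 0 -> size (gpoly n * f)%R = (n + size f)%N.
Proof. by move=> f0; rewrite size_mul ?gpoly_neq0 // size_gpoly. Qed.

Lemma size_gpolyM_leq n (f : {poly R n}) m :
  (size (gpoly n * f)%R <= n + m)%N -> (size f <= m)%N.
Proof.
by have [-> _|f0] := eqVneq f 0; rewrite ?size_poly0 // size_gpolyM // leq_add2l.
Qed.

Lemma size_gpolyM_le n (f : {poly R n}) : (size (gpoly n * f)%R <= n + size f)%N.
Proof. by rewrite (leq_trans (size_polyMleq _ _)) // size_gpoly. Qed.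

Definition ppi n (d : nat) (f : {poly R n}) : {poly R n} :=
  \poly_(j < size f) pihomog mdeg d f`_j.

Lemma coef_ppi n d (f : {poly R n}) j : (ppi d f)`_j = pihomog mdeg d f`_j.
Proof.
rewrite coef_poly; case: ltnP => // h.
by rewrite nth_default // pihomog0.
Qed.

Lemma pihomogM1 n d (x q : R n) :
  x \is 1.-homog -> pihomog mdeg d.+1 (x * q) = x * pihomog mdeg d q.
Proof.
move=> hx; rewrite {1}(pihomog_partitionE (mf := mdeg) (leqnn (msize q))).
rewrite mulr_sumr raddf_sum /=.
have e : forall l : 'I_(msize q), pihomog mdeg d.+1 (x * pihomog mdeg l q) =
    if l == d :> nat then x * pihomog mdeg d q else 0.
  move=> l; have hd : x * pihomog mdeg l q \is l.+1.-homog.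
    by apply: (dhomogM (d := 1) (e := l)) => //; apply: pihomogP.
  case: eqP => [<-|/eqP la]; first by rewrite pihomog_dE.
  by rewrite (pihomog_ne0 _ hd).
rewrite (eq_bigr _ (fun l _ => e l)) -big_mkcond /=.
case: (ltnP d (msize q)) => dq.
  by rewrite (big_pred1 (Ordinal dq)).
rewrite big_pred0 => [|l]; last by apply/eqP => la; have := ltn_ord l; lia.
rewrite [pihomog _ d q]big_seq_cond big_pred0 ?mulr0 // => m.
apply/negP => /andP[/msize_mdeg_lt h1 /eqP /= h2].
by move: dq; rewrite leqNgt -h2 h1.
Qed.

(** As P_n is linear in the X_j, projecting q to degree d leaves the product P_n q unchanged, and
    P_n can be cancelled. *)
Lemma phomog_divisor n d (q : {poly R n}) :
  phomog d.+1 (gpoly n * q) -> phomog d q.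
Proof.
move=> h; suff -> : q = ppi d q by move=> j; rewrite coef_ppi pihomogP.
apply: gpolyI; apply/polyP => j.
rewrite -(pihomog_dE (h j)) !coefM raddf_sum; apply: eq_bigr => i _ /=.
by rewrite coef_ppi pihomogM1 // coef_gpoly homog_xv.
Qed.

Lemma phomog_rho_eq0 n d (f : {poly R n.+1}) : phomog d.+1 f -> rho f = 0 ->
  exists2 q, phomog d q & f = gpoly n.+1 * q.
Proof.
move=> hf /rho_eq0[q fq]; exists q => //.
by apply: phomog_divisor; rewrite -fq.
Qed.

(** Modulo P_(n+1) its initial part X_0 + ... + X_i t^i is minus the tail, which [rho] sends to
    t^(i+1) X_i. So -t^(n-i) times the initial part lifts t^(n+1) X_i and has degree only n in t. *)
Lemma revlift0 n d (c : R n) : c \is d.-homog -> exists L : {poly R n.+1},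
  [/\ phomog d L, rho L = 'X^(d * n.+1) * c%:P & (size L <= (d * n).+1)%N].
Proof.
move: d c; apply: homog_ind => [d|c|i|d p q [L [hL rL sL]] [M [hM rM sM]]
                               |d b p q [L [hL rL sL]] [M [hM rM sM]]].
- by exists 0; rewrite rmorph0 mulr0 size_poly0; split=> //; apply: phomog0.
- exists c%:MP%:P; rewrite mul0n expr0 mul1r rhoC rho0C; split=> //.
    by apply: phomogC; rewrite -[_%:MP]mulr1 mul_mpolyC rpredZ // dhomog1.
  exact: size_polyC_leq1.
- exists (- ('X^(n - i) * take_poly i.+1 (gpoly n.+1))); split.
  + by apply/phomogN/phomogXnM/phomog_take/phomog_gpoly.
  + have e : take_poly i.+1 (gpoly n.+1) =
      gpoly n.+1 - drop_poly i.+1 (gpoly n.+1) * 'X^(i.+1) :> {poly R n.+1}.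
      by apply/eqP; rewrite eq_sym subr_eq poly_take_drop.
    rewrite e mulrBr opprB rhoB !rhoM rho_gpoly mulr0 subr0 rho_drop_gpoly.
    rewrite !rhoXn mulrCA mulrC -exprD xvX; congr ('X^_ * _).
    by have := ltn_ord i; lia.
  have -> : (1 * n = (n - i) + i)%N by have := ltn_ord i; lia.
  rewrite size_polyN; apply: size_mul_leqS; first by rewrite size_polyXn.
  exact: size_take_poly.
- exists (L + M); rewrite rhoD rL rM polyCD mulrDr; split=> //; first exact: phomogD.
  by rewrite (leq_trans (size_polyD _ _)) // geq_max sL.
exists (L * M); rewrite rhoM rL rM polyCM mulnDl exprD; split; first exact: phomogM.
  by rewrite mulrACA.
by rewrite mulnDl; apply: size_mul_leqS.
Qed.

(* A lift along rho which is small at t = infinity, whereas lam is a lift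
   without denominators at t = 0. *)
Lemma revlift n d (f : {poly R n}) : phomog d f -> exists L : {poly R n.+1},
  [/\ phomog d L, rho L = 'X^(d * n.+1) * f & (size L <= size f + d * n)%N].
Proof.
elim/poly_ind: f => [|f c ih] hf.
  by exists 0; rewrite rmorph0 mulr0 size_poly0; split=> //; apply: phomog0.
have [|L [hL rL sL]] := ih.
  by move=> j; have := hf j.+1; rewrite coefD coefMX coefC addr0.
have [|M [hM rM sM]] := @revlift0 n d c.
  by have := hf 0%N; rewrite coefD coefMX coefC add0r.
have [/eqP f0|f0] := eqVneq (f * 'X + c%:P) 0.
  exists 0; rewrite (eqP f0) rmorph0 mulr0 size_poly0; split=> //; exact: phomog0.
exists ('X * L + M); rewrite rhoD rhoM rhoX rL rM; split.
- by apply: phomogD => //; apply: phomogXM.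
- by rewrite mulrDr ['X * _]mulrC -mulrA; congr (_ + _).
have -> : size (f * 'X + c%:P) = (size f).+1.
  rewrite size_MXaddC; case: ifP => // /andP[/eqP f1 /eqP c1].
  by rewrite f1 c1 mul0r addr0 eqxx in f0.
rewrite (leq_trans (size_polyD _ _)) // geq_max; apply/andP; split; last by lia.
have [->|L0] := eqVneq L 0; first by rewrite mulr0 size_poly0.
by rewrite mulrC size_mulX // addSn ltnS.
Qed.

End Homogeneous.

(** * From Koszul modules to polynomials in t *)

Section Cech.
Variable k : fieldType.
Local Notation R n := {mpoly k[n.+1]}.

(** This is t d/dt on the Laurent polynomial f / t^N, multiplied back by t^N. *)
Definition theta (A : nzRingType) (N : nat) (f : {poly A}) : {poly A} := 'X * f^`() - f *+ N.

Lemma coef_theta (A : nzRingType) N (f : {poly A}) j :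
  (theta N f)`_j = f`_j *+ j - f`_j *+ N.
Proof.
rewrite coefB coefXM coefMn; case: j => [|j] //=.
by rewrite coef_deriv.
Qed.

Lemma thetaD (A : nzRingType) N (f h : {poly A}) : theta N (f + h) = theta N f + theta N h.
Proof. by apply/polyP => j; rewrite coefD !coef_theta coefD !mulrnDl addrACA opprD. Qed.

Lemma thetaN (A : nzRingType) N (f : {poly A}) : theta N (- f) = - theta N f.
Proof. by apply/polyP => j; rewrite coefN !coef_theta coefN !mulNrn opprD. Qed.

Lemma thetaB (A : nzRingType) N (f h : {poly A}) : theta N (f - h) = theta N f - theta N h.
Proof. by rewrite thetaD thetaN. Qed.

Lemma theta_Xn (A : nzRingType) N (f : {poly A}) : theta N ('X^N * f) = 'X^(N.+1) * f^`().
Proof.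
apply/polyP => j; rewrite coef_theta !coefXnM coef_deriv.
case: (ltngtP j N) => jN.
- by rewrite !mul0rn subr0 ltnS ltnW.
- by rewrite ltnS leqNgt jN /= -mulrnBr ?(ltnW jN) // subnS prednK ?subn_gt0.
by rewrite -jN ltnSn subrr.
Qed.

Lemma theta_XnM (A : nzRingType) m N (f : {poly A}) :
  theta (N + m) ('X^m * f) = 'X^m * theta N f.
Proof.
apply/polyP => j; rewrite coef_theta !coefXnM coef_theta.
case: ltnP => jm; first by rewrite !mul0rn subr0.
set x := f`_(j - m); have -> : x *+ j = x *+ (j - m) + x *+ m.
  by rewrite -mulrnDr subnK.
by rewrite [(N + m)%N]addnC mulrnDr addrKA.
Qed.

Lemma size_theta (A : nzRingType) N (f : {poly A}) :
  (size f <= N.+1)%N -> (size (theta N f) <= N)%N.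
Proof.
move=> sf; apply/leq_sizeP => j Nj; rewrite coef_theta.
case: (ltngtP N j) Nj => // [Nj _|-> _]; last by rewrite subrr.
by rewrite nth_default ?mul0rn ?subr0 // (leq_trans sf).
Qed.

Lemma phomog_theta n d N (f : {poly R n}) : phomog d f -> phomog d (theta N f).
Proof. by move=> hf; apply: phomogB; [apply/phomogXM/phomog_deriv|apply: phomogMn]. Qed.

(** Only the derivative that falls on P_(n+1) survives [rho], so N disappears. *)
Lemma rho_thetaM n N (f : {poly R n.+1}) :
  rho (theta N (gpoly n.+1 * f)) = 'X * gpoly n * rho f.
Proof.
rewrite /theta rhoB rhoM rhoX rmorphMn /= rhoM rho_gpoly mul0r mul0rn subr0.
by rewrite derivM rhoD !rhoM rho_gpoly rho_gpoly' mul0r addr0 mulrA.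
Qed.

Lemma rhoN n (f : {poly R n.+1}) : rho (- f) = - rho f.
Proof. exact: rmorphN. Qed.

Lemma rho_xv0 n : rho (xv n.+1 0)%:P = - ((xv n 0)%:P * 'X) :> {poly R n}.
Proof. by rewrite rhoC (rho0_xv _ (ltn0Sn _)) mul0r polyC0 sub0r. Qed.

Lemma rho_xvS n j :
  rho (xv n.+1 j.+1)%:P = (xv n j)%:P - (xv n j.+1)%:P * 'X :> {poly R n}.
Proof.
case: (ltnP j.+1 n.+2) => jn; first by rewrite rhoC (rho0_xv _ jn) mul1r.
rewrite [xv n.+1 _]xv_ge // [xv n j]xv_ge // [xv n j.+1]xv_ge; last exact: ltnW.
by rewrite !polyC0 rmorph0 mul0r subrr.
Qed.

(* Both sides are derivations over rho o rho that agree on the generators: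
   inserting two variables x, y and then setting x = y = t, the derivatives in
   x and in y of a function symmetric in x and y coincide. *)
Lemma deriv_rho_rho n (H : {poly R n.+2}) :
  (rho (rho H))^`() + rho (rho H^`()) = rho (rho H)^`() *+ 2.
Proof.
elim/poly_mpoly_ind: H => [c|i||f h hf hh|f h hf hh].
- by rewrite rhoC rho0C rhoC rho0C !derivC !rmorph0 add0r mul0rn.
- rewrite xvX; case: (nat_of_ord i) => [|[|j]]; rewrite derivC !rmorph0 addr0 ?rho_xv0 ?rho_xvS.
  + rewrite rhoN rhoM rho_xv0 rhoX !(derivN, derivM, derivX, derivC).
    rewrite !(mul0r, mulr1, add0r) rhoN rho_xv0; ring.
  + rewrite rhoB rhoM rho_xv0 rho_xvS rhoX !(derivN, derivB, derivM, derivX, derivC).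
    rewrite !(mul0r, mulr1, add0r, oppr0) rhoN rho_xvS; ring.
  move: (rho_xvS n j) (rho_xvS n j.+1) (derivC (xv n j : R n)) (derivC (xv n j.+1 : R n))
    (derivC (xv n j.+2 : R n)) (derivC (xv n.+1 j.+1 : R n.+1)) (derivC (xv n.+1 j.+2 : R n.+1)).
  move: (xv n.+1 j.+1)%:P (xv n.+1 j.+2)%:P (xv n j)%:P (xv n j.+1)%:P (xv n j.+2)%:P.
  move=> p p' c c' c'' e1 e2 h h' h'' d1 d2.
  rewrite rhoB rhoM e1 e2 rhoX !(derivN, derivB, derivM, derivX) d1 d2 h h' h''.
  rewrite !(mul0r, mulr1, add0r, oppr0) rhoN e2; ring.
- by rewrite !rhoX !derivX !rmorph1 mulr2n.
- rewrite !(rhoD, derivD) -[RHS]/(_ *+ 2) mulrnDl -hf -hh; ring.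
have e : (rho (rho (f * h)))^`() + rho (rho (f * h)^`()) =
   ((rho (rho f))^`() + rho (rho f^`())) * rho (rho h) +
    rho (rho f) * ((rho (rho h))^`() + rho (rho h^`())).
  rewrite !(rhoM, derivM, rhoD); ring.
rewrite e hf hh !(rhoM, derivM, rhoD); ring.
Qed.

(** Times P_n^2, this is the coefficient of v^2 in the Koszul boundary of P_(n+1) s + (P_(n+1) s)'
    v, see [kdel'_syzd]. *)
Definition syzd n (s : {poly R n.+1}) : {poly R n} := (rho s)^`() - rho s^`() *+ 2.

Lemma syzd_rho n (H : {poly R n.+2}) : syzd (rho H) = - rho (rho H^`()).
Proof. by rewrite /syzd -deriv_rho_rho opprD addNKr. Qed.

(** Multiples of P_(n+2) account for the kernel of the inner [rho]. The derivative of P_(n+2) A goes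
    to P_(n+1) rho(A), so with A a lift of the quotient of rho f by P_(n+1) it accounts for the
    kernel of the outer one. *)
Lemma rho_rho_eq0 n d (f : {poly R n.+2}) : phomog d.+1 f -> rho (rho f) = 0 ->
  exists A B, [/\ phomog d A, phomog d B & f = (gpoly n.+2 * A)^`() + gpoly n.+2 * B].
Proof.
move=> hf /(phomog_rho_eq0 (phomog_rho hf))[E hE fE].
have hA := phomog_lam hE.
have [||B hB fB] := @phomog_rho_eq0 k n.+1 d (f - (gpoly n.+2 * lam E)^`()).
- by apply: phomogB => //; apply/phomog_deriv/phomog_gpolyM.
- rewrite rhoB fE derivM rhoD !rhoM rho_gpoly rho_gpoly' mul0r addr0 rho_lam.
  exact: subrr.
by exists (lam E), B; split=> //; rewrite -fB addrC subrK.
Qed.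

(* F_0 t^d + F_1 t^(d-1) + ... + F_d. *)
Definition fhat d (F : {ffun 'I_d.+1 -> R d}) : {poly R d} :=
  \poly_(j < d.+1) F (inord (d - j)).

Lemma coef_fhat d (F : {ffun 'I_d.+1 -> R d}) (i : 'I_d.+1) : (fhat F)`_(d - i) = F i.
Proof.
rewrite coef_poly ltnS leq_subr; congr (F _); apply/val_inj.
by rewrite /= inordK; have := ltn_ord i; lia.
Qed.

Lemma phomog_fhat d q (F : {ffun 'I_d.+1 -> R d}) :
  (forall i, F i \is q.-homog) -> phomog q (fhat F).
Proof. by move=> hF j; rewrite coef_poly; case: ifP => _; rewrite ?rpred0. Qed.

Lemma coef_gpolyM d (M : {poly R d}) N : (d <= N)%N ->
  (gpoly d * M)`_N = \sum_(i < d.+1) 'X_i * M`_(N - i).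
Proof.
move=> dN; rewrite coefM.
rewrite [RHS](eq_bigr (fun i : 'I_d.+1 => xv d i * M`_(N - i))); last first.
  by move=> i _; rewrite xvX.
rewrite (big_ord_widen N.+1 (fun i => xv d i * M`_(N - i))) ?ltnS // [RHS]big_mkcond.
apply: eq_bigr => i _; rewrite coef_gpoly ltnS; case: leqP => // id.
by rewrite xv_ge // mul0r.
Qed.

Lemma koszul_num_fhat d q (F : {ffun 'I_d.+1 -> R d}) :
  koszul_num q F <-> (forall i, F i \is q.+1.-homog) /\ (gpoly d * fhat F)`_d = 0.
Proof.
rewrite coef_gpolyM //.
have -> : \sum_(i < d.+1) 'X_i * (fhat F)`_(d - i) = \sum_i 'X_i * F i.
  by apply: eq_bigr => i _; rewrite coef_fhat.
by [].
Qed.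

(** For N = d this inverts [fhat]; a larger N reads an element of the Koszul module off d + 1
    consecutive coefficients of a longer polynomial. *)
Definition window d (N : nat) (M : {poly R d}) : {ffun 'I_d.+1 -> R d} :=
  [ffun i : 'I_d.+1 => M`_(N - i)].

Lemma koszul_num_window d q N (M : {poly R d}) : (d <= N)%N -> phomog q.+1 M ->
  (gpoly d * M)`_N = 0 -> koszul_num q (window N M).
Proof.
move=> dN hM e; split=> [i|]; first by rewrite ffunE.
by rewrite -[RHS]e coef_gpolyM //; apply: eq_bigr => i _; rewrite ffunE.
Qed.

Lemma drop_polyXnM (A : nzRingType) m l (p : {poly A}) :
  drop_poly (m + l) ('X^m * p) = drop_poly l p.
Proof.
apply/polyP => j; rewrite !coef_drop_poly coefXnM ltnNge addnCA leq_addr /=.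
by rewrite addKn.
Qed.

Lemma drop_polyXnMid (A : nzRingType) m (p : {poly A}) : drop_poly m ('X^m * p) = p.
Proof. by rewrite -{1}[m]addn0 drop_polyXnM drop_poly0l. Qed.

(** Coefficients of M below t^(N-d) cannot pass t^N after multiplication by P_d; those above t^N
    give the multiple of P_d that is subtracted. *)
Lemma drop_window d N (M : {poly R d}) : (d <= N)%N ->
  drop_poly d.+1 (gpoly d * fhat (window N M)) =
  drop_poly N.+1 (gpoly d * M) - gpoly d * drop_poly N.+1 M.
Proof.
move=> dN.
have eM : M = take_poly (N - d) M + 'X^(N - d) * fhat (window N M)
              + 'X^(N.+1) * drop_poly N.+1 M.
  apply/polyP => j; rewrite !coefD !coefXnM coef_take_poly coef_drop_poly coef_poly.
  case: (ltnP j (N - d)) => j1.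
    by rewrite (_ : (j < N.+1)%N) ?addr0 //; lia.
  case: (ltnP j N.+1) => j2.
    have -> : (j - (N - d) < d.+1)%N by lia.
    rewrite add0r addr0 ffunE inordK; last by lia.
    by congr (M`_ _); lia.
  have -> : (j - (N - d) < d.+1)%N = false by lia.
  by rewrite !add0r subnK.
have h0 : drop_poly N.+1 (gpoly d * take_poly (N - d) M) = 0.
  have [->|t0] := eqVneq (take_poly (N - d) M) 0; first by rewrite mulr0 linear0.
  apply: drop_poly_eq0; rewrite size_gpolyM //.
  by have := size_take_poly (N - d) M; lia.
rewrite {2}eM !mulrDr linearD linearD /= ![gpoly d * ('X^_ * _)]mulrCA.
rewrite drop_polyXnMid addrK h0 add0r.
have eN : N.+1 = (N - d + d.+1)%N by lia.
by rewrite [X in drop_poly X (_ ^+ _ * _)]eN drop_polyXnM.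
Qed.

Definition psi n (F : {ffun 'I_n.+3 -> R n.+2}) : {poly R n} :=
  rho (rho (drop_poly n.+3 (gpoly n.+2 * fhat F))).

Lemma phomog_psi n q (F : {ffun 'I_n.+3 -> R n.+2}) :
  (forall i, F i \is q.+1.-homog) -> phomog q.+2 (psi F).
Proof. by move=> hF; apply/phomog_rho/phomog_rho/phomog_drop/phomog_gpolyM/phomog_fhat. Qed.

Lemma size_XnM_le (A : idomainType) m l (p : {poly A}) :
  (size ('X^m * p)%R <= m + l)%N -> (size p <= l)%N.
Proof.
have [-> _|p0] := eqVneq p 0; first by rewrite size_poly0.
by rewrite mulrC size_mulXn // leq_add2l.
Qed.

Lemma size_XnM_leq (A : idomainType) m (p : {poly A}) :
  (size ('X^m * p)%R <= m + size p)%N.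
Proof.
have [->|p0] := eqVneq p 0; first by rewrite mulr0 size_poly0.
by rewrite mulrC size_mulXn.
Qed.

Lemma split_at (A : nzRingType) m (f : {poly A}) : f`_m = 0 ->
  f = take_poly m f + 'X^(m.+1) * drop_poly m.+1 f.
Proof.
move=> f0; apply/polyP => j; rewrite coefD coef_take_poly coefXnM coef_drop_poly ltnS.
by case: (ltngtP j m) => [jm|jm|->]; rewrite ?addr0 // add0r subnK.
Qed.

(** [rho] kills the whole product and its coefficient of t^(n+2) vanishes, so t^(n+3) psi F is also
    minus the image of the lower part. That part has degree at most n + 1 and gains at most q + 2
    under each [rho]. *)
Lemma size_psi n q (F : {ffun 'I_n.+3 -> R n.+2}) :
  koszul_num q F -> (size (psi F) <= q.*2.+3)%N.
Proof.
move=> /koszul_num_fhat[hF /split_at]; set f := gpoly _ * _ => ef.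
have hf : phomog q.+2 f by apply/phomog_gpolyM/phomog_fhat.
have e : 'X^(n.+3) * psi F = - rho (rho (take_poly n.+2 f)).
  apply/eqP; rewrite -subr_eq0 opprK addrC -[X in X * _]rhoXn -[X in rho X * _]rhoXn.
  by rewrite -!(rhoM, rhoD) -ef rhoM rho_gpoly mul0r rmorph0.
apply: (@size_XnM_le _ n.+3); rewrite e size_polyN.
have h1 := phomog_take n.+2 hf; have h2 := phomog_rho h1.
have s1 := size_rho h1; have s2 := size_rho h2.
apply: (leq_trans s2); apply: (leq_trans (leq_add s1 (leqnn _))).
rewrite -addnA (leq_trans (leq_add (size_take_poly _ _) (leqnn _))) //; lia.
Qed.

Lemma psi_window n N (M : {poly R n.+2}) : (n.+2 <= N)%N ->
  psi (window N M) = rho (rho (drop_poly N.+1 (gpoly n.+2 * M))).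
Proof.
by move=> nN; rewrite /psi drop_window // rhoB rhoM rho_gpoly mul0r subr0.
Qed.

Lemma drop_theta (A : nzRingType) N (f : {poly A}) :
  drop_poly N.+1 (theta N f) = (drop_poly N f)^`().
Proof.
apply/polyP => j; rewrite coef_deriv !coef_drop_poly coef_theta addSnnS.
by rewrite -mulrnBr; [congr (_ *+ _); lia | lia].
Qed.

Lemma coef_theta_self (A : nzRingType) N (f : {poly A}) : (theta N f)`_N = 0.
Proof. by rewrite coef_theta subrr. Qed.

Lemma size_rho_drop n q N (Y : {poly R n.+1}) :
  phomog q Y -> rho Y = 0 -> (size (rho (drop_poly N Y)) <= q)%N.
Proof.
move=> hY Y0; have e : 'X^N * rho (drop_poly N Y) = - rho (take_poly N Y).
  apply/eqP; rewrite -subr_eq0 opprK addrC -[X in X * _]rhoXn -rhoM -rhoD.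
  by rewrite ['X^_ * _]mulrC poly_take_drop Y0.
apply: (@size_XnM_le _ N); rewrite e size_polyN.
have h1 := size_rho (phomog_take N hY).
by rewrite (leq_trans h1) // leq_add2r size_take_poly.
Qed.

(* Cech argument on P^1: the two local lifts of r, regular at t = 0 and at
   t = infinity, differ by a cocycle, which is split as a derivative plus a
   multiple M of the generic polynomial; F collects the coefficients of M. *)
Lemma psi_surj n q (r : {poly R n}) :
  phomog q.+2 r -> (size r <= q.*2.+3)%N ->
  exists F s, [/\ koszul_num q F, phomog q.+2 s, (size s <= q.+3)%N
                & r = psi F - syzd s].
Proof.
move=> hr sr.
have [L1 [hL1 rL1 sL1]] := revlift hr; have [L [hL rL sL]] := revlift hL1.
set N := (q.+2 * n.+2 + q.+2 * n.+1)%N.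
have rrL : rho (rho L) = 'X^N * r by rewrite rL rhoM rhoXn rL1 mulrA -exprD.
set H := lam (lam r).
have hH : phomog q.+2 H by apply/phomog_lam/phomog_lam.
have rrH : rho (rho H) = r by rewrite /H !rho_lam.
set X := 'X^N * H - L.
have hX : phomog q.+2 X by apply: phomogB => //; apply: phomogXnM.
have [|E hE rX] := phomog_rho_eq0 (phomog_rho hX).
  by rewrite /X !(rhoB, rhoM, rhoXn) rrH rrL subrr.
set Y := gpoly n.+2 * lam E.
have hY : phomog q.+2 Y by apply/phomog_gpolyM/phomog_lam.
(* [theta N Y] cancels what one [rho] leaves of t X, so the remainder is a multiple of the generic
   polynomial. *)
have [||M hM eM] := @phomog_rho_eq0 _ _ q.+1 ('X * X - theta N Y).
- by apply: phomogB; [apply: phomogXM|apply: phomog_theta].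
- by rewrite rhoB rhoM rhoX rX /Y rho_thetaM rho_lam mulrA subrr.
have nN : (n.+2 <= N)%N by rewrite /N; lia.
(* The bound on r makes the coefficient of t^(N-1) in L vanish; hence t X has no term in t^N and the
   window lies in the kernel. *)
have sLN : (size L < N)%N by rewrite /N; move: sL sL1 sr; lia.
exists (window N M), (rho (drop_poly N Y)); split.
- apply: koszul_num_window => //; rewrite -eM coefB coefXM coef_theta_self subr0.
  case: (N =P 0%N) => // _; rewrite coefB coefXnM.
  have -> : (N.-1 < N)%N by lia.
  by rewrite nth_default ?subrr //; lia.
- exact/phomog_rho/phomog_drop.
- have rY : rho Y = 0 by rewrite /Y rhoM rho_gpoly mul0r.
  by rewrite (leq_trans (size_rho_drop N hY rY)).
rewrite psi_window // -eM syzd_rho linearB /= drop_theta rhoB rhoB opprK subrK.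
rewrite /X mulrBr mulrA -exprS linearB /= drop_polyXnMid.
rewrite drop_poly_eq0 ?subr0 ?rrH // mulrC.
have [->|L0] := eqVneq L 0; first by rewrite mul0r size_poly0.
by rewrite size_mulX // ltnS ltnW.
Qed.

Definition weyman_poly d N (C : {poly R d}) : {poly R d} :=
  'X * (gpoly d)^`() * C *+ 2 + gpoly d * theta N C.

Lemma gpolyM_weyman_poly d N (C : {poly R d}) :
  gpoly d * weyman_poly N C = theta N (gpoly d * (gpoly d * C)).
Proof. by rewrite /weyman_poly /theta !derivM; ring. Qed.

Lemma phomog_weyman_poly d q N (C : {poly R d}) :
  phomog q C -> phomog q.+1 (weyman_poly N C).
Proof.
move=> hC; apply: phomogD; last exact/phomog_gpolyM/phomog_theta.
apply: phomogMn; rewrite -add1n; apply: phomogM => //.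
exact/phomogXM/phomog_deriv/phomog_gpoly.
Qed.

(** Cutting P^2 C at t^N turns [theta N] into an honest derivative of the upper part ([drop_theta]),
    and [syzd_rho] recognises its image as a value of [syzd]. *)
Lemma psi_weyman_poly n q N (C : {poly R n.+2}) : (n.+2 <= N)%N -> phomog q C ->
  koszul_num q (window N (weyman_poly N C)) /\
  exists s, [/\ phomog q.+2 s, (size s <= q.+3)%N
              & psi (window N (weyman_poly N C)) = syzd s].
Proof.
move=> nN hC; split.
  apply: koszul_num_window => //; first exact: phomog_weyman_poly.
  by rewrite gpolyM_weyman_poly coef_theta_self.
set Y := gpoly n.+2 * (gpoly n.+2 * C).
have hY : phomog q.+2 Y by do 2!apply: phomog_gpolyM.
have rY : rho Y = 0 by rewrite /Y rhoM rho_gpoly mul0r.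
exists (- rho (drop_poly N Y)); split.
- exact/phomogN/phomog_rho/phomog_drop.
- by rewrite size_polyN (leq_trans (size_rho_drop N hY rY)).
rewrite psi_window // gpolyM_weyman_poly drop_theta.
rewrite /syzd rhoN !derivN rhoN mulNrn -opprD -/(syzd _).
by rewrite -[RHS]/(- syzd (rho (drop_poly N Y))) syzd_rho opprK.
Qed.

End Cech.

(** * The relations of the Weyman module *)

Section Den.
Variable k : fieldType.
Local Notation R n := {mpoly k[n.+1]}.

Lemma Delta1E d t (i j : 'I_d.+1) :
  Delta1 k d t i j = if (i + j == t.+1)%N then i%:R - j%:R else 0.
Proof.
have w (a b : 'I_d.+1) : wedge (dpow k a) (dpow k b) i j =
   ((i == a) && (j == b))%:R - ((i == b) && (j == a))%:R.
  by rewrite /wedge /dpow !mxE !big_ord1 !mxE !eqxx /= -!mulnb !natrM.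
rewrite /Delta1 summxE.
pose G (a b : 'I_d.+1) := if ((a + b == t.+1) && (b < a))%N
  then (a%:R - b%:R) * (((i == a) && (j == b))%:R - ((i == b) && (j == a))%:R) else 0 : k.
transitivity (\sum_(a < d.+1) \sum_(b < d.+1) G a b).
  apply: eq_bigr => a _; rewrite summxE [LHS]big_mkcond /=; apply: eq_bigr => b _.
  rewrite /G; case: ifP => // /andP[_ ba].
  by rewrite mxE w natrB // ltnW.
pose H (a b : 'I_d.+1) := if ((a + b == t.+1) && (b < a))%N then a%:R - b%:R else 0 : k.
transitivity (H i j - H j i).
  have hs (u v : 'I_d.+1) : \sum_(a < d.+1) \sum_(b < d.+1)
      H a b * ((u == a) && (v == b))%:R = H u v.
    rewrite (bigD1 u) //= (bigD1 v) //= !eqxx mulr1 big1 ?addr0; last first.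
      by move=> b /negPf; rewrite eq_sym => ->; rewrite mulr0.
    by rewrite big1 ?addr0 // => a /negPf; rewrite eq_sym => e;
      apply: big1 => b _; rewrite e mulr0.
  rewrite -(hs i j) -(hs j i) -sumrB; apply: eq_bigr => a _; rewrite -sumrB.
  apply: eq_bigr => b _; rewrite /G /H [(i == b) && _]andbC; case: ifP => _.
    by rewrite mulrBr.
  by rewrite !mul0r subrr.
rewrite /H [(j + i)%N]addnC; case: eqP => _ /=; last by rewrite subrr.
case: (ltngtP i j) => [_|_|->]; first by rewrite sub0r opprB.
  by rewrite subr0.
by rewrite !subrr.
Qed.

Lemma rhoMn n (f : {poly R n.+1}) m : rho (f *+ m) = rho f *+ m.
Proof. exact: rmorphMn. Qed.

(* An element of delta2 (weyman_space (x) Sym), with - C`_(N - t.+1) the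
   coefficient of Delta1 t. *)
Definition bil d N (C : {poly R d}) : {ffun 'I_d.+1 -> R d} :=
  [ffun i : 'I_d.+1 =>
    \sum_(j < d.+1) (j%:R - i%:R : k) *: ('X_j * C`_(N - (i + j)))].

Lemma delta2P d (M M' : 'M[k]_d.+1) (f : R d) (c : k) :
  delta2 (c *: M + M') f = c *: delta2 M f + delta2 M' f.
Proof.
apply/ffunP => i; rewrite !ffunE scaler_sumr -big_split; apply: eq_bigr => j _ /=.
by rewrite !mxE scalerDl scalerA.
Qed.

Lemma delta2_0 d (f : R d) : delta2 (0 : 'M[k]_d.+1) f = 0.
Proof. by apply/ffunP => i; rewrite !ffunE big1 // => j _; rewrite mxE scale0r. Qed.

Lemma bil_den d q N (C : {poly R d}) : (2 * d <= N)%N -> phomog q C ->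
  koszul_den (weyman_space k d) q (bil N C).
Proof.
move=> dN hC.
exists [seq (Delta1 k d t, - C`_(N - t.+1)) | t <- iota 0 (2 * d).-1].
  move=> _ /mapP[t ht ->] /=; split; last by rewrite rpredN; apply: hC.
  by apply: memv_span; apply: map_f.
rewrite big_map; apply/ffunP => i; rewrite ffunE sum_ffunE.
under [RHS]eq_bigr do rewrite ffunE; rewrite exchange_big /=.
apply: eq_bigr => j _.
have -> : iota 0 (2 * d).-1 = index_iota 0 (2 * d).-1 by rewrite /index_iota subn0.
case e : (i + j)%N => [|s].
  have [-> ->] : (i = 0 :> nat)%N /\ (j = 0 :> nat)%N by lia.
  rewrite subrr scale0r big1 // => t _.
  by rewrite Delta1E e /= scale0r.
under eq_bigr => t _.
  rewrite Delta1E e eqSS -[_ *: _](_ : (if t == s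
    then (j%:R - i%:R : k) *: ('X_j * C`_(N - s.+1)) else 0) = _); last first.
    rewrite eq_sym; case: eqP => [->|_]; last by rewrite scale0r.
    by rewrite mulrN scalerN -scaleNr opprB.
  over.
(* For s >= 2d - 1 the family contains no [Delta1 s], but then i = j = d and the scalar is 0. *)
rewrite -big_mkcond big_nat1_eq /=; case: ltnP => // sd.
have := ltn_ord i; have := ltn_ord j => hj hi.
have -> : i = j :> nat by lia.
by rewrite subrr scale0r.
Qed.

Lemma bilD d N (C C' : {poly R d}) (c : k) :
  bil N (c%:MP *: C + C') = c *: bil N C + bil N C'.
Proof.
apply/ffunP => i; rewrite !ffunE scaler_sumr -big_split; apply: eq_bigr => j _ /=.
by rewrite coefD coefZ mulrDr scalerDr mulrCA mul_mpolyC !scalerA mulrC.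
Qed.

Lemma bil0 d N : bil N (0 : {poly R d}) = 0.
Proof. by apply/ffunP => i; rewrite !ffunE big1 // => j _; rewrite coef0 mulr0 scaler0. Qed.

(** The generator [Delta1 t] with coefficient f comes from the single monomial C = -f t^(N-t-1). By
    2d <= N, distinct sums i + j read distinct coefficients of C. *)
Lemma den_bil d q N (F : {ffun 'I_d.+1 -> R d}) : (2 * d <= N)%N ->
  koszul_den (weyman_space k d) q F -> exists2 C, phomog q C & F = bil N C.
Proof.
move=> dN [s hs ->].
pose G (F : {ffun 'I_d.+1 -> R d}) := exists2 C, phomog q C & F = bil N C.
have G0 : G 0 by exists 0; rewrite ?bil0 //; apply: phomog0.
have GD c F1 F2 : G F1 -> G F2 -> G (c *: F1 + F2).
  move=> [C1 h1 ->] [C2 h2 ->]; exists (c%:MP *: C1 + C2); last by rewrite bilD.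
  apply: phomogD => // j; rewrite coefZ mul_mpolyC rpredZ //.
rewrite -/(G _) big_seq.
have GA F1 F2 : G F1 -> G F2 -> G (F1 + F2) by rewrite -{2}[F1]scale1r; apply: GD.
elim/big_ind: _ => // -[M f] /hs[/= hM hf].
set X := in_tuple [seq Delta1 k d t | t <- iota 0 (2 * d).-1].
rewrite (coord_span (X := X) hM).
elim/big_ind: _ => [|M1 M2 h1 h2|i _]; first by rewrite delta2_0.
  by rewrite -[M1]scale1r delta2P scale1r; apply: GA.
rewrite -[_ *: _]addr0 delta2P delta2_0 addr0 -[_ *: _]addr0; apply: GD => //.
have := mem_nth 0 (ltn_ord i : (i < size X)%N).
move=> /mapP[t ht ->].
exists (- f *: 'X^(N - t.+1)).
  by move=> j; rewrite coefZ coefXn; case: eqP => _; rewrite ?mulr1 ?mulr0 ?rpred0 ?rpredN.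
apply/ffunP => a; rewrite !ffunE; apply: eq_bigr => j _.
rewrite Delta1E coefZ coefXn.
have -> : (N - (a + j) == N - t.+1)%N = (a + j == t.+1)%N.
  move: ht; rewrite mem_iota => ht; have := ltn_ord a; have := ltn_ord j; lia.
case: eqP => _; last by rewrite mulr0 mulr0 scaler0 scale0r.
by rewrite mulr1 mulrN scalerN -scaleNr opprB.
Qed.

Lemma coefM_le (A : nzRingType) d m (P M : {poly A}) :
  (forall j, (d < j)%N -> P`_j = 0) -> (d <= m)%N ->
  (P * M)`_m = \sum_(j < d.+1) P`_j * M`_(m - j).
Proof.
move=> hP dm; rewrite coefM [RHS](big_ord_widen m.+1 (fun j => P`_j * M`_(m - j))) ?ltnS //.
rewrite [RHS]big_mkcond; apply: eq_bigr => j _; rewrite ltnS.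
by case: leqP => // /hP ->; rewrite mul0r.
Qed.

(** The term X_j C_(N-i-j) gets weight 2j from the derivative of P_d and (N - i - j) - N from
    [theta N]; the total j - i is, up to sign, the weight in [Delta1]. *)
Lemma window_weyman_poly d N (C : {poly R d}) : (2 * d <= N)%N ->
  window N (weyman_poly N C) = bil N C.
Proof.
move=> dN; apply/ffunP => i; rewrite !ffunE /weyman_poly coefD coefMn.
have hi := ltn_ord i; have dNi : (d <= N - i)%N by lia.
rewrite coef_gpolyM // (coefM_le (d := d)) //; last first.
  by move=> j dj; rewrite coefXM; case: j dj => // j dj;
    rewrite coef_deriv coef_gpoly xv_ge // mul0rn.
rewrite -sumrMnl -big_split; apply: eq_bigr => j _ /=.
have hj := ltn_ord j.
have -> : ('X * (gpoly d)^`())`_j = 'X_j *+ j :> R d.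
  rewrite coefXM xvX -coef_gpoly; case: (nat_of_ord j) => // j'.
  by rewrite coef_deriv.
rewrite coef_theta -subnDA; set c := C`_ _; set x : R d := 'X_j.
rewrite mulrBr !mulrnAr !mulrnAl scalerBl !scaler_nat; set y := x * c.
have {2}-> : N = (N - (i + j) + (i + j))%N by lia.
rewrite [y *+ (N - _ + _)]mulrnDr [y *+ (i + j)]mulrnDr mulr2n.
move: (y *+ i) (y *+ j) (y *+ (N - (i + j))) => y1 y2 y3; ring.
Qed.

(* Pairing both local lifts of s with the two halves of gpoly * fhat F gives
   gpoly * (fhat F + boundary terms) = theta (gpoly * Z), which forces gpoly to
   divide Z. *)
Lemma psi_inj n q (F : {ffun 'I_n.+3 -> R n.+2}) (s : {poly R n.+1}) :
  koszul_num q F -> phomog q.+2 s -> (size s <= q.+3)%N -> psi F = syzd s ->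
  koszul_den (weyman_space k n.+2) q F.
Proof.
move=> /koszul_num_fhat[hF eF] hs ss ePsi.
set X := gpoly n.+2 * fhat F in eF.
have hX : phomog q.+2 X by apply/phomog_gpolyM/phomog_fhat.
have rX : rho X = 0 by rewrite /X rhoM rho_gpoly mul0r.
have eX := split_at eF; rewrite -/X in eX.
set Xlo := take_poly n.+2 X in eX; set Phi := drop_poly n.+3 X in eX.
have ePhi : rho (rho Phi) = syzd s by rewrite -ePsi.
have hPhi : phomog q.+2 Phi by apply: phomog_drop.
have rlo : rho (rho Xlo) = - ('X^(n.+3) * syzd s).
  apply/eqP; rewrite -subr_eq0 opprK -ePhi -[X in X * _]rhoXn -[X in rho X * _]rhoXn.
  by rewrite -!(rhoM, rhoD) -eX rX rmorph0.
set Sp := lam s; have hSp : phomog q.+2 Sp by apply: phomog_lam.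
have rSp : rho Sp = s by apply: rho_lam.
have [N eN] : {N : nat | N = (q.+2 * n.+2)%N} by exists (q.+2 * n.+2)%N.
have nN : (n.+2 <= N)%N by rewrite eN; lia.
have [Sm [hSm]] := revlift hs; rewrite -eN => rSm sSm.
have [||Y hY eY] := @phomog_rho_eq0 _ _ q.+1 ('X^N * Sp - Sm).
- by apply: phomogB => //; apply: phomogXnM.
- by rewrite rhoB rhoM rhoXn rSp rSm subrr.
(* The chart t = 0: the derivative of the lift of s cancels the upper half of X under the double
   [rho]. *)
have [||A [B [hA hB eAB]]] := @rho_rho_eq0 _ _ q.+1 (Phi + Sp^`()).
- by apply: phomogD => //; apply: phomog_deriv.
- by rewrite rhoD rhoD ePhi -rSp syzd_rho addNr.
(* The chart at infinity: Sm stands for Sm / t^N, so [theta N] takes the place of the derivative. *)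
set U := theta N Sm - 'X^(N - n.+2) * Xlo.
have hU : phomog q.+2 U.
  by apply: phomogB; [apply: phomog_theta|apply/phomogXnM/phomog_take].
have rS : rho (rho (theta N Sm)) = - ('X^(N.+1) * syzd s).
  have e1 : rho (rho Sm^`()) = - syzd ('X^N * s) by rewrite -rSm syzd_rho opprK.
  have e2 : rho (rho Sm) = 'X^N * rho s by rewrite rSm rhoM rhoXn.
  rewrite /theta rhoB rhoMn rhoB rhoMn e2 !rhoM !rhoX e1 /syzd rhoM rhoXn derivM derivXn.
  rewrite derivM derivXn rhoD !rhoM rhoMn !rhoXn.
  case: (N) => [|N'] /=; rewrite ?mulr0n ?exprS ?expr0 ?rhoX; ring.
have rU : rho (rho U) = 0.
  rewrite /U rhoB rhoB rS !(rhoM, rhoXn) rlo mulrN opprK mulrA -exprD.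
  have -> : (N - n.+2 + n.+3 = N.+1)%N by rewrite eN; lia.
  exact: addNr.
have sU : (size U <= N)%N.
  rewrite size_add_leq ?size_polyN ?size_theta //.
    by rewrite (leq_trans sSm) // eN; lia.
  rewrite (leq_trans (size_XnM_leq _ _)) //.
  rewrite (leq_trans (leq_add (leqnn _) (size_take_poly _ _))) //; rewrite eN; lia.
have [|E hE eE] := phomog_rho_eq0 (phomog_rho hU); first exact: rU.
have sE : (size E <= N + q.+2 - n.+1)%N.
  apply: (@size_gpolyM_leq _ n.+1); rewrite -eE (leq_trans (size_rho hU)) //.
  by rewrite subnKC ?leq_add2r //; lia.
(* K is the exponent of the lift of E at infinity; the extra power of t in N' matches the factor t
   in [rho_thetaM]. *)
have [K eK] : {K : nat | K = (q.+1 * n.+2)%N} by exists (q.+1 * n.+2)%N.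
have [L [hL]] := revlift hE; rewrite -eK => rL sL.
have [N' eN'] : {N' : nat | N' = (N + K.+1)%N} by exists (N + K.+1)%N.
have sL' : (size L <= N' - n.+1)%N.
  by rewrite (leq_trans sL) // (leq_trans (leq_add sE (leqnn _))) // eN' eN eK; lia.
have [||Bm hBm eBm] := @phomog_rho_eq0 _ _ q.+1 ('X^(K.+1) * U - theta N' (gpoly n.+2 * L)).
- by apply: phomogB; [apply: phomogXnM|apply/phomog_theta/phomog_gpolyM].
- rewrite rhoB rhoM rhoXn eE rho_thetaM rL exprS; ring.
have sBm : (size Bm <= N' - n.+2)%N.
  apply: (@size_gpolyM_leq _ n.+2); rewrite -eBm subnKC; last by rewrite eN' eN; lia.
  apply: size_add_leq.
    by rewrite (leq_trans (size_XnM_leq _ _)) // addnC eN' leq_add2r.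
  rewrite size_polyN; apply: size_theta.
  rewrite (leq_trans (size_gpolyM_le _)) // (leq_trans (leq_add (leqnn _) sL')) //.
  by rewrite eN' eN; lia.
set Z := 'X^N' * A - L - 'X^(K.+1) * Y.
set W := 'X^(N' - n.+2) * fhat F - 'X^(N'.+1) * B + Bm.
have hZ : phomog q.+1 Z.
  by apply: phomogB; [apply: phomogB => //|]; apply: phomogXnM.
have eW : gpoly n.+2 * W = theta N' (gpoly n.+2 * Z).
  have a1 : 'X^(N'.+1) * Phi = theta N' ('X^N' * (gpoly n.+2 * A))
      + 'X^(N'.+1) * (gpoly n.+2 * B) - theta N' ('X^N' * Sp).
    rewrite !theta_Xn -mulrDr -eAB mulrDr; ring.
  have a2 : 'X^(K.+1) * U = theta N' ('X^(K.+1) * Sm) - 'X^(N' - n.+2) * Xlo.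
    rewrite /U eN' mulrBr theta_XnM mulrA -exprD; congr (_ - 'X^_ * _).
    by lia.
  have a3 : 'X^(N' - n.+2) * X = 'X^(N' - n.+2) * Xlo + 'X^(N'.+1) * Phi.
    rewrite {1}eX mulrDr mulrA -exprD; congr (_ + 'X^_ * _).
    by rewrite eN' eN; lia.
  have a4 : 'X^(K.+1) * (gpoly n.+2 * Y) = 'X^N' * Sp - 'X^(K.+1) * Sm.
    by rewrite -eY mulrBr mulrA -exprD addnC -eN'.
  have a5 : gpoly n.+2 * W = 'X^(N' - n.+2) * X
     - 'X^(N'.+1) * (gpoly n.+2 * B) + gpoly n.+2 * Bm.
    by rewrite /W /X; ring.
  have a6 : gpoly n.+2 * Z = 'X^N' * (gpoly n.+2 * A) - gpoly n.+2 * L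
     - 'X^(K.+1) * (gpoly n.+2 * Y).
    by rewrite /Z; ring.
  rewrite a5 a3 a1 -eBm a2 a6 a4 !thetaB; ring.
(* [rho] kills the left side of [eW] and turns the right side into t P_(n+1) rho(Z). *)
have rZ : rho Z = 0.
  have := congr1 rho eW; rewrite rhoM rho_gpoly mul0r rho_thetaM => /esym/eqP.
  by rewrite mulf_eq0 mulf_eq0 polyX_eq0 (negPf (gpoly_neq0 _ _)) => /eqP.
have [C hC eC] := phomog_rho_eq0 hZ rZ.
have dN' : (2 * n.+2 <= N')%N by rewrite eN' eN eK; lia.
have {}eW : W = weyman_poly N' C.
  by apply: (@gpolyI _ n.+2); rewrite eW eC gpolyM_weyman_poly.
suff -> : F = bil N' C by apply: bil_den.
(* Between t^(N'-n-2) and t^N' only F remains: the term with B starts above this range and Bm ends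
   below it. *)
rewrite -window_weyman_poly // -eW; apply/ffunP => i; rewrite !ffunE /W.
have hi := ltn_ord i.
rewrite !(coefD, coefN, coefXnM).
have -> : (N' - i < N' - n.+2)%N = false by lia.
have -> : (N' - i < N'.+1)%N by lia.
rewrite oppr0 addr0 [Bm`_ _]nth_default; last by rewrite (leq_trans sBm) //; lia.
rewrite addr0 -coef_fhat; congr (_`_ _); lia.
Qed.

End Den.

(** * Hermite reciprocity *)

(** The contraction by the s-th coordinate under Hermite reciprocity: the coefficient of t^s in the
    v-free Koszul differential of a polynomial constant in t. *)
HB.lock Definition cop (k : fieldType) n (s : nat) (f : {mpoly k[n.+2]}) : {mpoly k[n.+1]} :=
  (gpoly n * rho0 f)`_s.
Arguments cop {k n} s f.

(* Since the operators cop s anticommute and have square zero, this is an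
   alternating form in l; it identifies (R_n)_d with /\^n k^(n+d). *)
Fixpoint hermite (k : fieldType) n (l : seq nat) : {mpoly k[n.+1]} -> k :=
  match n return {mpoly k[n.+1]} -> k with
  | 0%N => fun f => if l is [::] then f.@[fun=> 1] else 0
  | n'.+1 => fun f => if l is x :: l' then hermite l' (cop x f) else 0
  end.

Definition desc m (S : {set 'I_m}) : seq nat := rev [seq val i | i <- enum S].

(** The position of s in the descending list of s |: S, hence the number of transpositions that
    carry it there from the front. *)
Definition ksgn m (s : 'I_m) (S : {set 'I_m}) : nat := #|[set j in S | (s < j)%N]|.

(** * Inserting an element into a descending list *)

Section DescLists.
Variable m : nat.
Implicit Types (s : 'I_m) (S : {set 'I_m}).

Lemma enum_split s : exists p1 p2, [/\ enum 'I_m = p1 ++ s :: p2,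
  {in p1, forall j : 'I_m, (j < s)%N} & {in p2, forall j : 'I_m, (s < j)%N}].
Proof.
have := mem_enum 'I_m s; rewrite inE => /splitPr e.
case: e (val_enum_ord m) => p1 p2 e; exists p1, p2; split=> //.
  move=> j jp; have : sorted ltn [seq val i | i <- p1 ++ s :: p2] by rewrite e iota_ltn_sorted.
  rewrite sorted_map (sorted_pairwise (relpre_trans ltn_trans)) pairwise_cat.
  by case/andP => /allrelP h _; apply: h; rewrite ?inE ?eqxx.
move=> j jp; have : sorted ltn [seq val i | i <- p1 ++ s :: p2] by rewrite e iota_ltn_sorted.
rewrite sorted_map (sorted_pairwise (relpre_trans ltn_trans)) pairwise_cat /=.
by case/and3P => _ _ /andP[/allP h _]; apply: h.
Qed.

Lemma enum_filter S : enum S = filter (mem S) (enum 'I_m).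
Proof. by rewrite {1}/enum_mem enumT. Qed.

Lemma desc_setU1 s S : s \notin S -> exists l1 l2,
  [/\ desc S = l1 ++ l2, desc (s |: S) = l1 ++ val s :: l2 & size l1 = ksgn s S].
Proof.
move=> sS; have [p1 [p2 [e h1 h2]]] := enum_split s.
exists (rev [seq val i | i <- filter (mem S) p2]), (rev [seq val i | i <- filter (mem S) p1]).
split.
- rewrite /desc enum_filter e filter_cat /= (negPf sS) map_cat rev_cat.
  by rewrite -rev_cat.
- rewrite /desc enum_filter e filter_cat /= in_setU1 eqxx /=.
  have -> : filter (mem (s |: S)) p1 = filter (mem S) p1.
    apply: eq_in_filter => j /h1 js; rewrite /= in_setU1.
    by rewrite -val_eqE (ltn_eqF js).
  have -> : filter (mem (s |: S)) p2 = filter (mem S) p2.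
    apply: eq_in_filter => j /h2 js; rewrite /= in_setU1.
    by rewrite -val_eqE (gtn_eqF js).
  by rewrite map_cat rev_cat /= rev_cons cat_rcons.
rewrite size_rev size_map size_filter /ksgn cardE enum_filter.
rewrite size_filter e count_cat /= inE (negPf sS) /= add0n.
rewrite [X in (_ = X + _)%N](_ : _ = 0)%N ?add0n.
  by apply: eq_in_count => j /h2 js; rewrite /= inE js andbT.
apply/eqP; rewrite -leqn0 leqNgt -has_count; apply/hasP => -[j /h1 js].
by rewrite /= inE [(s < j)%N]ltnNge (ltnW js) andbF.
Qed.

Lemma mem_desc s S : s \in S -> exists l1 l2, desc S = l1 ++ val s :: l2.
Proof.
move=> sS; have : val s \in desc S by rewrite mem_rev map_f // mem_enum.
by move/splitPr => [l1 l2]; exists l1, l2.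
Qed.

End DescLists.

Section Hermite.
Variable k : fieldType.
Hypothesis hk : 2%N \notin [pchar k].
Local Notation R n := {mpoly k[n.+1]}.

Lemma copP n s c (f h : R n.+1) : cop s (c *: f + h) = c *: cop s f + cop s h.
Proof.
rewrite !cop.unlock -[c *: f]mul_mpolyC rmorphD rmorphM /= rho0C mulrDr coefD.
by rewrite mulrCA coefCM mul_mpolyC.
Qed.

Lemma coef_gpoly_rho n (f : R n.+1) s : (gpoly n * rho f%:P)`_s = cop s f.
Proof. by rewrite rhoC cop.unlock. Qed.

Definition rho2 n (f : R n.+2) : {poly {poly R n}} := map_poly (@rho0 k n) (rho0 f).

Lemma rho0_xv0 n : rho0 (xv n.+1 0) = - ((xv n 0)%:P * 'X) :> {poly R n}.
Proof. by rewrite -rhoC rho_xv0. Qed.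

Lemma rho0_xvS n j :
  rho0 (xv n.+1 j.+1) = (xv n j)%:P - (xv n j.+1)%:P * 'X :> {poly R n}.
Proof. by rewrite -rhoC rho_xvS. Qed.

(** With two separate variables x and y, applying [rho0] twice sends X_j to X_(j-2) - (x + y)
    X_(j-1) + x y X_j, which is symmetric. The maps are abstracted behind their morphism laws so
    that [ring] meets only atoms. *)
Lemma swap_rho2 n (f : R n.+2) : swapXY (rho2 f) = rho2 f.
Proof.
pose mr := map_poly (@rho0 k n).
pose sw (u : {poly {poly R n}}) := swapXY u.
have mrB p q : mr (p - q) = mr p - mr q by apply: rmorphB.
have mrD p q : mr (p + q) = mr p + mr q by apply: rmorphD.
have mrN p : mr (- p) = - mr p by apply: rmorphN.
have mrM p q : mr (p * q) = mr p * mr q by apply: rmorphM.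
have mrC c : mr c%:P = (rho0 c)%:P by apply: map_polyC.
have mrX : mr 'X = 'X by apply: map_polyX.
have swB p q : sw (p - q) = sw p - sw q by apply: rmorphB.
have swD p q : sw (p + q) = sw p + sw q by apply: rmorphD.
have swN p : sw (- p) = - sw p by apply: rmorphN.
have swM p q : sw (p * q) = sw p * sw q by apply: rmorphM.
have swX : sw 'X = ('X)%:P by apply: swapXY_X.
have swY : sw ('X)%:P = 'X by apply: swapXY_Y.
have swC c : sw c%:P%:P = c%:P%:P by rewrite /sw swapXY_polyC map_polyC.
rewrite /rho2 -/mr -/(sw _); move: mr sw mrB mrD mrN mrM mrC mrX swB swD swN swM swX swY swC.
move=> mr sw mrB mrD mrN mrM mrC mrX swB swD swN swM swX swY swC.
elim/mpoly_alg_ind: f => [c|i|p q hp hq|p q hp hq].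
- by rewrite rho0C mrC rho0C swC.
- have mA j : mr (xv n.+1 j.+1)%:P = (xv n j)%:P%:P - (xv n j.+1)%:P%:P * ('X)%:P.
    by rewrite mrC rho0_xvS polyCB polyCM.
  have mA0 : mr (xv n.+1 0)%:P = - ((xv n 0)%:P%:P * ('X)%:P).
    by rewrite mrC rho0_xv0 polyCN polyCM.
  have sC j := swC (xv n j).
  rewrite xvX; case: (nat_of_ord i) => [|[|j]].
  + rewrite rho0_xv0 mrN mrM mrX; move: (xv n.+1 0)%:P mA0 (sC 0%N) => A ->.
    move: (xv n 0)%:P%:P => c ec; rewrite swN swM swN swM ec swY swX; ring.
  + rewrite rho0_xvS mrB mrM mrX; move: mA0 (mA 0%N) (sC 0%N) (sC 1%N).
    move: (xv n.+1 0)%:P (xv n.+1 1)%:P => A B -> ->.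
    move: (xv n 0)%:P%:P (xv n 1)%:P%:P => c c' ec ec'.
    rewrite swB swM swN swB !swM ec ec' swY swX; ring.
  rewrite rho0_xvS mrB mrM mrX; move: (mA j) (mA j.+1) (sC j) (sC j.+1) (sC j.+2).
  move: (xv n.+1 j.+1)%:P (xv n.+1 j.+2)%:P => A B -> ->.
  move: (xv n j)%:P%:P (xv n j.+1)%:P%:P (xv n j.+2)%:P%:P => c c' c'' ec ec' ec''.
  rewrite swB swM !swB !swM ec ec' ec'' swY swX; ring.
- by rewrite rmorphD mrD swD hp hq.
by rewrite rmorphM mrM swM hp hq.
Qed.

(** The double contraction is the coefficient of x^s y^s' in (y - x) P_n(x) P_n(y) times the
    symmetric [rho2 f]; only the factor y - x changes sign under the exchange. *)
Lemma cop_anti n s s' (f : R n.+2) : cop s (cop s' f) = - cop s' (cop s f).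
Proof.
pose B : {poly {poly R n}} := (gpoly n)%:P * (('X - ('X)%:P) * map_poly polyC (gpoly n) * rho2 f).
have hB a b : cop a (cop b f) = B`_b`_a.
  rewrite cop.unlock coefCM.
  suff -> : rho0 (gpoly n.+1 * rho0 f)`_b = (('X - ('X)%:P) * map_poly polyC (gpoly n) * rho2 f)`_b by [].
  rewrite -coef_map rmorphM /= -/(rho2 f) -map_rho_gpoly.
  suff -> : map_poly (rho0 (n:=n)) (gpoly n.+1) = map_poly (@rho k n \o polyC) (gpoly n.+1) by [].
  by apply: eq_map_poly => c /=; rewrite rhoC.
rewrite !hB; have e : swapXY B = - B.
  have e1 : swapXY ('X - ('X)%:P) = ('X)%:P - 'X :> {poly {poly R n}}.
    by rewrite rmorphB /= swapXY_X swapXY_Y.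
  rewrite /B rmorphM rmorphM rmorphM /= swap_rho2 e1 swapXY_map_polyC swapXY_polyC.
  ring.
by rewrite -[B in LHS]opprK -e !coefN coef_swapXY.
Qed.

Lemma cop_sq n s (f : R n.+2) : cop s (cop s f) = 0.
Proof.
have two : (2%:R : k) != 0 by apply: contra hk => h; rewrite inE /= h.
have : (2%:R : k) *: cop s (cop s f) = 0.
  by rewrite scaler_nat mulr2n {1}cop_anti addNr.
by move/eqP; rewrite scaler_eq0 (negPf two) => /eqP.
Qed.

Lemma hermiteP n l c (f h : R n) : hermite l (c *: f + h) = c * hermite l f + hermite l h.
Proof.
elim: n l c f h => [|n ih] [|x l] c f h /=; rewrite ?mulr0 ?addr0 //.
  by rewrite mevalD mevalZ.
by rewrite copP ih.
Qed.

Lemma hermite0 n l : hermite l (0 : R n) = 0.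
Proof. by have := hermiteP l 1 0 (0 : R n); rewrite scaler0 addr0 mul1r -{1}[hermite l 0]addr0 => /addrI. Qed.

Lemma hermiteD n l (f h : R n) : hermite l (f + h) = hermite l f + hermite l h.
Proof. by rewrite -[f]scale1r hermiteP scale1r mul1r. Qed.

Lemma hermiteZ n l c (f : R n) : hermite l (c *: f) = c * hermite l f.
Proof. by rewrite -[_ *: f]addr0 hermiteP hermite0 addr0. Qed.

Lemma hermiteN n l (f : R n) : hermite l (- f) = - hermite l f.
Proof. by rewrite -scaleN1r hermiteZ mulN1r. Qed.

Lemma hermite_swap n x y l (f : R n) : hermite (x :: y :: l) f = - hermite (y :: x :: l) f.
Proof.
case: n f => [|[|n]] f /=; rewrite ?oppr0 //.
by rewrite cop_anti hermiteN.
Qed.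

Lemma hermite_rot n x l1 l2 (f : R n) :
  hermite (x :: l1 ++ l2) f = (-1) ^+ size l1 * hermite (l1 ++ x :: l2) f.
Proof.
elim: l1 n f => [|y l1 ih] n f; first by rewrite expr0 mul1r.
rewrite cat_cons hermite_swap exprS -mulrA mulN1r; congr (- _).
case: n f => [|n] f /=; first by rewrite mulr0.
exact: ih.
Qed.

Lemma hermite_dup n x l1 l2 (f : R n) : hermite (x :: l1 ++ x :: l2) f = 0.
Proof.
elim: l1 n f => [|y l1 ih] n f.
  case: n f => [|[|n]] f //=.
  by rewrite cop_sq hermite0.
rewrite cat_cons hermite_swap; case: n f => [|n] f; rewrite ?oppr0 //.
by rewrite [hermite _ _]ih oppr0.
Qed.

Lemma hermite_desc_in n m (s : 'I_m) (S : {set 'I_m}) (f : R n) : s \in S -> hermite (val s :: desc S) f = 0.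
Proof. by case/mem_desc => l1 [l2 ->]; apply: hermite_dup. Qed.

Lemma hermite_desc_notin n m (s : 'I_m) (S : {set 'I_m}) (f : R n) : s \notin S ->
  hermite (val s :: desc S) f = (-1) ^+ ksgn s S * hermite (desc (s |: S)) f.
Proof.
by case/desc_setU1 => l1 [l2 [-> -> <-]]; apply: hermite_rot.
Qed.

Lemma homog_cop n d s (f : R n.+1) : f \is d.-homog -> cop s f \is d.+1.-homog.
Proof.
by move=> hf; rewrite cop.unlock; apply: phomog_gpolyM; apply: (phomog_rho0 hf).1.
Qed.

Lemma size_gpoly_rho0 n d (f : R n.+1) : f \is d.-homog -> (size (gpoly n * rho0 f)%R <= (n + d).+1)%N.
Proof.
move=> hf; rewrite (leq_trans (size_gpolyM_le _)) // -addnS leq_add2l.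
exact: (phomog_rho0 hf).2.
Qed.

Lemma cop_big n d s (f : R n.+1) : f \is d.-homog -> (n + d < s)%N -> cop s f = 0.
Proof.
move=> hf ns; rewrite cop.unlock nth_default // (leq_trans (size_gpoly_rho0 hf)) //.
Qed.

(** If all contractions vanish, f is a multiple of P_(n+1), which has positive degree in t, whereas
    f does not involve t. *)
Lemma cop_eq0 n (f : R n.+1) : (forall s, cop s f = 0) -> f = 0.
Proof.
move=> h; have : gpoly n * rho f%:P = 0.
  by apply/polyP => s; rewrite coef_gpoly_rho h coef0.
move/eqP; rewrite mulf_eq0 (negPf (gpoly_neq0 _ _)) => /eqP /rho_eq0[q eq].
have [q0|q0] := eqVneq q 0.
  by apply/eqP; rewrite -polyC_eq0 eq q0 mulr0.
have := size_polyC_leq1 f; rewrite eq size_gpolyM //.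
by move: q0; rewrite -size_poly_gt0; lia.
Qed.

(** Alternation transfers the hypothesis to every contraction of f, and [cop_eq0] closes the
    induction. For n = 0 a form in one variable is determined by its value at 1. *)
Lemma hermite_inj g n d (f : R n) : (n + d = g.+1)%N -> f \is d.-homog ->
  (forall S : {set 'I_g.+1}, #|S| = n -> hermite (desc S) f = 0) -> f = 0.
Proof.
elim: n d f => [|n ih] d f nd hf h.
  have := h set0 (cards0 _); rewrite /desc enum_set0 /= => h0.
  pose M : 'X_{1..1} := [multinom d | i < 1].
  rewrite (mpolyE f); have e m : m \in msupp f -> m = M.
    move/dhomogP: hf => /[apply] /= hm; apply/mnmP => i; rewrite mnmE -hm mdegE.
    by rewrite big_ord1 ord1.
  rewrite big_seq (eq_bigr (fun=> f@_M *: 'X_[M])); last first.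
    by move=> m /e ->.
  suff -> : f@_M = 0.
    by rewrite big1 // => m _; rewrite scale0r.
  move: h0; rewrite mevalE.
  rewrite (eq_bigr (fun m => f@_m)); last first.
    by move=> m _; rewrite big1 ?mulr1 // => i _; rewrite expr1n.
  case: (boolP (M \in msupp f)) => hm; last by rewrite memN_msupp_eq0.
  rewrite (bigD1_seq _ hm (msupp_uniq f)) /= big1_seq ?addr0 // => m /andP[/eqP m1 /e //].
apply: cop_eq0 => s; case: (ltnP s g.+1) => sg; last by apply: (cop_big hf); lia.
apply: (ih d.+1); [lia|exact: homog_cop|move=> S cS].
have e : hermite (desc S) (cop s f) = hermite (val (Ordinal sg) :: desc S) f by [].
rewrite e; case: (boolP (Ordinal sg \in S)) => hs; first exact: hermite_desc_in.
by rewrite hermite_desc_notin // h ?mulr0 // cardsU1 hs cS.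
Qed.

(** Dimension count: forms of degree d in n + 1 variables and n-subsets of a set with n + d elements
    are equally numerous, so injectivity suffices. *)
Lemma hermite_surj g n d (v : {set 'I_g.+1} -> k) : (n + d = g.+1)%N ->
  exists2 f : R n, f \is d.-homog & forall S : {set 'I_g.+1}, #|S| = n -> hermite (desc S) f = v S.
Proof.
move=> nd; pose I := {S : {set 'I_g.+1} | #|S| == n}.
pose N := #|{: I}|.
have cI : N = 'C(d + n, d).
  rewrite /N card_sig -(cardsE (fun A : {set 'I_g.+1} => #|A| == n)) card_draws card_ord.
  by rewrite -nd addnC -[RHS]bin_sub ?leq_addr // addKn.
pose F (f : dhomog n.+1 k d) : 'rV[k]_N := \row_i hermite (desc (val (enum_val i))) (val f).
have Flin : linear F.
  by move=> c f h; apply/rowP => i; rewrite !mxE linearP /= hermiteP.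
pose FL := GRing.isLinear.Build _ _ _ _ F Flin.
pose Fl : {linear dhomog n.+1 k d -> 'rV[k]_N} := HB.pack F FL.
pose H := linfun Fl.
have kH : lker H == 0%VS.
  apply/lker0P => f h; rewrite !lfunE /= => efh.
  apply/val_inj/eqP; rewrite -subr_eq0; apply/eqP.
  apply: (@hermite_inj g n d) => //.
    by apply: rpredB; apply: dhomog_is_dhomog.
  move=> S /eqP cS; have := congr1 (fun M : 'rV_N => M 0 (enum_rank (exist _ S cS : I))) efh.
  rewrite !mxE !enum_rankK /= => e.
  by rewrite -scaleN1r addrC hermiteP e mulN1r addNr.
have : limg H = fullv.
  apply/eqP; rewrite eqEdim subvf /= dimvf.
  have := limg_ker_dim H fullv; rewrite (eqP kH) capv0 dimv0 add0n => ->.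
  by rewrite dimvf /dim /= mul1n cI.
move=> e; have : (\row_i v (val (enum_val i)) : 'rV[k]_N) \in limg H by rewrite e memvf.
case/memv_imgP => f _; rewrite lfunE /= => ef.
exists (val f); first exact: dhomog_is_dhomog.
move=> S /eqP cS; have := congr1 (fun M : 'rV_N => M 0 (enum_rank (exist _ S cS : I))) ef.
by rewrite !mxE !enum_rankK.
Qed.

End Hermite.

(** * The Koszul differential under Hermite reciprocity *)

Section KoszulDifferential.
Variables (m : nat) (A : comNzRingType) (x : 'I_m -> A).
Implicit Types (s : 'I_m) (S : {set 'I_m}) (w : {set 'I_m} -> A).

(** Contraction with the vector of the x_s, on coordinates indexed by subsets: the coordinate at s
    |: S contributes to the one at S. *)
Definition kd w S : A := \sum_(s | s \notin S) (-1) ^+ ksgn s S * (x s * w (s |: S)).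

Lemma ksgn_setU1 s s' S : s \notin S -> ksgn s' (s |: S) = (ksgn s' S + (s' < s))%N.
Proof.
move=> sS; rewrite /ksgn; case: (ltnP s' s) => ss.
  rewrite (_ : [set j in s |: S | _] = s |: [set j in S | (s' < j)%N]); last first.
    by apply/setP => j; rewrite !inE; case: eqP => // ->; rewrite ss.
  by rewrite cardsU1 inE (negPf sS) addnC.
rewrite addn0; congr #|pred_of_set _|; apply/setP => j; rewrite !inE.
by case: (j =P s) => [->|_] //=; rewrite ltnNge ss /= andbF.
Qed.

Lemma kd_kd w S : kd (kd w) S = 0.
Proof.
pose F s s' := (-1) ^+ (ksgn s S + ksgn s' S + (s' < s))%N * (x s * x s' * w (s' |: (s |: S))).
pose P s s' := [&& s \notin S, s' \notin S & s != s'].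
have eF : kd (kd w) S = \sum_s \sum_(s' | P s s') F s s'.
  rewrite /kd big_mkcond; apply: eq_bigr => s _; case: ifPn => sS; last first.
    by rewrite big_pred0 // => s'; rewrite /P (negPf sS).
  rewrite !mulr_sumr; apply: eq_big => s'.
    by rewrite /P sS !inE negb_or eq_sym andbC.
  rewrite !inE negb_or => /andP[_ s'S]; rewrite /F ksgn_setU1 // !exprD.
  by move: (_ ^+ ksgn s S) (_ ^+ ksgn s' S) (_ ^+ (s' < s)%N) (w _) => a b c d; ring.
have FC s s' : P s s' -> F s' s = - F s s'.
  move=> /and3P[_ _ ss]; rewrite /F [x s' * _]mulrC setUCA [(ksgn s' S + _)%N]addnC -mulNr.
  congr (_ * _); move: ss; rewrite neq_ltn => /orP[] ss; rewrite ss ltnNge (ltnW ss) /=.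
    by rewrite addn0 addn1 exprS mulN1r.
  by rewrite addn0 addn1 exprS mulN1r opprK.
rewrite eF.
have -> : \sum_s \sum_(s' | P s s') F s s' =
    \sum_s \sum_(s' | P s s' && (s < s')%N) F s s' + \sum_s \sum_(s' | P s s' && (s' < s)%N) F s s'.
  rewrite -big_split; apply: eq_bigr => s _ /=; rewrite (bigID (fun s' : 'I_m => s < s')%N) /=.
  congr (_ + _); apply: eq_bigl => s'; rewrite /P -leqNgt ltn_neqAle -val_eqE [val s' == _]eq_sym.
  by case: (s \notin S) => //=; case: (s' \notin S) => //=; rewrite andbA andbb.
rewrite [X in _ + X](exchange_big_dep predT) //= -big_split; apply: big1 => s _ /=.
rewrite [X in _ + X](eq_bigl (fun s' => P s s' && (s < s')%N)); last first.
  by move=> s'; rewrite /P eq_sym andbCA.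
by rewrite -big_split; apply: big1 => s' /andP[h _] /=; rewrite (FC s s' h) addrN.
Qed.

End KoszulDifferential.

(* The parts of the Koszul differential of degree 0 and 1 in v, as z_s = t^s +
   (t^s)' v for u = 1. *)
HB.lock Definition kdel (k : fieldType) n (f : {poly {mpoly k[n.+2]}}) :
    {poly {mpoly k[n.+1]}} := gpoly n * rho f.
HB.lock Definition kdel' (k : fieldType) n (f : {poly {mpoly k[n.+2]}}) :
    {poly {mpoly k[n.+1]}} := (kdel f)^`() - kdel f^`().
Arguments kdel {k n} f.
Arguments kdel' {k n} f.

(** * The differential on families of polynomials in t and v *)

Section KoszulFamilies.
Variable k : fieldType.
Hypothesis hk : 2%N \notin [pchar k].
Local Notation R n := {mpoly k[n.+1]}.

Fact cop_zmod n s : zmod_morphism (@cop k n s).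
Proof. by move=> f h; rewrite -scaleN1r addrC copP scaleN1r addrC. Qed.

HB.instance Definition _ n s :=
  GRing.isZmodMorphism.Build (R n.+1) (R n) (@cop k n s) (@cop_zmod n s).

Fact hermite_zmod n l : zmod_morphism (@hermite k n l).
Proof. by move=> f h; rewrite -scaleN1r addrC hermiteP mulN1r addrC. Qed.

HB.instance Definition _ n l :=
  GRing.isZmodMorphism.Build (R n) k (@hermite k n l) (@hermite_zmod n l).

Definition Hermite n l (f : {poly R n}) : {poly k} := map_poly (@hermite k n l) f.

Lemma coef_Hermite n l (f : {poly R n}) j : (Hermite l f)`_j = hermite l f`_j.
Proof. by rewrite coef_map_id0 ?hermite0. Qed.

Lemma HermiteD n l (f h : {poly R n}) : Hermite l (f + h) = Hermite l f + Hermite l h.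
Proof. by apply/polyP => j; rewrite coefD !coef_Hermite coefD hermiteD. Qed.

Lemma HermiteN n l (f : {poly R n}) : Hermite l (- f) = - Hermite l f.
Proof. by apply/polyP => j; rewrite coefN !coef_Hermite coefN hermiteN. Qed.

Lemma HermiteB n l (f h : {poly R n}) : Hermite l (f - h) = Hermite l f - Hermite l h.
Proof. by rewrite HermiteD HermiteN. Qed.

Lemma Hermite0 n l : Hermite l (0 : {poly R n}) = 0.
Proof. by apply/polyP => j; rewrite coef_Hermite !coef0 hermite0. Qed.

Lemma Hermite_deriv n l (f : {poly R n}) : Hermite l f^`() = (Hermite l f)^`().
Proof.
by apply/polyP => j; rewrite coef_deriv !coef_Hermite coef_deriv raddfMn.
Qed.

Lemma HermiteXn n l s (f : {poly R n}) : Hermite l ('X^s * f) = 'X^s * Hermite l f.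
Proof.
by apply/polyP => j; rewrite coefXnM !coef_Hermite coefXnM; case: ifP => _; rewrite ?hermite0.
Qed.

Lemma Hermite_cons n l s (f : {poly R n.+1}) : Hermite (s :: l) f = Hermite l (map_poly (@cop k n s) f).
Proof. by apply/polyP => j; rewrite !coef_Hermite coef_map. Qed.

(** The sum may stop at s = g, since the contractions of a form of degree d vanish beyond n + d. *)
Lemma gpoly_rho_sum g n d (f : {poly R n.+1}) : (n + d = g)%N -> phomog d f ->
  gpoly n * rho f = \sum_(s < g.+1) 'X^s * map_poly (@cop k n s) f.
Proof.
move=> nd; elim/poly_ind: f => [|f c ih] hf.
  by rewrite rmorph0 mulr0 big1 // => s _; rewrite raddf0 mulr0.
have hf' : phomog d f by move=> j; have := hf j.+1; rewrite coefD coefMX coefC addr0.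
have hc : c \is d.-homog by have := hf 0%N; rewrite coefD coefMX coefC add0r.
have e1 : gpoly n * rho c%:P = \sum_(s < g.+1) 'X^s * (cop s c)%:P.
  apply/polyP => j; rewrite coef_gpoly_rho coef_sum.
  under eq_bigr do rewrite mulrC coefCM coefXn eq_sym.
  case: (ltnP j g.+1) => jg.
    rewrite (bigD1 (Ordinal jg)) //= eqxx mulr1 big1 ?addr0 // => i.
    by rewrite -val_eqE /= => /negPf ->; rewrite mulr0.
  rewrite big1 => [|i _]; first by apply: (cop_big hc); lia.
  by rewrite (ltn_eqF (leq_trans (ltn_ord i) jg)) mulr0.
rewrite rhoD rhoM rhoX mulrDr mulrA (ih hf') e1 mulr_suml -big_split.
apply: eq_bigr => s _ /=.
have -> : map_poly (@cop k n s) (f * 'X + c%:P) = map_poly (@cop k n s) f * 'X + (cop s c)%:P.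
  apply/polyP => j; rewrite coef_map /= !coefD !coefMX !coefC raddfD /= coef_map.
  by case: j => [|j] /=; rewrite ?raddf0.
by rewrite mulrDr mulrA.
Qed.

Lemma Hermite_kdel g n d l (f : {poly R n.+1}) : (n + d = g)%N -> phomog d f ->
  \sum_(s < g.+1) 'X^s * Hermite (val s :: l) f = Hermite l (kdel f).
Proof.
move=> nd hf; rewrite kdel.unlock (gpoly_rho_sum nd hf).
rewrite (big_morph _ (HermiteD l) (Hermite0 n l)); apply: eq_bigr => s _.
by rewrite HermiteXn -Hermite_cons.
Qed.

(** Leibniz rule: differentiate [Hermite_kdel] for f and subtract it for the derivative of f. *)
Lemma Hermite_kdel' g n d l (f : {poly R n.+1}) : (n + d = g)%N -> phomog d f ->
  \sum_(s < g.+1) ('X^s)^`() * Hermite (val s :: l) f = Hermite l (kdel' f).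
Proof.
move=> nd hf; rewrite kdel'.unlock HermiteB Hermite_deriv -(Hermite_kdel l nd hf).
rewrite -(Hermite_kdel l nd (phomog_deriv hf)) raddf_sum -sumrB; apply: eq_bigr => s _ /=.
by rewrite derivM Hermite_deriv addrK.
Qed.

Definition zc (s : nat) : {poly {poly k}} := ('X^s)%:P + (('X^s)^`())%:P * 'X.

Definition kdiff m (Q : {set 'I_m} -> {poly {poly k}}) : {set 'I_m} -> {poly {poly k}} :=
  kd (fun s : 'I_m => zc s) Q.

Definition fam n m (f0 f1 f2 : {poly R n}) (S : {set 'I_m}) : {poly {poly k}} :=
  (Hermite (desc S) f0)%:P + (Hermite (desc S) f1)%:P * 'X + (Hermite (desc S) f2)%:P * 'X^2.

(** Indices s in S may be added to the sum because a repeated index gives 0. Then t^s contributes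
    [kdel], and (t^s)' v contributes [kdel'] one power of v higher. *)
Lemma kdiff_fam g n d (f0 f1 f2 : {poly R n.+1}) (Q : {set 'I_g.+1} -> {poly {poly k}})
    (S : {set 'I_g.+1}) : (n + d = g)%N -> #|S| = n ->
  phomog d f0 -> phomog d f1 -> phomog d f2 ->
  (forall S' : {set 'I_g.+1}, #|S'| = n.+1 -> Q S' = fam f0 f1 f2 S') ->
  kdiff Q S = fam (kdel f0) (kdel f1 + kdel' f0) (kdel f2 + kdel' f1) S
              + (Hermite (desc S) (kdel' f2))%:P * 'X^3.
Proof.
move=> nd cS h0 h1 h2 hQ.
pose l := desc S.
pose G (s : 'I_g.+1) : {poly {poly k}} := (Hermite (val s :: l) f0)%:P
  + (Hermite (val s :: l) f1)%:P * 'X + (Hermite (val s :: l) f2)%:P * 'X^2.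
have -> : kdiff Q S = \sum_(s < g.+1) zc s * G s.
  rewrite /kdiff /kd big_mkcond; apply: eq_bigr => s _; case: ifPn => [sS|/negPn sS].
    have e (f : {poly R n.+1}) : Hermite (val s :: l) f = (-1) ^+ ksgn s S * Hermite (desc (s |: S)) f.
      apply/polyP => j; rewrite coef_Hermite /l hermite_desc_notin //.
      elim: (ksgn s S) => [|a ih]; first by rewrite !expr0 !mul1r coef_Hermite.
      by rewrite !exprS !mulN1r !mulNr ih coefN.
    rewrite hQ; last by rewrite cardsU1 sS cS.
    rewrite mulrCA /G /fam !e; congr (_ * _); elim: (ksgn s S) => [|a ih].
      by rewrite !expr0 !mul1r.
    rewrite !(exprS (-1) a) !mulN1r !mulNr ih !polyCN; ring.
  have e (f : {poly R n.+1}) : Hermite (val s :: l) f = 0.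
    by apply/polyP => j; rewrite coef_Hermite coef0 /l hermite_desc_in.
  by rewrite /G !e polyC0 !mul0r !addr0 mulr0.
rewrite /fam !HermiteD -/l -!(Hermite_kdel l nd h0) -!(Hermite_kdel l nd h1) -!(Hermite_kdel l nd h2).
rewrite -!(Hermite_kdel' l nd h0) -!(Hermite_kdel' l nd h1) -!(Hermite_kdel' l nd h2).
rewrite -!big_split /= !rmorph_sum /= !mulr_suml -!big_split /=.
apply: eq_bigr => s _; rewrite /zc /G !polyCD !polyCM; ring.
Qed.

End KoszulFamilies.

(** * Sections of O_T(m) *)

HB.lock Definition tloc (k : fieldType) (p : {poly k}) : tuv_field k :=
  tuv_inj (map_poly (@mpolyC 3 k) p).['X_(inord 0)].

HB.lock Definition uloc (k : fieldType) : tuv_field k := tuv_inj 'X_(inord 1).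
HB.lock Definition vloc (k : fieldType) : tuv_field k := tuv_inj 'X_(inord 2).

Fact tloc_zmod (k : fieldType) : zmod_morphism (@tloc k).
Proof. by move=> p q; rewrite tloc.unlock !rmorphB hornerD hornerN rmorphB. Qed.

Fact tloc_monoid (k : fieldType) : monoid_morphism (@tloc k).
Proof.
by rewrite tloc.unlock; split=> [|p q]; rewrite ?rmorph1 ?hornerC ?rmorph1 // !rmorphM hornerM rmorphM.
Qed.

HB.instance Definition _ (k : fieldType) :=
  GRing.isZmodMorphism.Build {poly k} (tuv_field k) (@tloc k) (@tloc_zmod k).
HB.instance Definition _ (k : fieldType) :=
  GRing.isMonoidMorphism.Build {poly k} (tuv_field k) (@tloc k) (@tloc_monoid k).

(* The outer variable of {poly {poly k}} stands for v / u, the inner one for t. *)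
HB.lock Definition dehom (k : fieldType) (Q : {poly {poly k}}) : tuv_field k :=
  (map_poly (@tloc k) Q).[vloc k / uloc k].

Fact dehom_zmod (k : fieldType) : zmod_morphism (@dehom k).
Proof. by move=> p q; rewrite dehom.unlock !rmorphB hornerD hornerN. Qed.

Fact dehom_monoid (k : fieldType) : monoid_morphism (@dehom k).
Proof.
by rewrite dehom.unlock; split=> [|p q]; rewrite ?rmorph1 ?hornerC // !rmorphM hornerM.
Qed.

HB.instance Definition _ (k : fieldType) :=
  GRing.isZmodMorphism.Build {poly {poly k}} (tuv_field k) (@dehom k) (@dehom_zmod k).
HB.instance Definition _ (k : fieldType) :=
  GRing.isMonoidMorphism.Build {poly {poly k}} (tuv_field k) (@dehom k) (@dehom_monoid k).

Section Sections.
Variable k : fieldType.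

Lemma tuv_inj_eq0 (f : {mpoly k[3]}) : tuv_inj f = 0 -> f = 0.
Proof. by move/eqP; rewrite [_ == _](tofrac_eq0 f) => /eqP. Qed.

Lemma uloc_neq0 : uloc k != 0.
Proof.
rewrite uloc.unlock; apply/eqP => /tuv_inj_eq0/(congr1 (mcoeff U_(inord 1))).
by rewrite mcoeffX eqxx mcoeff0 => /eqP; rewrite oner_eq0.
Qed.

Lemma ulocE : tuv_inj 'X_(inord 1) = uloc k.
Proof. by rewrite uloc.unlock. Qed.

Lemma vlocE : tuv_inj 'X_(inord 2) = vloc k.
Proof. by rewrite vloc.unlock. Qed.

Lemma tlocC (c : k) : tloc c%:P = tuv_inj c%:MP.
Proof. by rewrite tloc.unlock map_polyC hornerC. Qed.

Lemma tlocX : tloc ('X : {poly k}) = tuv_inj 'X_(inord 0).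
Proof. by rewrite tloc.unlock map_polyX hornerX. Qed.

Lemma tlocXn n : tloc ('X^n : {poly k}) = tloc 'X ^+ n.
Proof. exact: rmorphXn. Qed.

Lemma tlocMn n (p : {poly k}) : tloc (p *+ n) = tloc p *+ n.
Proof. exact: rmorphMn. Qed.

Lemma dehomC (p : {poly k}) : dehom p%:P = tloc p.
Proof. by rewrite dehom.unlock map_polyC hornerC. Qed.

Lemma dehomX : dehom ('X : {poly {poly k}}) = vloc k / uloc k.
Proof. by rewrite dehom.unlock map_polyX hornerX. Qed.

Lemma dehomZ (c : k) (Q : {poly {poly k}}) : dehom (c%:P%:P * Q) = c *: dehom Q.
Proof. by rewrite rmorphM /= dehomC tlocC. Qed.

Definition rehom : {mpoly k[3]} -> {poly {poly k}} :=
  mmap (polyC \o polyC) (fun i : 'I_3 => if i == inord 0 then ('X)%:P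
    else if i == inord 1 then 1 else 'X).

HB.instance Definition _ := GRing.RMorphism.on rehom.

Lemma mulf_clear (F : fieldType) (a b c d : F) : b != 0 -> a * b * (c * (d / b)) = c * d * a.
Proof. by move=> b0; field. Qed.

Lemma mulf_clear1 (F : fieldType) (a b c d : F) : a != 0 ->
  a * (b * c * (d / a)) = b * d * c.
Proof. by move=> a0; field. Qed.

Lemma dehomE (Q : {poly {poly k}}) :
  dehom Q = \sum_(j < size Q) tloc Q`_j * (vloc k / uloc k) ^+ j.
Proof.
rewrite -{1}[Q]coefK poly_def rmorph_sum; apply: eq_bigr => j _ /=.
by rewrite -mul_polyC rmorphM rmorphXn /= dehomC dehomX.
Qed.

Lemma ord3_neq : [/\ inord 1 != inord 0 :> 'I_3, inord 2 != inord 0 :> 'I_3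
  & inord 2 != inord 1 :> 'I_3].
Proof. by split; rewrite -val_eqE /= !inordK. Qed.

(** Clearing powers of u gives a polynomial H in t, u, v, from which Q is recovered by setting u = 1
    ([rehom]). *)
Lemma dehom_inj : injective (@dehom k).
Proof.
suff inj0 Q : dehom Q = 0 :> tuv_field k -> Q = 0.
  move=> P Q e; apply/eqP; rewrite -subr_eq0; apply/eqP/inj0.
  by rewrite raddfB /= e addrN.
pose D := size Q; pose h (p : {poly k}) := (map_poly (@mpolyC 3 k) p).['X_(inord 0)].
pose H : {mpoly k[3]} := \sum_(j < D) h Q`_j * ('X_(inord 2)) ^+ j * ('X_(inord 1)) ^+ (D - j).
have u0 := uloc_neq0.
have eH : uloc k ^+ D * dehom Q = tuv_inj H.
  rewrite dehomE mulr_sumr rmorph_sum; apply: eq_bigr => j _ /=.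
  rewrite !rmorphM !rmorphXn /= tloc.unlock -/(h _) ulocE vlocE.
  have -> : uloc k ^+ D = uloc k ^+ (D - j) * uloc k ^+ j.
    by rewrite -exprD subnK // ltnW.
  have : uloc k ^+ j != 0 by rewrite expf_neq0.
  rewrite expr_div_n.
  move: (uloc k ^+ j) (uloc k ^+ (D - j)) (vloc k ^+ j) (tuv_inj _) => B A V C B0.
  exact: mulf_clear.
move=> Q0; have : H = 0 by apply: tuv_inj_eq0; rewrite -eH Q0 mulr0.
move/(congr1 rehom); rewrite rmorph0 rmorph_sum => <-.
have [n10 n20 n21] := ord3_neq.
rewrite -{1}[Q]coefK poly_def; apply: eq_bigr => j _ /=.
rewrite !rmorphM !rmorphXn /= {2 3}/rehom !mmapX !mmap1U (negPf n20) (negPf n21) eqxx.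
rewrite (negPf n10) expr1n mulr1 -mul_polyC; congr (_ * _).
have hD p c : h (p * 'X + c%:P) = h p * 'X_(inord 0) + c%:MP.
  have -> : h (p * 'X + c%:P) =
      (map_poly (@mpolyC 3 k) p * 'X + (c%:MP)%:P).['X_(inord 0)].
    congr (_.[_]); apply/polyP => l; rewrite coef_map /= !coefD !coefMX !coefC raddfD /=.
    by rewrite coef_map; case: l => [|l] /=; rewrite ?mpolyC0.
  by rewrite hornerMXaddC.
have rD f1 f2 c : rehom (f1 * f2 + c%:MP) = rehom f1 * rehom f2 + c%:P%:P.
  rewrite rmorphD rmorphM; congr (_ + _); exact: mmapC.
have rX : rehom 'X_(inord 0) = ('X)%:P by rewrite /rehom mmapX mmap1U eqxx.
elim/poly_ind: (Q`_j) => [|p c ih]; first by rewrite /h !rmorph0 horner0 rmorph0.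
by rewrite hD rD rX polyCD polyCM ih.
Qed.

Section WithG.
Variable g : nat.

Definition tanp : {mpoly k[g.+1]} -> {poly {poly k}} :=
  mmap (polyC \o polyC) (fun i : 'I_g.+1 => zc k i).

HB.instance Definition _ := GRing.RMorphism.on tanp.

Lemma tanpX i : tanp 'X_i = zc k i.
Proof. by rewrite /tanp mmapX mmap1U. Qed.

Lemma tanpC c : tanp c%:MP = c%:P%:P.
Proof. by rewrite /tanp mmapC. Qed.

Lemma tanpZ c p : tanp (c *: p) = c%:P%:P * tanp p.
Proof. by rewrite -mul_mpolyC rmorphM /= tanpC. Qed.

Lemma dehom_zc (i : 'I_g.+1) :
  tangent_param_fraction 'X_i = uloc k * dehom (zc k i) :> tuv_field k.
Proof.
have eR : dehom (zc k i) = tloc 'X ^+ i + tloc 'X ^+ i.-1 *+ i * (vloc k / uloc k) :> tuv_field k.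
  rewrite /zc rmorphD rmorphM /= !dehomC dehomX derivXn.
  by rewrite tlocMn !tlocXn.
have eL : tangent_param_fraction 'X_i =
    uloc k * tloc 'X ^+ i + i%:R * vloc k * tloc 'X ^+ i.-1 :> tuv_field k.
  rewrite /tangent_param_fraction /= /tangent_param mmapX mmap1U /tangent_coord.
  rewrite rmorphD rmorphM rmorphXn rmorphM rmorphM rmorphXn rmorph_nat.
  by rewrite /= ulocE vlocE -tlocX.
rewrite eL eR mulrDr; congr (_ + _).
by rewrite -[X in _ = _ * (X * _)]mulr_natl (mulf_clear1 _ _ _ uloc_neq0).
Qed.

Lemma param_dehom M p : p \is M.-homog ->
  tangent_param_fraction p = uloc k ^+ M * dehom (tanp p) :> tuv_field k.
Proof.
move: M p; apply: homog_ind => [d|c|i|d p q hp hq|d e p q hp hq].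
- by rewrite !rmorph0 mulr0.
- rewrite expr0 mul1r tanpC dehomC tlocC /tangent_param_fraction /= /tangent_param mmapC //.
- by rewrite dehom_zc expr1 tanpX.
- by rewrite !rmorphD /= hp hq mulrDr.
by rewrite !rmorphM /= hp hq exprD mulrACA.
Qed.

Lemma tanp_size M p : p \is M.-homog -> (size (tanp p) <= M.+1)%N.
Proof.
move: M p; apply: homog_ind => [d|c|i|d p q hp hq|d e p q hp hq].
- by rewrite rmorph0 size_poly0.
- by rewrite tanpC size_polyC_leq1.
- rewrite tanpX /zc; apply: size_add_leq; first by rewrite (leq_trans (size_polyC_leq1 _)).
  have [->|c0] := eqVneq ('X^i)^`() (0 : {poly k}); first by rewrite polyC0 mul0r size_poly0.
  by rewrite size_mulX ?polyC_eq0 // size_polyC c0.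
- by rewrite rmorphD; apply: size_add_leq.
by rewrite rmorphM; apply: size_mul_leqS.
Qed.

(** Modulo v^2, z_s is (t + v)^s, so v acts as an infinitesimal shift of t. *)
Lemma tanp_deriv p : (tanp p)`_1 = ((tanp p)`_0)^`().
Proof.
elim/mpoly_alg_ind: p => [c|i|p q hp hq|p q hp hq].
- by rewrite tanpC !coefC /= derivC.
- by rewrite tanpX /zc !coefD !coefMX !coefC /= addr0 add0r.
- by rewrite rmorphD /= !coefD derivD hp hq.
rewrite rmorphM /= coef0M derivM coefM big_ord_recl big_ord1 /= subn0 subnn hp hq.
by rewrite addrC.
Qed.

Lemma tanp_size0 M p : p \is M.-homog -> (size ((tanp p)`_0)%R <= (g * M).+1)%N.
Proof.
move: M p; apply: homog_ind => [d|c|i|d p q hp hq|d e p q hp hq].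
- by rewrite rmorph0 coef0 size_poly0.
- by rewrite tanpC coefC /= (leq_trans (size_polyC_leq1 _)).
- rewrite tanpX /zc coefD coefMX coefC /= addr0 size_polyXn muln1 ltnS.
  by rewrite -ltnS ltn_ord.
- by rewrite rmorphD coefD; apply: size_add_leq.
by rewrite rmorphM coef0M mulnDr; apply: size_mul_leqS.
Qed.

(* For z_(a_1) ... z_(a_M) with weight w = a_1 + ... + a_M, the number e is the
   second elementary symmetric function of the a_i; it is determined by w
   when w is at least g M - 1, as then all but at most one of the a_i are g. *)
Lemma tanp_monomial M (m : 'X_{1..g.+1}) : mdeg m = M -> exists w e : nat,
  [/\ (tanp 'X_[m])`_0 = 'X^w, (tanp 'X_[m])`_2 = 'X^(w - 2) *+ e,
      ((w <= g * M) /\ ((w < 2) -> e = 0))%N,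
      (w = g * M -> e = g ^ 2 * 'C(M, 2))%N
    & ((w.+1 = g * M)%N -> (e + g * M.-1 = g ^ 2 * 'C(M, 2))%N)].
Proof.
elim: M m => [|M ih] m hm.
  have -> : m = 0%MM by apply/eqP; rewrite -mdeg_eq0 hm.
  exists 0%N, 0%N; rewrite mpolyX0 rmorph1 !coefC /= expr0 mulr0n bin0n !muln0; split=> //.
have [i mi] : exists i, (m i != 0)%N.
  case: (pickP (fun i => m i != 0)%N) => [i mi|h0]; first by exists i.
  have : mdeg m = 0%N by rewrite mdegE; apply: big1 => i _; apply/eqP/negbFE/h0.
  by rewrite hm.
have em : m = (m - U_(i) + U_(i))%MM by rewrite submK // lep1mP.
have [|w [e [e0 e2 [hw hwe] h1 h2]]] := ih (m - U_(i))%MM.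
  by move: hm; rewrite {1}em mdegD mdeg1; lia.
have e1 := tanp_deriv 'X_[m - U_(i)].
exists (w + i)%N, (e + i * w)%N.
rewrite em mpolyXD rmorphM /= tanpX.
have z0 : (zc k i)`_0 = 'X^i by rewrite /zc coefD coefMX coefC /= addr0.
have z1 : (zc k i)`_1 = 'X^(i.-1) *+ i.
  by rewrite /zc coefD coefMX !coefC /= add0r derivXn.
have z2 : (zc k i)`_2 = 0 by rewrite /zc coefD coefMX !coefC /= add0r.
have ig : (i <= g)%N by rewrite -ltnS.
split.
- by rewrite coef0M e0 z0 -exprD.
- rewrite coefM !big_ord_recl big_ord0 /= /bump /= !subnn subn0 z0 z1 z2 e1 e2 e0 mulr0 add0r addr0.
  rewrite derivXn mulrnDr addrC; congr (_ + _).
    case: (ltnP w 2) => hw2; first by rewrite hwe // !mulr0n mul0r.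
    by rewrite mulrnAl -exprD; congr ('X^_ *+ _); lia.
  rewrite mulrnAl mulrnAr -mulrnA -exprD mulnC.
  case: w {e0 e2 e1 h1 h2 hwe hw} => [|w]; first by rewrite ?muln0 ?mul0n !mulr0n.
  case: (nat_of_ord i) => [|i']; first by rewrite ?mul0n ?muln0 !mulr0n.
  by congr ('X^_ *+ _); lia.
- split; first by rewrite mulnS; lia.
  move=> wi; have -> : e = 0%N by apply: hwe; lia.
  have [->|->] : (i = 0 :> nat)%N \/ w = 0%N by lia.
    by rewrite mul0n.
  by rewrite muln0.
- rewrite mulnS => wi; have [-> ew] : (i = g :> nat)%N /\ w = (g * M)%N by lia.
  by rewrite ew h1 // binS bin1 -!mulnn; nia.
rewrite mulnS => wi.
have [[ig' ew]|[ig' ew]] : (i = g :> nat /\ w.+1 = g * M \/ i.+1 = g :> nat /\ w = g * M)%N by lia.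
  rewrite ig' /= binS bin1 mulnDr -(h2 ew).
  case: M {ih hm hw h1 h2 hwe} ew wi => [|M] ew wi; first by lia.
  by rewrite /= !expnS expn0; nia.
by rewrite /= (h1 ew) ew binS bin1 mulnDr -addnA -mulSnr ig' -mulnn mulnA.
Qed.

(** In degrees g M - 2 and g M - 3 the coefficient of the v^2 part is a fixed multiple of the
    coefficient two degrees higher in the v-free part: at the weights g M and g M - 1 the number e
    of [tanp_monomial] depends on the weight alone. *)
Lemma tanp_infty M p : p \is M.-homog -> (tanp p)`_0 = 0 ->
  (size ((tanp p)`_2)%R <= g * M - 3)%N.
Proof.
move=> /dhomogP hp p0.
have ep i : (tanp p)`_i = \sum_(m <- msupp p) p@_m *: (tanp 'X_[m])`_i.
  rewrite {1}(mpolyE p) rmorph_sum coef_sum; apply: eq_bigr => m _ /=.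
  by rewrite -mul_mpolyC rmorphM /= tanpC coefCM mul_polyC.
have c0 j : \sum_(m <- msupp p) p@_m * ((tanp 'X_[m])`_0)`_j = 0.
  have := congr1 (fun P : {poly k} => P`_j) p0; rewrite ep coef_sum coef0 => e0; rewrite -[RHS]e0.
  by apply: eq_bigr => m _; rewrite coefZ.
apply/leq_sizeP => j hj; rewrite ep coef_sum.
under eq_bigr do rewrite coefZ.
case: (ltnP (g * M) (j + 2)) => j2.
  rewrite big_seq big1 // => m mp.
  have [w [e [_ -> [hw hwe] _ _]]] := tanp_monomial (hp m mp).
  rewrite coefMn coefXn; case: (ltnP w 2) => w2; first by rewrite hwe // mulr0n mulr0.
  by rewrite (_ : (j == w - 2)%N = false) ?mul0rn ?mulr0 //; lia.
pose c : k := if (j + 2 == g * M)%N then (g ^ 2 * 'C(M, 2))%:R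
  else (g ^ 2 * 'C(M, 2))%:R - (g * M.-1)%:R.
transitivity (c * \sum_(m <- msupp p) p@_m * ((tanp 'X_[m])`_0)`_(j + 2)); last first.
  by rewrite c0 mulr0.
rewrite mulr_sumr big_seq [RHS]big_seq.
apply: eq_bigr => m mp.
have [w [e [-> -> [hw hwe] h1 h2]]] := tanp_monomial (hp m mp).
rewrite coefMn !coefXn mulrCA; congr (_ * _).
case: (ltnP w 2) => w2.
  rewrite hwe // mulr0n (_ : (j + 2 == w)%N = false) ?mulr0 //; lia.
have -> : (j + 2 == w)%N = (j == w - 2)%N by lia.
case: eqP => jw; last by rewrite mul0rn mulr0.
rewrite mulr1 /c; case: eqP => jg.
  by rewrite h1 //; lia.
rewrite -h2; last by lia.
by rewrite natrD addrK.
Qed.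

Lemma coef0Xn (A : nzRingType) (P : {poly A}) n : (P ^+ n)`_0 = P`_0 ^+ n.
Proof. by elim: n => [|n ih]; rewrite ?expr0 ?coefC // !exprS coef0M ih. Qed.

Hypothesis hg : (3 <= g)%N.

(** Three local conditions are exploited. For u = 1, z_0 is 1, so f is given by a polynomial Q in t
    and v; z_1 = t + v is monic in v and bounds the degree of Q in v; z_g controls t at infinity. *)
Lemma sectionP m (f : tuv_field k) : is_section g m f -> exists Q : {poly {poly k}},
  [/\ f = uloc k ^+ m * dehom Q, (size Q <= m.+1)%N, Q`_1 = (Q`_0)^`(),
      (size (Q`_0)%R <= (g * m).+1)%N
    & m = 2 -> Q`_0 = 0 -> (size (Q`_2)%R <= 2 * g - 3)%N].
Proof.
move=> hf; have u0 := uloc_neq0.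
have [N [p hp ep]] := hf ord0.
have zc0 : zc k 0 = 1 by rewrite /zc expr0 derivC polyC0 mul0r addr0.
pose Q := tanp p.
have fQ : f = uloc k ^+ m * dehom Q.
  move: ep; rewrite (param_dehom hp) dehom_zc zc0 rmorph1 mulr1 exprD mulrAC.
  by apply: mulIf; rewrite expf_neq0.
have key i : exists N, exists2 p : {mpoly k[g.+1]}, p \is (m + N).-homog &
    Q * zc k (i : 'I_g.+1) ^+ N = tanp p.
  have [N' [p' hp' ep']] := hf i; exists N', p' => //.
  apply: dehom_inj; rewrite rmorphM rmorphXn /=.
  apply: (@mulfI _ (uloc k ^+ (m + N'))); first by rewrite expf_neq0.
  by rewrite -param_dehom // -ep' fQ dehom_zc exprMn exprD mulrACA.
have sQ : (size Q <= m.+1)%N.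
  have [N' [p' hp' ep']] := key (inord 1).
  have [->|Q0] := eqVneq Q 0; first by rewrite size_poly0.
  have z1 : zc k (inord 1 : 'I_g.+1) = 'X - (- 'X)%:P.
    by rewrite inordK; [rewrite /zc expr1 derivX mul1r polyCN opprK addrC | lia].
  have := tanp_size hp'; rewrite -ep' z1 size_mul // ?expf_neq0 ?polyXsubC_eq0 //.
  by rewrite size_exp_XsubC addnS /= -addSn leq_add2r.
have zg0 : (zc k (ord_max : 'I_g.+1))`_0 = 'X^g by rewrite /zc coefD coefMX coefC /= addr0.
exists Q; split=> //.
- exact: tanp_deriv.
- have [N' [p' hp' ep']] := key ord_max.
  have e0 : Q`_0 * 'X^(g * N') = (tanp p')`_0.
    by rewrite -ep' coef0M coef0Xn zg0 exprM.
  have [->|Q0] := eqVneq Q`_0 0; first by rewrite size_poly0.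
  have := tanp_size0 hp'; rewrite -e0 size_mulXn // mulnDr; lia.
move=> m2 Q0; have [N' [p' hp' ep']] := key ord_max.
have Q1 : Q`_1 = 0 by rewrite /Q tanp_deriv -/Q Q0 derivC.
have eQ : Q = (Q`_2)%:P * 'X^2.
  apply/polyP => -[|[|[|j]]]; rewrite coefCM coefXn /= ?mulr0 ?mulr1 //.
  by rewrite nth_default // (leq_trans sQ) // m2.
have e0 : (tanp p')`_0 = 0 by rewrite -ep' coef0M Q0 mul0r.
have e2 : (tanp p')`_2 = Q`_2 * 'X^(g * N').
  rewrite -ep' {1}eQ mulrAC coefMXn /= subnn coefCM coef0Xn zg0 exprM.
  by [].
have := tanp_infty hp' e0; rewrite e2 m2.
have [->|q0] := eqVneq Q`_2 0; first by rewrite size_poly0.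
rewrite size_mulXn // mulnDr mulnC; lia.
Qed.

Lemma param_section m (p : {mpoly k[g.+1]}) :
  p \is m.-homog -> is_section g m (uloc k ^+ m * dehom (tanp p)).
Proof.
move=> hp i; exists 0%N, p; first by rewrite addn0.
by rewrite expr0 mulr1 (param_dehom hp).
Qed.

Lemma homogX (i : 'I_g.+1) : ('X_i : {mpoly k[g.+1]}) \is 1.-homog.
Proof. by rewrite dhomogX /= mdeg1. Qed.

Lemma section1 (F : {poly k}) : (size F <= g.+1)%N ->
  is_section g 1 (uloc k * dehom (F%:P + F^`()%:P * 'X)).
Proof.
move=> sF; pose p : {mpoly k[g.+1]} := \sum_(i < g.+1) F`_i *: 'X_i.
suff -> : F%:P + F^`()%:P * 'X = tanp p.
  rewrite -[X in X * _]expr1; apply: param_section.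
  by apply: rpred_sum => i _; apply: rpredZ; apply: homogX.
have -> : tanp p = \sum_(i < g.+1) (F`_i)%:P%:P * zc k i.
  rewrite /p rmorph_sum; apply: eq_bigr => i _ /=.
  by rewrite -mul_mpolyC rmorphM /= tanpC tanpX.
have eF : F = \sum_(i < g.+1) (F`_i)%:P * 'X^i.
  rewrite -{1}[F]coefK poly_def (big_ord_widen g.+1 (fun i => F`_i *: 'X^i)) // big_mkcond.
  apply: eq_bigr => i _; rewrite mul_polyC; case: ltnP => // hi.
  by rewrite nth_default // scale0r.
rewrite [in LHS]eF !raddf_sum /= mulr_suml -big_split; apply: eq_bigr => i _ /=.
by rewrite derivM derivC mul0r add0r !polyCM /zc mulrDr mulrA.
Qed.

Hypothesis hk : 2%N \notin [pchar k].

Lemma zcM a b : zc k a * zc k b = ('X^(a + b))%:P + (('X^(a + b))^`())%:P * 'X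
   + (('X^a)^`() * ('X^b)^`())%:P * 'X^2.
Proof. by rewrite /zc exprD derivM !(polyCD, polyCM); ring. Qed.

(** The quadrics z_(l+1)^2 - z_l z_(l+2) and z_(l+1) z_(l+2) - z_l z_(l+3) go to t^(2l) v^2 and 2
    t^(2l+1) v^2, as (l+1)^2 - l(l+2) = 1 and (l+1)(l+2) - l(l+3) = 2. *)
Lemma section2X j : (j < 2 * g - 3)%N -> exists2 p : {mpoly k[g.+1]},
  p \is 2.-homog & tanp p = ('X^j)%:P * 'X^2.
Proof.
move=> jg; pose z (i : nat) : {mpoly k[g.+1]} := 'X_(inord i).
have tz i : (i <= g)%N -> tanp (z i) = zc k i by move=> ig; rewrite tanpX inordK.
have hz a b : z a * z b \is 2.-homog by apply: (dhomogM (d := 1) (e := 1)); apply: homogX.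
have two : (2%:R : k) != 0 by apply: contra hk => h; rewrite inE /= h.
have D a : ('X^(a.+1))^`() = 'X^a *+ a.+1 :> {poly k} by rewrite derivXn.
have [e|e] := boolP (odd j); last first.
  pose l := j./2; have ej : j = (l + l)%N by rewrite addnn; lia.
  exists (z l.+1 * z l.+1 - z l.+2 * z l); first by apply: rpredB; apply: hz.
  rewrite rmorphB !rmorphM /= !tz; try lia.
  rewrite !zcM; have -> : (l.+2 + l = l.+1 + l.+1)%N by lia.
  rewrite opprD addrACA subrr add0r -mulrBl -polyCB; congr (_%:P * _).
  rewrite !D ej; case: (l) => [|l']; first by rewrite expr0 derivC mulr0 subr0 mulr1.
  rewrite D !mulrnAl !mulrnAr -!mulrnA -!exprD.
  have -> : (l'.+2 + l' = l'.+1 + l'.+1)%N by lia.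
  rewrite -mulrnBr; last by lia.
  by rewrite (_ : _ - _ = 1)%N //; lia.
pose l := j./2; have ej : j = (l + l.+1)%N by have := odd_double_half j; rewrite e -addnn; lia.
have ex : tanp (z l.+2 * z l.+1 - z l.+3 * z l) = (2%:R)%:P%:P * (('X^j)%:P * 'X^2).
  rewrite rmorphB !rmorphM /= !tz; try lia.
  rewrite !zcM; have -> : (l.+3 + l = l.+2 + l.+1)%N by lia.
  rewrite opprD addrACA subrr add0r -mulrBl -polyCB mulrA -polyCM; congr (_%:P * _).
  rewrite !D ej; case: (l) => [|l']; first by rewrite expr0 derivC mulr0 subr0 mulr1 add0n mul_polyC scaler_nat.
  rewrite D !mulrnAl !mulrnAr -!mulrnA -!exprD mul_polyC scaler_nat.
  have -> : (l'.+3 + l' = l'.+2 + l'.+1)%N by lia.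
  have -> : (l'.+1 + l'.+2 = l'.+2 + l'.+1)%N by lia.
  by rewrite -mulrnBr; [congr (_ *+ _); lia | lia].
exists ((2%:R)^-1%:MP * (z l.+2 * z l.+1 - z l.+3 * z l)).
  by rewrite mul_mpolyC; apply: rpredZ; apply: rpredB; apply: hz.
have c2 : ((2%:R)^-1)%:P%:P * (2%:R)%:P%:P = 1 :> {poly {poly k}}.
  by rewrite -polyCM -polyCM mulVf.
by rewrite rmorphM /= tanpC ex [LHS]mulrA c2 mul1r.
Qed.

Lemma section2 (F : {poly k}) : (size F <= 2 * g - 3)%N ->
  is_section g 2 (uloc k ^+ 2 * dehom (F%:P * 'X^2)).
Proof.
move=> sF; have hP j : exists p : {mpoly k[g.+1]}, (j < 2 * g - 3)%N ->
    p \is 2.-homog /\ tanp p = ('X^j)%:P * 'X^2.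
  case: (ltnP j (2 * g - 3)) => [/section2X[p hp ep]|_]; last by exists 0.
  by exists p.
have {}hP := fun j => cid (hP j).
pose p : {mpoly k[g.+1]} := \sum_(j < 2 * g - 3) F`_j *: projT1 (hP j).
suff -> : F%:P * 'X^2 = tanp p.
  apply: param_section; apply: rpred_sum => j _; apply: rpredZ.
  exact: (projT2 (hP j) (ltn_ord j)).1.
rewrite rmorph_sum /=.
have eF : F = \sum_(j < 2 * g - 3) (F`_j)%:P * 'X^j.
  rewrite -{1}[F]coefK poly_def (big_ord_widen _ (fun i => F`_i *: 'X^i) sF) // big_mkcond.
  apply: eq_bigr => i _; rewrite mul_polyC; case: ltnP => // hi.
  by rewrite nth_default // scale0r.
rewrite [in LHS]eF rmorph_sum mulr_suml; apply: eq_bigr => j _ /=.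
rewrite tanpZ (projT2 (hP j) (ltn_ord j)).2.
by rewrite polyCM -mulrA.
Qed.

End WithG.
End Sections.

(** * The Koszul resolution *)

Section KoszulHomotopy.
Variables (k : fieldType) (m : nat).
Local Notation R := {mpoly k[m]}.
Implicit Types (s j : 'I_m) (S T : {set 'I_m}) (w : {set 'I_m} -> R) (e : 'X_{1..m}).

Definition maxs T : option 'I_m := [pick j in T | [forall i in T, (i <= j)%N]].

Lemma maxsP T j : j \in T -> {in T, forall i : 'I_m, (i <= j)%N} -> maxs T = Some j.
Proof.
move=> jT hj; rewrite /maxs; case: pickP => [i /andP[iT /forall_inP hi]|/(_ j)].
  by congr Some; apply/val_inj/eqP; rewrite eqn_leq hj //= hi.
by rewrite jT => /forall_inP; case.
Qed.

Lemma maxs_ex T i : i \in T -> exists2 j, j \in T & {in T, forall i : 'I_m, (i <= j)%N}.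
Proof.
move=> iT; exists [arg max_(j > i in T) j]%N; case: arg_maxnP => // j jT hj.
Qed.

Definition below j e : bool := [forall i : 'I_m, (j < i)%N ==> (e i == 0%N)].

(* The monomial contracting homotopy of the Koszul complex: move the largest
   index of T back into the monomial, provided that it exceeds all the
   variables of the monomial. *)
Definition khom w T : R :=
  if maxs T is Some j then
    \sum_(e <- msupp (w (T :\ j)) | (e j != 0%N) && below j e)
       (w (T :\ j))@_e *: 'X_[e - U_(j)]
  else 0.

Lemma mcoeff_khom w T j e : maxs T = Some j ->
  (khom w T)@_e = if below j e then (w (T :\ j))@_(e + U_(j)) else 0.
Proof.
move=> hT; rewrite /khom hT; set p := w _.
have bU : below j (e + U_(j)) = below j e.
  apply: eq_forallb => i; case: (ltnP j i) => //= ji.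
  by rewrite mnmDE mnm1E -val_eqE (ltn_eqF ji) addn0.
rewrite raddf_sum /=.
have E : forall f : 'X_{1..m}, (f j != 0%N) && below j f ->
    (p@_f *: 'X_[f - U_(j)])@_e = if f == (e + U_(j))%MM then p@_f else 0.
  move=> f /andP[fj _]; rewrite mcoeffZ mcoeffX.
  have -> : ((f - U_(j))%MM == e) = (f == (e + U_(j))%MM).
    apply/eqP/eqP => [<-|->]; last by rewrite addmK.
    by rewrite submK // lep1mP.
  by case: eqP => _; rewrite ?mulr1 ?mulr0.
rewrite (eq_bigr _ E) -big_mkcondr.
case: ifP => be; last first.
  rewrite big_pred0 // => f; apply/negP => /andP[/andP[_ bf] /eqP ef].
  by move: bf; rewrite ef bU be.
case: (boolP ((e + U_(j))%MM \in msupp p)) => hin; last first.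
  rewrite memN_msupp_eq0 // big_seq_cond big_pred0 // => f.
  by apply/negP => /andP[fp /andP[_ /eqP ef]]; rewrite -ef fp in hin.
rewrite -big_filter (_ : filter _ _ = [:: (e + U_(j))%MM]) ?big_seq1 //.
rewrite (eq_filter (a2 := pred1 (e + U_(j))%MM)); first by rewrite filter_pred1_uniq.
move=> f /=; case: (f =P (e + U_(j))%MM) => [->|_]; last by rewrite andbF.
by rewrite bU be mnmDE mnm1E eqxx addn1.
Qed.

Lemma mcoeffXM s (p : R) e :
  ('X_s * p)@_e = if e s != 0%N then p@_(e - U_(s)) else 0.
Proof.
rewrite mulrC; case: ifP => es.
  by rewrite -{1}(submK (m := U_(s)) (m' := e)) ?lep1mP // addmC mcoeffMX.
apply: memN_msupp_eq0; rewrite (perm_mem (msuppMX _ _)); apply/negP => /mapP[f _ ef].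
by move: es; rewrite ef mnmDE mnm1E eqxx addSn.
Qed.

Lemma mcoeff_kd w S e : (kd (fun s => 'X_s) w S)@_e =
  \sum_(s | s \notin S) (-1) ^+ ksgn s S * (if e s != 0%N then (w (s |: S))@_(e - U_(s)) else 0).
Proof.
rewrite /kd raddf_sum; apply: eq_bigr => s _ /=; rewrite -mcoeffXM.
elim: (ksgn s S) => [|l ih]; first by rewrite !expr0 !mul1r.
by rewrite !exprS !mulN1r !mulNr mcoeffN ih.
Qed.

Lemma ksgn_max j S : {in S, forall i : 'I_m, (i <= j)%N} -> ksgn j S = 0%N.
Proof.
move=> h; apply/eqP; rewrite cards_eq0; apply/eqP/setP => i; rewrite !inE.
by apply/negP => /andP[/h]; rewrite leqNgt => /negPf ->.
Qed.

(** Let j be the largest index occurring in S or e. If j is in S, the term of [khom (kd w)] that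
    reinserts j gives the right side and all others cancel in pairs. Otherwise [khom (kd w)]
    contributes 0 and only s = j survives in [kd (khom w)]. *)
Lemma khom_homotopy w S e : (S != set0) || (e != 0%MM) ->
  (kd (fun s => 'X_s) (khom w) S)@_e + (khom (kd (fun s => 'X_s) w) S)@_e = (w S)@_e.
Proof.
move=> Se; pose T := S :|: [set i | e i != 0%N].
have [i iT] : exists i, i \in T.
  apply/set0Pn; apply: contraL Se => /eqP; rewrite negb_or !negbK => T0.
  have /andP[-> /eqP e0] : (S == set0) && ([set i | e i != 0%N] == set0) by rewrite -setU_eq0 -/T T0.
  apply/eqP/mnmP => i; have := in_set0 i; rewrite -e0 inE mnm0E => /negbFE/eqP //.
have [j jT hj] := maxs_ex iT.
have hjS l : l \in S -> (l <= j)%N by move=> lS; apply: hj; rewrite inE lS.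
have hje l : e l != 0%N -> (l <= j)%N by move=> lS; apply: hj; rewrite !inE lS orbT.
have be : below j e.
  by apply/forallP => l; apply/implyP; rewrite ltnNge; apply: contraR; apply: hje.
have bsub f : below j f -> forall s, below j (f - U_(s)).
  move=> /forallP hf s; apply/forallP => l; apply/implyP => jl.
  by have := hf l; rewrite jl /= mnmBE => /eqP ->.
rewrite mcoeff_kd; case: (boolP (j \in S)) => jS.
  have mS : maxs S = Some j by apply: maxsP.
  rewrite (mcoeff_khom _ _ mS) be mcoeff_kd [X in _ + X](bigD1 j) ?setD11 //=.
  rewrite ksgn_max ?expr0 ?mul1r; last by move=> l /setD1P[_ /hjS].
  rewrite mnmDE mnm1E eqxx addn1 /= addmK setD1K // addrCA -[RHS]addr0; congr (_ + _).
  rewrite [X in _ + X](eq_bigl (fun s => s \notin S)); last first.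
    by move=> s; rewrite !inE; case: (s =P j) => [->|_] /=; rewrite ?jS ?andbT.
  rewrite -big_split; apply: big1 => s sS /=.
  have sj : s != j by apply: contraNneq sS => ->.
  rewrite mnmDE mnm1E [j == s]eq_sym (negPf sj) addn0; case: ifP => es; last by rewrite !mulr0 addr0.
  have slj : (s < j)%N by rewrite ltn_neqAle val_eqE sj hje.
  rewrite (@mcoeff_khom _ _ j); last first.
    by apply: maxsP => [|l]; rewrite !inE ?jS ?orbT // => /orP[/eqP->|/hjS //]; apply: ltnW.
  rewrite bsub //.
  have -> : (s |: S) :\ j = s |: S :\ j.
    by apply/setP => l; rewrite !inE; case: (l =P s) => [->|_]; rewrite ?sj.
  have -> : (e - U_(s) + U_(j) = e + U_(j) - U_(s))%MM.
    apply/mnmP => l; rewrite !(mnmDE, mnmBE, mnm1E).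
    by case: (s =P l) => [<-|_]; move: es; lia.
  have -> : ksgn s S = (ksgn s (S :\ j)).+1.
    by rewrite -{1}(setD1K jS) ksgn_setU1 ?setD11 // slj addn1.
  by rewrite exprS mulN1r mulNr addNr.
have ej : e j != 0%N by move: jT; rewrite !inE (negPf jS).
have -> : (khom (kd (fun s => 'X_s) w) S)@_e = 0.
  case: (set_0Vmem S) => [->|[l lS]].
    rewrite /khom /maxs; case: pickP => [i'|_]; last by rewrite mcoeff0.
    by rewrite inE.
  have [j' j'S hj'] := maxs_ex lS.
  rewrite (@mcoeff_khom _ _ j'); last exact: maxsP.
  have j'j : (j' < j)%N.
    by rewrite ltn_neqAle hjS // andbT val_eqE; apply: contraNneq jS => <-.
  by case: ifP => // /forallP/(_ j); rewrite j'j (negPf ej).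
rewrite addr0 (bigD1 j) //= big1 ?addr0.
  rewrite ej ksgn_max // expr0 mul1r (@mcoeff_khom _ _ j); last first.
    by apply: maxsP => [|l]; rewrite !inE ?eqxx // => /orP[/eqP->|/hjS].
  rewrite bsub // submK ?lep1mP //; congr (_@_e); congr (w _).
  by apply/setP => l; rewrite !inE; case: (l =P j) => [->|_] //=; rewrite (negPf jS).
move=> s /andP[sS sj]; case: ifP => es; last by rewrite mulr0.
have [j' j'S hj'] := maxs_ex (setU11 s S).
rewrite (@mcoeff_khom _ _ j'); last exact: maxsP.
have j'j : (j' < j)%N.
  rewrite ltn_neqAle; apply/andP; split.
    rewrite val_eqE; apply: contraTneq j'S => ->.
    by rewrite !inE negb_or eq_sym sj.
  by move: j'S; rewrite !inE => /orP[/eqP->|/hjS //]; apply: hje.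
case: ifP => [/forallP/(_ j)|_]; last by rewrite mulr0.
by rewrite j'j mnmBE mnm1E (negPf sj) subn0 (negPf ej).
Qed.

End KoszulHomotopy.

Section KoszulResolution.
Variables (k : fieldType) (m : nat).
Local Notation R := {mpoly k[m]}.

Definition kset n : finType := {S : {set 'I_m} | #|S| == n}.

Definition kmk n (S : {set 'I_m}) (h : #|S| == n) : kset n :=
  exist (fun T : {set 'I_m} => #|T| == n) S h.

Definition kext (A : zmodType) n (w : {ffun kset n -> A}) (S : {set 'I_m}) : A :=
  if insub S is Some B then w B else 0.

Definition kmat n (B : kset n.+1) (C : kset n) : R :=
  \sum_(s | (s \notin val C) && (s |: val C == val B)) (-1) ^+ ksgn s (val C) *: 'X_s.

Lemma kext_val (A : zmodType) n (w : {ffun kset n -> A}) (B : kset n) : kext w (val B) = w B.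
Proof. by rewrite /kext valK. Qed.

Lemma free_map_kmat (A : comNzRingType) (f : {rmorphism R -> A}) n
    (w : {ffun kset n.+1 -> A}) (C : kset n) :
  free_map (fun b c => f (kmat b c)) w C = kd (fun s => f 'X_s) (kext w) (val C).
Proof.
rewrite ffunE /kd.
have e B : w B * f (kmat B C) = \sum_(s | s \notin val C)
    if s |: val C == val B then (-1) ^+ ksgn s (val C) * (f 'X_s * w B) else 0.
  rewrite /kmat rmorph_sum mulr_sumr big_mkcondr; apply: eq_bigr => s _ /=.
  case: ifP => // _; elim: (ksgn s _) => [|l ih].
    by rewrite !expr0 scale1r mul1r mulrC.
  by rewrite !exprS !mulN1r scaleNr rmorphN mulrN ih mulNr.
rewrite (eq_bigr _ (fun B _ => e B)) exchange_big; apply: eq_bigr => s sC /=.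
have cB : #|s |: val C| == n.+1 by rewrite cardsU1 sC (eqP (valP C)).
rewrite (bigD1 (kmk cB)) //= eqxx big1 ?addr0.
  by rewrite -(kext_val w (kmk cB)).
by move=> B /eqP neB; case: eqP => // h; case: neB; apply: val_inj; exact: esym h.
Qed.

Lemma kmat_homog n (B : kset n.+1) (C : kset n) e :
  e \in msupp (kmat B C) -> (mdeg e + n)%N = n.+1.
Proof.
have /dhomogP h : kmat B C \is 1.-homog.
  by apply: rpred_sum => s _; apply: rpredZ; rewrite dhomogX /= mdeg1.
by move/h => /= ->; rewrite add1n.
Qed.

Definition kaug (B : kset 0) : k := 1.

Lemma kaug_surj : exists b : kset 0, kaug b != 0.
Proof.
have h : #|set0 : {set 'I_m}| == 0%N by rewrite cards0.
by exists (kmk h); rewrite oner_eq0.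
Qed.

Lemma kset0 (B : kset 0) : val B = set0.
Proof. by apply/eqP; rewrite -cards_eq0; apply: (valP B). Qed.

Lemma kmap_kd n (w : {ffun kset n.+1 -> R}) C :
  free_map (@kmat n) w C = kd (fun s => 'X_s) (kext w) (val C).
Proof. exact: (free_map_kmat (idfun : {rmorphism R -> R})). Qed.

Lemma kext_kmap n (w : {ffun kset n.+1 -> R}) (S : {set 'I_m}) : #|S| = n ->
  kext (free_map (@kmat n) w) S = kd (fun s => 'X_s) (kext w) S.
Proof. by move=> /eqP cS; have := kext_val (free_map (@kmat n) w) (kmk cS); rewrite /= => ->; rewrite kmap_kd. Qed.

Lemma eq_kd (A : comNzRingType) (x : 'I_m -> A) (w w' : {set 'I_m} -> A) (S : {set 'I_m}) :
  (forall s, s \notin S -> w (s |: S) = w' (s |: S)) -> kd x w S = kd x w' S.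
Proof. by move=> h; apply: eq_bigr => s sS; rewrite h. Qed.

Lemma kdd n (w : {ffun kset n.+2 -> R}) : free_map (@kmat n) (free_map (@kmat n.+1) w) = 0.
Proof.
apply/ffunP => C; rewrite kmap_kd ffunE -[RHS](kd_kd (fun s => 'X_s) (kext w) (val C)).
by apply: eq_kd => s sC; rewrite kext_kmap // cardsU1 sC (eqP (valP C)).
Qed.

(** The homotopy formula gives v = kd (khom v) at every coefficient except the constant one for n =
    0; that one vanishes on boundaries and is assumed to vanish for v. *)
Lemma khom_lift n (v : {ffun kset n -> R}) :
  (forall (C : kset n) e, (n != 0%N) || (e != 0%MM) ->
     (khom (kd (fun s => 'X_s) (kext v)) (val C))@_e = 0) ->
  (n = 0%N -> forall C, (v C)@_0%MM = 0) ->
  exists w, v = free_map (@kmat n) w.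
Proof.
move=> h h0; exists [ffun B : kset n.+1 => khom (kext v) (val B)].
apply/ffunP => C; rewrite kmap_kd; apply/mpolyP => e.
have -> : kd (fun s => 'X_s) (kext [ffun B : kset n.+1 => khom (kext v) (val B)]) (val C) =
   kd (fun s => 'X_s) (khom (kext v)) (val C).
  apply: eq_kd => s sC; have cB : #|s |: val C| == n.+1 by rewrite cardsU1 sC (eqP (valP C)).
  by rewrite -[s |: _]/(val (kmk cB)) kext_val ffunE.
have [ne|] := boolP ((n != 0%N) || (e != 0%MM)).
  have := @khom_homotopy k m (kext v) (val C) e; rewrite h // addr0 kext_val => -> //.
  by rewrite -cards_eq0 (eqP (valP C)).
rewrite negb_or !negbK => /andP[/eqP n0 /eqP ->]; rewrite h0 // mcoeff_kd big1 // => s _.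
by rewrite mnm0E mulr0.
Qed.

Lemma khom_zero (w : {set 'I_m} -> R) (S : {set 'I_m}) : (forall j, j \in S -> w (S :\ j) = 0) -> khom w S = 0 :> R.
Proof.
move=> h; rewrite /khom /maxs; case: pickP => // j /andP[jS _].
by rewrite h // msupp0 big_nil.
Qed.

Lemma kexact0 (v : {ffun kset 0 -> R}) :
  \sum_b (v b)@_0%MM * kaug b = 0 <-> exists w, v = free_map (@kmat 0) w.
Proof.
have h : #|set0 : {set 'I_m}| == 0%N by rewrite cards0.
pose B0 : kset 0 := kmk h.
have uB B : B = B0 by apply: val_inj; rewrite kset0.
have -> : \sum_b (v b)@_0%MM * kaug b = (v B0)@_0%MM.
  rewrite (bigD1 B0) //= big1 ?addr0 ?mulr1 // => B; by rewrite (uB B) eqxx.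
split=> [v0|[w ->]].
  apply: khom_lift => [C e _|_ C]; last by rewrite (uB C).
  by rewrite khom_zero ?mcoeff0 // kset0 => j; rewrite inE.
by rewrite kmap_kd mcoeff_kd big1 // => s _; rewrite mnm0E mulr0.
Qed.

Lemma kexactS n (v : {ffun kset n.+1 -> R}) :
  free_map (@kmat n) v = 0 <-> exists w, v = free_map (@kmat n.+1) w.
Proof.
split=> [v0|[w ->]]; last exact: kdd.
apply: khom_lift => // C e _; rewrite khom_zero ?mcoeff0 // => j jC.
have cB : #|val C :\ j| == n.
  by have := eqP (valP C); rewrite (cardsD1 j) jC add1n => -[->].
have := congr1 (fun F : {ffun _} => F (kmk cB)) v0.
by rewrite kmap_kd ffunE.
Qed.

Definition koszul_resolution : free_resolution k m :=
  @FreeResolution k m kset (fun n _ => n) kmat kaug kmat_homog (fun _ _ => erefl)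
    kaug_surj kexact0 kexactS.

End KoszulResolution.

(** * Independence of the resolution *)

(** The types vary with n because a resolution has a different basis in each degree; P carries the
    invariant that makes the next step possible. *)
Lemma dependent_choice_in (T : nat -> Type) (P : forall n, T n -> Prop) (Q : forall n, T n -> T n.+1 -> Prop) :
  (exists x, P 0%N x) ->
  (forall n x, P n x -> exists2 y, P n.+1 y & Q n x y) ->
  exists f : forall n, T n, (forall n, P n (f n)) /\ (forall n, Q n (f n) (f n.+1)).
Proof.
move=> /cid x0 step.
have step' n (x : {x | P n x}) : {y : {y | P n.+1 y} | Q n (sval x) (sval y)}.
  by case: x => x hx; have [y hy q] := cid2 (step n x hx); exists (exist _ y hy).
pose f n : {x | P n x} := nat_rect _ x0 (fun n x => sval (step' n x)) n.
exists (fun n => sval (f n)); split=> n; first exact: svalP.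
exact: (svalP (step' n (f n))).
Qed.

Section FreeMap.
Variable (A : comNzRingType).

Lemma free_mapD (I J : finType) (D : I -> J -> A) v w :
  free_map D (v + w) = free_map D v + free_map D w.
Proof.
by apply/ffunP=> c; rewrite !ffunE -big_split; apply: eq_bigr => b _; rewrite ffunE mulrDl.
Qed.

Lemma free_mapN (I J : finType) (D : I -> J -> A) v : free_map D (- v) = - free_map D v.
Proof.
by apply/ffunP=> c; rewrite !ffunE -sumrN; apply: eq_bigr => b _; rewrite ffunE mulNr.
Qed.

Lemma free_mapB (I J : finType) (D : I -> J -> A) v w :
  free_map D (v - w) = free_map D v - free_map D w.
Proof. by rewrite free_mapD free_mapN. Qed.

Lemma free_map_comp (I J K : finType) (M : I -> {ffun J -> A}) (N : J -> K -> A) v :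
  free_map N (free_map M v) = free_map (fun b => free_map N (M b)) v.
Proof.
apply/ffunP=> c; rewrite !ffunE.
under eq_bigr do rewrite ffunE mulr_suml; rewrite exchange_big.
apply: eq_bigr => b _; rewrite ffunE mulr_sumr; apply: eq_bigr => j _; exact/esym/mulrA.
Qed.

Lemma free_map_addl (I J : finType) (M N : I -> {ffun J -> A}) v :
  free_map (fun b => M b + N b) v = free_map M v + free_map N v.
Proof.
by apply/ffunP=> c; rewrite !ffunE -big_split; apply: eq_bigr => b _; rewrite !ffunE mulrDr.
Qed.

Lemma free_map_oppl (I J : finType) (M : I -> {ffun J -> A}) v :
  free_map (fun b => - M b) v = - free_map M v.
Proof.
by apply/ffunP=> c; rewrite !ffunE -sumrN; apply: eq_bigr => b _; rewrite !ffunE mulrN.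
Qed.

Lemma free_map1 (I : finType) (v : {ffun I -> A}) :
  free_map (fun b => [ffun c => (b == c)%:R] : {ffun I -> A}) v = v.
Proof.
apply/ffunP=> c; rewrite ffunE (bigD1 c) //= ffunE eqxx mulr1 big1 ?addr0 // => b bc.
by rewrite ffunE (negPf bc) mulr0.
Qed.

Lemma eq_free_map (I J : finType) (M N : I -> J -> A) v :
  (forall b c, M b c = N b c) -> free_map M v = free_map N v.
Proof. by move=> h; apply/ffunP=> c; rewrite !ffunE; apply: eq_bigr => b _; rewrite h. Qed.

Lemma free_map_row (I J : finType) (D : I -> J -> A) (b : I) :
  free_map D [ffun c => (b == c)%:R] = [ffun c => D b c].
Proof.
apply/ffunP=> c; rewrite !ffunE (bigD1 b) //= ffunE eqxx mul1r big1 ?addr0 // => b' bb.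
by rewrite ffunE eq_sym (negPf bb) mul0r.
Qed.

Lemma free_map_rows (I J : finType) (D : I -> J -> A) v :
  free_map D v = free_map (fun b => [ffun c => D b c] : {ffun J -> A}) v.
Proof. by apply: eq_free_map => b c; rewrite ffunE. Qed.

End FreeMap.

(** * Homogeneous parts relative to shifted degrees *)

Section HomogeneousPart.
Variables (k : fieldType) (n : nat).
Local Notation R := {mpoly k[n]}.

(** The component that a coefficient of a basis element of degree c needs for total degree d. The
    test c <= d matters: truncated subtraction would otherwise select constants. *)
Definition hpart d c (p : R) : R :=
  if (c <= d)%N then pihomog [measure of mdeg] (d - c) p else 0.

Lemma mcoeff_hpart d c (p : R) e : (hpart d c p)@_e = if (mdeg e + c == d)%N then p@_e else 0.
Proof.
rewrite /hpart; case: (leqP c d) => cd; last first.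
  by rewrite mcoeff0 gtn_eqF // (leq_trans cd) // leq_addl.
elim/mpolyind: p => [|a m p _ _ ih]; first by rewrite linear0 mcoeff0 if_same.
rewrite linearP /= !mcoeffD !mcoeffZ ih pihomogX mcoeffX.
have -> : (mdeg e + c == d)%N = (mdeg e == d - c)%N by apply/eqP/eqP => [<-|->]; rewrite ?addnK ?subnK.
case: (m =P e) => [->|ne]; first by case: ifP; rewrite ?mcoeffX ?eqxx ?mcoeff0 // mulr0 addr0.
by rewrite mulr0 add0r; case: ifP => _; rewrite ?mcoeffX ?mcoeff0 ?(introF eqP ne) mulr0 add0r.
Qed.

Lemma hpartD d c : {morph hpart d c : p q / p + q}.
Proof.
by move=> p q; apply/mpolyP => e; rewrite mcoeffD !mcoeff_hpart mcoeffD; case: ifP; rewrite ?addr0.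
Qed.

Lemma hpart0 d c : hpart d c 0 = 0.
Proof. by apply/mpolyP => e; rewrite mcoeff_hpart mcoeff0 if_same. Qed.

Definition hom_coef (d c : nat) (p : R) := forall e, e \in msupp p -> (mdeg e + c)%N = d.

Lemma hpart_id d c p : hom_coef d c p -> hpart d c p = p.
Proof.
move=> hp; apply/mpolyP => e; rewrite mcoeff_hpart; case: eqP => // ne.
by apply/esym/memN_msupp_eq0/negP => /hp.
Qed.

Lemma hom_coef_hpart d c p : hom_coef d c (hpart d c p).
Proof.
move=> e; rewrite mcoeff_msupp mcoeff_hpart; case: ifP => [/eqP //|_]; by rewrite eqxx.
Qed.

Lemma hom_coefE d c p : hom_coef d c p <-> hpart d c p = p.
Proof. by split=> [h|<-]; [apply: hpart_id|apply: hom_coef_hpart]. Qed.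

Lemma hom_coefP d c p :
  hom_coef d c p <-> (if (c <= d)%N then p \is (d - c).-homog else p == 0).
Proof.
rewrite hom_coefE /hpart; case: ifP => _; first by rewrite homog_piE; split=> [->|/eqP].
by rewrite eq_sym; split=> [->|/eqP].
Qed.

Lemma hpartM d b c p D : hom_coef b c D -> hpart d c (p * D) = hpart d b p * D.
Proof.
move=> hD; rewrite (mpolyE D) !mulr_sumr.
rewrite (big_morph _ (hpartD d c) (hpart0 d c)) big_seq [RHS]big_seq.
apply: eq_bigr => m /hD <-; rewrite -!scalerAr; apply/mpolyP => e.
rewrite mcoeff_hpart !mcoeffZ.
case: (boolP (m <= e)%MM) => [me|nme].
  rewrite -(submK me) addmC !mcoeffMX mcoeff_hpart mdegD.
  by rewrite -addnA addnCA; case: ifP => //; rewrite mulr0.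
have z q : (q * 'X_[m])@_e = 0 :> k.
  apply: memN_msupp_eq0; rewrite (perm_mem (msuppMX _ _)); apply/negP => /mapP[f _ ef].
  by move: nme; rewrite ef lem_addr.
by rewrite !z mulr0 if_same.
Qed.

End HomogeneousPart.

Lemma submod_rpredB (k : fieldType) (V : lmodType k) (Z : submodClosed V) x y :
  x \in Z -> y \in Z -> x - y \in Z.
Proof. by move=> hx hy; rewrite -[y]scale1r -scaleNr rpredD ?rpredZ. Qed.

(** * Isomorphisms of subquotients from maps of representatives *)

Section SubquotientIso.
Variables (k : fieldType) (V V' : lmodType k) (Z B : submodClosed V) (Z' B' : submodClosed V').
Variable f : V -> V'.
Hypothesis fD : forall a x y, f (a *: x + y) = a *: f x + f y.
Hypothesis fZ : forall z, z \in Z -> f z \in Z'.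
Hypothesis fB : forall z, z \in Z -> (f z \in B') = (z \in B).
Hypothesis fS : forall z', z' \in Z' -> exists2 z, z \in Z & z' - f z \in B'.

Definition subv_map (x : subv Z) : subv Z' := exist (fun y => y \in Z') (f (\val x)) (fZ (valP x)).

Definition subquotient_map (x : subquotient Z B) : subquotient Z' B' :=
  subquotient_pi B' (subv_map (repr (x : Quotient.quot (den Z B)))).

Lemma subvf_sub x y : f (x - y) = f x - f y.
Proof. by rewrite addrC -[- y]scaleN1r fD scaleN1r addrC. Qed.

Lemma subquotient_map_pi x : subquotient_map (subquotient_pi B x) = subquotient_pi B' (subv_map x).
Proof.
apply/subquotient_piP; rewrite /= -subvf_sub fB.
  by apply/subquotient_piP; rewrite /subquotient_pi reprK.
by apply: submod_rpredB; apply: valP.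
Qed.

Lemma subquotient_map_linear : linear subquotient_map.
Proof.
move=> a x y; have [x' ->] := subquotient_pi_surj x; have [y' ->] := subquotient_pi_surj y.
rewrite -[a *: subquotient_pi B x']subquotient_piZ -subquotient_piD !subquotient_map_pi.
rewrite -[a *: subquotient_pi B' _]subquotient_piZ -subquotient_piD; congr subquotient_pi.
by apply: val_inj; rewrite /= fD.
Qed.

Lemma subquotient_iso :
  exists h : {linear subquotient Z B -> subquotient Z' B'}, bijective h.
Proof.
pose h : {linear subquotient Z B -> subquotient Z' B'} :=
  HB.pack subquotient_map (GRing.isLinear.Build _ _ _ _ subquotient_map subquotient_map_linear).
exists h.
have /= inj : injective subquotient_map.
  move=> x y; have [x' ->] := subquotient_pi_surj x; have [y' ->] := subquotient_pi_surj y.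
  rewrite !subquotient_map_pi => /subquotient_piP /=; rewrite -subvf_sub fB.
    by move=> /subquotient_piP.
  by apply: submod_rpredB; apply: valP.
have surj y : exists x, subquotient_map x = y.
  have [[y' hy] ->] := subquotient_pi_surj y; have [z hz zB] := fS hy.
  exists (subquotient_pi B (exist (fun y => y \in Z) z hz)); rewrite subquotient_map_pi.
  by apply/subquotient_piP; rewrite /= -[_ - _]scale1r -[1]opprK scaleNr -scalerN opprB rpredZ.
pose h' y := sval (cid (surj y)).
exists h' => [x|y]; last exact: (svalP (cid (surj y))).
by apply: inj; exact: (svalP (cid (surj _))).
Qed.

End SubquotientIso.

(** * Graded comparison of free resolutions *)

Section Comparison.
Variables (k : fieldType) (m : nat).
Local Notation R := {mpoly k[m]}.
Local Notation FR := (free_resolution k m).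

Definition row (F : FR) n (b : rbasis F n.+1) : {ffun rbasis F n -> R} := [ffun c => rdiff b c].

Definition res_cycle (F : FR) n : {ffun rbasis F n -> R} -> Prop :=
  match n with
  | 0%N => fun v => \sum_b (v b)@_0%MM * raug b = 0
  | n'.+1 => fun v => free_map (@rdiff _ _ F n') v = 0
  end.

Definition hom_chain (F : FR) n d (v : {ffun rbasis F n -> R}) : Prop :=
  forall b, hom_coef d (rdeg b) (v b).

Lemma res_exact (F : FR) n (v : {ffun rbasis F n -> R}) :
  res_cycle v <-> exists w, v = free_map (@rdiff _ _ F n) w.
Proof. by case: n v => [|n] v; [exact: rexact0|exact: rexactS]. Qed.

(** Exactness is ungraded in [free_resolution]. Replacing a preimage by its part of total degree d
    does not change the image, which is already homogeneous. *)
Lemma res_exact_hom (F : FR) n d (v : {ffun rbasis F n -> R}) :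
  hom_chain d v -> res_cycle v ->
  exists2 w, hom_chain d w & v = free_map (@rdiff _ _ F n) w.
Proof.
move=> hv /res_exact[w ew]; exists [ffun b => hpart d (rdeg b) (w b)].
  by move=> b; rewrite ffunE; apply: hom_coef_hpart.
apply/ffunP => c; rewrite -(hpart_id (hv c)) ew !ffunE.
rewrite (big_morph _ (hpartD d _) (hpart0 _ _ _ _)); apply: eq_bigr => b _.
by rewrite ffunE; apply: hpartM => e; apply: rdiff_homog.
Qed.

Lemma res_lift (F : FR) (I : finType) (dI : I -> nat) n (M : I -> {ffun rbasis F n -> R}) :
  (forall i, hom_chain (dI i) (M i)) -> (forall i, res_cycle (M i)) ->
  exists2 N : I -> {ffun rbasis F n.+1 -> R},
    forall i, hom_chain (dI i) (N i) & forall i, M i = free_map (@rdiff _ _ F n) (N i).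
Proof.
move=> hM cM; pose N i := sval (cid2 (res_exact_hom (hM i) (cM i))).
by exists N => i; rewrite /N; case: cid2.
Qed.

Lemma hom_coefM d b c (p q : R) : hom_coef d b p -> hom_coef b c q -> hom_coef d c (p * q).
Proof. by move=> hp hq; apply/hom_coefE; rewrite (hpartM _ _ hq) (hpart_id hp). Qed.

Lemma hom_coefD d c (p q : R) : hom_coef d c p -> hom_coef d c q -> hom_coef d c (p + q).
Proof. by move=> hp hq; apply/hom_coefE; rewrite hpartD !hpart_id. Qed.

Lemma hom_coef0 d c : hom_coef d c (0 : R).
Proof. by move=> e; rewrite msupp0. Qed.

Lemma hom_coefN d c (p : R) : hom_coef d c p -> hom_coef d c (- p).
Proof. by move=> hp e; rewrite (perm_mem (msuppN _)); apply: hp. Qed.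

Lemma hom_chainB (F : FR) n d (v w : {ffun rbasis F n -> R}) :
  hom_chain d v -> hom_chain d w -> hom_chain d (v - w).
Proof. by move=> hv hw b; rewrite !ffunE; apply: hom_coefD (hv b) (hom_coefN (hw b)). Qed.

Lemma hom_chain_row (F : FR) n (b : rbasis F n.+1) : hom_chain (rdeg b) (row b).
Proof. by move=> c; rewrite ffunE => e; apply: rdiff_homog. Qed.

Lemma hom_chain_map (F : FR) n (I : finType) (dI : I -> nat) (M : I -> {ffun rbasis F n -> R}) d
    (v : {ffun I -> R}) :
  (forall i, hom_chain (dI i) (M i)) -> (forall i, hom_coef d (dI i) (v i)) ->
  hom_chain d (free_map M v).
Proof.
move=> hM hv c; rewrite ffunE; apply: (big_ind (hom_coef d (rdeg c))).
- exact: hom_coef0.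
- exact: hom_coefD.
by move=> i _; apply: hom_coefM (hv i) (hM i c).
Qed.

Lemma rdiff_row (F : FR) n (b : rbasis F n.+2) : free_map (@rdiff _ _ F n) (row b) = 0.
Proof.
suff : res_cycle (row b) by [].
apply/res_exact; exists [ffun c => (b == c)%:R].
by apply/ffunP => c; rewrite free_map_row ffunE.
Qed.

(* [M n b] is the image of the basis element b; the augmentation is preserved. *)
Definition chain_map (F F' : FR) (M : forall n, rbasis F n -> {ffun rbasis F' n -> R}) : Prop :=
  [/\ forall n b, hom_chain (rdeg b) (M n b),
      forall b, \sum_c (M 0%N b c)@_0%MM * raug c = raug b
    & forall n b, free_map (@rdiff _ _ F' n) (M n.+1 b) = free_map (M n) (row b)].

Lemma mcoeff0M (p q : R) : (p * q)@_0%MM = p@_0%MM * q@_0%MM.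
Proof. exact: (rmorphM (mcoeff 0%MM)). Qed.

Lemma raug_map (F F' : FR) n0 (M : rbasis F n0 -> {ffun rbasis F' 0 -> R}) (a : rbasis F n0 -> k)
    (v : {ffun rbasis F n0 -> R}) :
  (forall b, \sum_c (M b c)@_0%MM * raug c = a b) ->
  \sum_c (free_map M v c)@_0%MM * raug c = \sum_b (v b)@_0%MM * a b.
Proof.
move=> h.
under eq_bigr do rewrite ffunE raddf_sum mulr_suml.
rewrite exchange_big; apply: eq_bigr => b _; rewrite -h mulr_sumr; apply: eq_bigr => c _ /=.
by rewrite mcoeff0M mulrA.
Qed.

(** The construction carries along that the image of each row of the differential is a cycle, which
    allows the next lift. It starts by sending everything to multiples of one basis element with
    nonzero augmentation, necessarily of degree 0. *)
Lemma chain_map_exists (F F' : FR) : exists M, @chain_map F F' M.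
Proof.
pose P n (M : rbasis F n -> {ffun rbasis F' n -> R}) :=
  (forall b, hom_chain (rdeg b) (M b)) /\ (forall b, res_cycle (free_map M (row b))) /\
  match n return (rbasis F n -> {ffun rbasis F' n -> R}) -> Prop with
  | 0%N => fun M => forall b, \sum_c (M b c)@_0%MM * raug c = raug b | _ => fun=> True end M.
pose Q n (M : rbasis F n -> {ffun rbasis F' n -> R}) (N : rbasis F n.+1 -> {ffun rbasis F' n.+1 -> R}) :=
  forall b, free_map (@rdiff _ _ F' n) (N b) = free_map M (row b).
have [||M [hP hQ]] := @dependent_choice_in _ P Q.
- have [b' hb'] := raug_surj F'.
  pose M0 (b : rbasis F 0) : {ffun rbasis F' 0 -> R} :=
    [ffun c => if c == b' then (raug b / raug b')%:MP else 0].
  have aM b : \sum_c (M0 b c)@_0%MM * raug c = raug b.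
    rewrite (bigD1 b') //= ffunE eqxx mcoeffC eqxx mulr1 divfK // big1 ?addr0 // => c cb.
    by rewrite ffunE (negPf cb) mcoeff0 mul0r.
  exists M0; split; [|split] => //.
    move=> b c; rewrite ffunE; case: eqP => [->|_] e; last by rewrite msupp0.
    rewrite msuppC; case: eqP => [//|/eqP nz]; rewrite inE => /eqP ->.
    rewrite (raug_homog hb') mdeg0 addn0; apply/esym/raug_homog.
    by apply: contra nz => /eqP ->; rewrite mul0r.
  move=> b; rewrite /res_cycle (raug_map _ aM).
  have : res_cycle (row b).
    apply/res_exact; exists [ffun c => (b == c)%:R].
    by apply/ffunP => c; rewrite free_map_row ffunE.
  by [].
- move=> n M [hM [cM _]].
  have hR b : hom_chain (rdeg b) (free_map M (row b)).
    by apply: hom_chain_map hM _ => c; apply: hom_chain_row.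
  have [N hN eN] := res_lift hR cM.
  exists N; last by move=> b; rewrite -eN.
  split; [|split] => // b /=; rewrite free_map_comp.
  transitivity (free_map (fun b => free_map M (row b)) (row b)).
    by apply: eq_free_map => c d; rewrite -eN.
  rewrite -free_map_comp (_ : free_map (@row F n) (row b) = 0).
    by apply/ffunP => c; rewrite !ffunE big1 // => b' _; rewrite ffunE mul0r.
  by rewrite -free_map_rows rdiff_row.
exists M; split.
- by move=> n b; have [h _] := hP n; apply: h.
- by have [_ [_ h]] := hP 0%N.
- by move=> n b; apply: hQ.
Qed.

Lemma chain_map_id (F : FR) : @chain_map F F (fun n b => [ffun c => (b == c)%:R]).
Proof.
split=> [n b c|b|n b].
- rewrite ffunE; case: eqP => [->|_] e; last by rewrite msupp0.
  by rewrite -[1]/(1%:MP) msupp1 inE => /eqP ->; rewrite mdeg0.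
- rewrite (bigD1 b) //= ffunE eqxx big1 ?addr0 => [|c cb].
    by rewrite -[1 in LHS]/(1%:MP) mcoeffC eqxx mulr1 mul1r.
  by rewrite ffunE eq_sym (negPf cb) mcoeff0 mul0r.
by rewrite free_map_row free_map1; apply/ffunP => c; rewrite !ffunE.
Qed.

Lemma chain_map_comp (F F' F'' : FR) M N : @chain_map F F' M -> @chain_map F' F'' N ->
  @chain_map F F'' (fun n b => free_map (N n) (M n b)).
Proof.
move=> [hM aM dM] [hN aN dN]; split=> [n b|b|n b].
- by apply: hom_chain_map (hN n) _; apply: hM.
- by rewrite (raug_map _ aN) aM.
rewrite free_map_comp (eq_free_map (N := fun b => free_map (N n) (row b))); last first.
  by move=> c d; rewrite dN.
by rewrite -free_map_comp -free_map_rows dM free_map_comp.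
Qed.

(** The invariant is again a cycle condition, now for the defect M - N - H d that the next homotopy
    has to bound. *)
Lemma chain_homotopy (F F' : FR) M N : @chain_map F F' M -> @chain_map F F' N ->
  exists H : forall n, rbasis F n -> {ffun rbasis F' n.+1 -> R},
    [/\ forall n b, hom_chain (rdeg b) (H n b),
        forall b, M 0%N b - N 0%N b = free_map (@rdiff _ _ F' 0) (H 0%N b)
      & forall n b, M n.+1 b - N n.+1 b =
          free_map (@rdiff _ _ F' n.+1) (H n.+1 b) + free_map (H n) (row b)].
Proof.
move=> [hM aM dM] [hN aN dN].
pose P n (H : rbasis F n -> {ffun rbasis F' n.+1 -> R}) :=
  [/\ forall b, hom_chain (rdeg b) (H b),
      forall b, res_cycle (M n.+1 b - N n.+1 b - free_map H (row b)) &
      match n return (rbasis F n -> {ffun rbasis F' n.+1 -> R}) -> Prop with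
      | 0%N => fun H => forall b, M 0%N b - N 0%N b = free_map (@rdiff _ _ F' 0) (H b)
      | _ => fun=> True end H].
pose Q n (H : rbasis F n -> {ffun rbasis F' n.+1 -> R}) (K : rbasis F n.+1 -> {ffun rbasis F' n.+2 -> R}) :=
  forall b, M n.+1 b - N n.+1 b = free_map (@rdiff _ _ F' n.+1) (K b) + free_map H (row b).
have rowrow n b : free_map (@row F n) (row b) = 0 by rewrite -free_map_rows rdiff_row.
have map0 (I J : finType) (D : I -> J -> R) : free_map D 0 = 0.
  by apply/ffunP => c; rewrite !ffunE big1 // => b' _; rewrite ffunE mul0r.
have [||H [hP hQ]] := @dependent_choice_in _ P Q.
- have c0 b : res_cycle (M 0%N b - N 0%N b).
    rewrite /res_cycle; under eq_bigr do rewrite !ffunE mcoeffB mulrBl.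
    by rewrite sumrB aM aN subrr.
  have [H hH eH] := res_lift (fun b => hom_chainB (hM 0%N b) (hN 0%N b)) c0.
  exists H; split=> // b; rewrite /res_cycle !free_mapB dM dN free_map_comp.
  have -> : free_map (fun c => free_map (@rdiff _ _ F' 0) (H c)) (row b) =
      free_map (fun c => M 0%N c - N 0%N c) (row b) by apply: eq_free_map => c d; rewrite -eH.
  by rewrite free_map_addl free_map_oppl subrr.
- move=> n H [hH cH _].
  have hR b : hom_chain (rdeg b) (M n.+1 b - N n.+1 b - free_map H (row b)).
    apply: hom_chainB; first exact: hom_chainB (hM _ b) (hN _ b).
    by apply: hom_chain_map hH _ => c; apply: hom_chain_row.
  have [K hK eK] := res_lift hR cH.
  have eQ : Q n H K by move=> b; rewrite -eK subrK.
  exists K => //; split=> // b; rewrite /res_cycle !free_mapB dM dN free_map_comp.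
  have -> : free_map (fun c => free_map (@rdiff _ _ F' n.+1) (K c)) (row b) =
      free_map (fun c => M n.+1 c - N n.+1 c - free_map H (row c)) (row b).
    by apply: eq_free_map => c d; rewrite -eK.
  by rewrite !(free_map_addl, free_map_oppl) -free_map_comp rowrow map0 subr0 subrr.
exists H; split=> [n b|b|n b].
- by have [h _ _] := hP n; apply: h.
- by have [_ _ h] := hP 0%N; apply: h.
exact: hQ.
Qed.

End Comparison.

Section TensorComparison.
Variables (k : fieldType) (m : nat) (A : comAlgType k) (phi : {rmorphism {mpoly k[m]} -> A}).
Variable (G : nat -> submodClosed A).
Hypothesis GM : forall d e p x, p \is e.-homog -> x \in G d -> x * phi p \in G (d + e)%N.
Local Notation R := {mpoly k[m]}.
Local Notation FR := (free_resolution k m).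

Definition tensor_map (I J : finType) (M : I -> J -> R) : {ffun I -> A} -> {ffun J -> A} :=
  free_map (fun b c => phi (M b c)).

Lemma tensor_map_comp (I J K : finType) (M : I -> {ffun J -> R}) (N : J -> K -> R) v :
  tensor_map N (tensor_map M v) = tensor_map (fun b => free_map N (M b)) v.
Proof.
apply/ffunP=> c; rewrite !ffunE.
under eq_bigr do rewrite ffunE mulr_suml; rewrite exchange_big.
apply: eq_bigr => b _; rewrite ffunE rmorph_sum mulr_sumr; apply: eq_bigr => j _ /=.
by rewrite rmorphM mulrA.
Qed.

Lemma tensor_map_addl (I J : finType) (M N : I -> {ffun J -> R}) v :
  tensor_map (fun b => M b + N b) v = tensor_map M v + tensor_map N v.
Proof.
apply/ffunP=> c; rewrite !ffunE -big_split; apply: eq_bigr => b _.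
by rewrite !ffunE rmorphD mulrDr.
Qed.

Lemma tensor_map_oppl (I J : finType) (M : I -> {ffun J -> R}) v :
  tensor_map (fun b => - M b) v = - tensor_map M v.
Proof.
by apply/ffunP=> c; rewrite !ffunE -sumrN; apply: eq_bigr => b _; rewrite !ffunE rmorphN mulrN.
Qed.

Lemma tensor_map1 (I : finType) (v : {ffun I -> A}) :
  tensor_map (fun b => [ffun c => (b == c)%:R] : {ffun I -> R}) v = v.
Proof.
apply/ffunP=> c; rewrite ffunE (bigD1 c) //= ffunE eqxx rmorph1 mulr1 big1 ?addr0 // => b bc.
by rewrite ffunE (negPf bc) rmorph0 mulr0.
Qed.

Lemma eq_tensor_map (I J : finType) (M N : I -> J -> R) v :
  (forall b c, M b c = N b c) -> tensor_map M v = tensor_map N v.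
Proof. by move=> h; apply: eq_free_map => b c; rewrite h. Qed.

Lemma tensor_map_linear (I J : finType) (M : I -> J -> R) a x y :
  tensor_map M (a *: x + y) = a *: tensor_map M x + tensor_map M y.
Proof.
apply/ffunP=> c; rewrite !ffunE scaler_sumr -big_split /=.
by apply: eq_bigr => b _; rewrite !ffunE mulrDl scalerAl.
Qed.

Lemma tensor_map0 (I J : finType) (M : I -> J -> R) : tensor_map M 0 = 0.
Proof. by apply/ffunP=> c; rewrite !ffunE big1 // => b _; rewrite ffunE mul0r. Qed.

Lemma tensor_chain_map (F F' : FR) i j (M : rbasis F i -> {ffun rbasis F' j -> R}) d
    (v : {ffun rbasis F i -> A}) :
  (forall b, hom_chain (rdeg b) (M b)) -> tensor_chain G d v -> tensor_chain G d (tensor_map M v).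
Proof.
move=> hM hv c; rewrite ffunE.
have hb b : if (rdeg c <= d)%N then (v b * phi (M b c) \in G (d - rdeg c)%N : Prop)
            else v b * phi (M b c) = 0.
  have := hv b; have /hom_coefP := hM b c; case: (leqP (rdeg b) d) => bd; last first.
    by move=> _ ->; rewrite mul0r; case: ifP => // _; rewrite rpred0.
  case: (leqP (rdeg c) (rdeg b)) => cb; last first.
    by move=> /eqP -> _; rewrite rmorph0 mulr0; case: ifP => // _; rewrite rpred0.
  move=> hp hx; rewrite (leq_trans cb bd).
  by have := GM hp hx; rewrite addnBA // subnK.
case: (leqP (rdeg c) d) hb => cd hb; first by apply: rpred_sum => b _; apply: hb.
by apply: big1 => b _; apply: hb.
Qed.

Lemma tensor_diffE (F : FR) i (v : {ffun rbasis F i.+1 -> A}) :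
  tensor_diff phi v = tensor_map (@rdiff _ _ F i) v.
Proof. by []. Qed.

Lemma tensor_map_diff (F F' : FR) M i (v : {ffun rbasis F i.+1 -> A}) : @chain_map k m F F' M ->
  tensor_diff phi (tensor_map (M i.+1) v) = tensor_map (M i) (tensor_diff phi v).
Proof.
move=> [_ _ dM]; rewrite !tensor_diffE.
rewrite (eq_tensor_map (M := @rdiff _ _ F i) (N := fun b => row b)); last first.
  by move=> b c; rewrite ffunE.
by rewrite !tensor_map_comp; apply: eq_tensor_map => b c; rewrite dM.
Qed.

Lemma tor_cycle_map (F F' : FR) M i d (v : {ffun rbasis F i -> A}) : @chain_map k m F F' M ->
  tor_cycle phi G d v -> tor_cycle phi G d (tensor_map (M i) v).
Proof.
move=> cM; have [hM _ _] := cM; case=> hv dv; split; first exact: tensor_chain_map.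
by case: i v hv dv => // i v _ dv; rewrite (tensor_map_diff _ cM) dv tensor_map0.
Qed.

Lemma tor_boundary_map (F F' : FR) M i d (v : {ffun rbasis F i -> A}) : @chain_map k m F F' M ->
  tor_boundary phi G d v -> tor_boundary phi G d (tensor_map (M i) v).
Proof.
move=> cM; have [hM _ _] := cM; case=> w hw ->; exists (tensor_map (M i.+1) w).
  exact: tensor_chain_map.
by rewrite (tensor_map_diff _ cM).
Qed.

Lemma tor_boundary_cycle (F : FR) i d (v : {ffun rbasis F i -> A}) :
  tor_boundary phi G d v -> tor_cycle phi G d v.
Proof.
case=> w hw ->; rewrite tensor_diffE.
rewrite (eq_tensor_map (M := @rdiff _ _ F i) (N := fun b => row b)); last first.
  by move=> b c; rewrite ffunE.
split; first by apply: tensor_chain_map hw; apply: hom_chain_row.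
case: i v w hw => // i v w hw; rewrite tensor_diffE tensor_map_comp.
apply/ffunP => c; rewrite !ffunE big1 // => b _.
by rewrite rdiff_row ffunE rmorph0 mulr0.
Qed.

Lemma tor_homotopy (F F' : FR) M N i d (v : {ffun rbasis F i -> A}) :
  @chain_map k m F F' M -> @chain_map k m F F' N -> tor_cycle phi G d v ->
  tor_boundary phi G d (tensor_map (M i) v - tensor_map (N i) v).
Proof.
move=> cM cN [hv dv]; have [H [hH eH0 eHS]] := chain_homotopy cM cN.
exists (tensor_map (H i) v); first exact: tensor_chain_map.
rewrite tensor_diffE tensor_map_comp -tensor_map_oppl -tensor_map_addl.
case: i v hv dv => [|i] v hv dv.
  by apply: eq_tensor_map => b c; rewrite eH0.
rewrite (eq_tensor_map (N := fun b => free_map (@rdiff _ _ F' i.+1) (H i.+1 b) +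
    free_map (H i) (row b))); last by move=> b c; rewrite eHS.
rewrite tensor_map_addl -[X in _ + X]tensor_map_comp.
rewrite (_ : tensor_map (@row k m F i) v = 0) ?tensor_map0 ?addr0 //.
rewrite -[RHS]dv tensor_diffE; apply: eq_tensor_map => b c; by rewrite ffunE.
Qed.

(** Chain maps exist both ways and their composites are homotopic to the identity; one composite
    gives injectivity, the other surjectivity. *)
Lemma tor_comparison (F F' : FR) i d :
  exists f : {linear tor phi G F i d -> tor phi G F' i d}, bijective f.
Proof.
have [M cM] := chain_map_exists F F'; have [N cN] := chain_map_exists F' F.
apply: (@subquotient_iso _ _ _ _ _ _ _ (tensor_map (M i))).
- exact: tensor_map_linear.
- by move=> z /subspace_ofP hz; apply/subspace_ofP; apply: tor_cycle_map.
- move=> z /subspace_ofP hz; apply/subspace_ofP/subspace_ofP; last exact: tor_boundary_map.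
  move/(tor_boundary_map cN); rewrite tensor_map_comp => h1.
  have h2 := tor_homotopy (chain_map_comp cM cN) (chain_map_id F) hz.
  rewrite tensor_map1 in h2.
  set y := tensor_map _ _ in h1 h2; rewrite -[z](subKr y).
  apply/(subspace_ofP (tor_boundary_subspace phi G F i d)).
  by apply: submod_rpredB; apply/subspace_ofP.
move=> z' /subspace_ofP hz; exists (tensor_map (N i) z').
  by apply/subspace_ofP; apply: tor_cycle_map.
rewrite tensor_map_comp; apply/subspace_ofP.
have := tor_homotopy (chain_map_id F') (chain_map_comp cN cM) hz.
by rewrite tensor_map1.
Qed.

End TensorComparison.

(** * Cycles and boundaries *)

Section Differential.
Variable k : fieldType.
Local Notation R n := {mpoly k[n.+1]}.

Lemma kdelE n (f : {poly R n.+1}) : kdel f = gpoly n * rho f.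
Proof. by rewrite kdel.unlock. Qed.

Lemma kdel'E n (f : {poly R n.+1}) : kdel' f = (gpoly n * rho f)^`() - gpoly n * rho f^`().
Proof. by rewrite kdel'.unlock !kdelE. Qed.

Lemma rho_zero n : rho (0 : {poly R n.+1}) = 0.
Proof. by rewrite -[0 in LHS](subrr 0) rhoB subrr. Qed.

Lemma kdel0 n : kdel (0 : {poly R n.+1}) = 0.
Proof. by rewrite kdelE rho_zero mulr0. Qed.

Lemma kdel'0 n : kdel' (0 : {poly R n.+1}) = 0.
Proof. by rewrite kdel'E deriv0 rho_zero mulr0 deriv0 subr0. Qed.

Lemma kdel_deriv n (f : {poly R n.+1}) : kdel f^`() + kdel' f = (kdel f)^`().
Proof. by rewrite kdel'.unlock addrC subrK. Qed.

Lemma kdel_gpolyM n (f : {poly R n.+1}) : kdel (gpoly n.+1 * f) = 0.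
Proof. by rewrite kdelE rhoM rho_gpoly mul0r mulr0. Qed.

Lemma kdel'_gpolyM n (f : {poly R n.+1}) : kdel' (gpoly n.+1 * f) = - (gpoly n ^+ 2 * rho f).
Proof.
rewrite kdel'.unlock kdel_gpolyM deriv0 sub0r kdelE derivM rhoD !rhoM rho_gpoly' rho_gpoly.
by rewrite mul0r addr0 mulrA -expr2.
Qed.

Lemma kdel'_gpoly2M n (f : {poly R n.+1}) : kdel' (gpoly n.+1 ^+ 2 * f) = 0.
Proof. by rewrite expr2 -mulrA kdel'_gpolyM rhoM rho_gpoly mul0r mulr0 oppr0. Qed.

(** The second derivative of P_(n+1) goes to 2 P_n', and this contribution cancels the derivative of
    P_n^2. *)
Lemma kdel'_syzd n (s : {poly R n.+1}) :
  kdel' (gpoly n.+1 * s)^`() = gpoly n ^+ 2 * syzd s.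
Proof.
rewrite kdel'E (derivM (gpoly n.+1)) rhoD !rhoM rho_gpoly' rho_gpoly mul0r addr0.
rewrite derivD (derivM (gpoly n.+1)) (derivM (gpoly n.+1)^`()) !rhoD !rhoM rho_gpoly' rho_gpoly'' rho_gpoly mul0r addr0.
rewrite !derivM /syzd.
move: (gpoly n) (gpoly n)^`() (rho s) (rho s)^`() (rho s^`()) => P P' r r' t.
by ring.
Qed.

Lemma kdel_eq0 n d (f : {poly R n.+1}) : phomog d.+1 f -> kdel f = 0 ->
  exists2 s, phomog d s & f = gpoly n.+1 * s.
Proof.
move=> hf e; apply: phomog_rho_eq0 => //.
by apply: (@gpolyI k n); rewrite mulr0 -kdelE.
Qed.

(** A vanishing of H^1 on P^1: [lam r] and the lift L at infinity differ by P_(n+1) E, and removing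
    the part of E from t^M on corrects [lam r] to a lift of degree at most N. *)
Lemma kdel_lift n d N (r : {poly R n}) : (n <= N)%N -> phomog d.+1 r -> (size r <= N.+1 + d.+1)%N ->
  exists G : {poly R n.+1}, [/\ phomog d.+1 G, (size G <= N.+1)%N & kdel G = gpoly n * r].
Proof.
move=> nN hr sr; have [L [hL eL sL]] := revlift hr.
have [M eM] : exists M, M = (d.+1 * n.+1)%N by exists (d.+1 * n.+1)%N.
rewrite -eM in eL.
have [E hE eE] : exists2 E, phomog d E & 'X^M * lam r - L = gpoly n.+1 * E.
  apply: phomog_rho_eq0; first by apply: phomogB hL; apply: phomogXnM; apply: phomog_lam.
  by rewrite rhoB rhoM rhoXn rho_lam eL subrr.
exists (lam r - gpoly n.+1 * drop_poly M E); split.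
- apply: phomogB; first exact: phomog_lam.
  by apply: phomog_gpolyM; apply: phomog_drop.
- apply: (@size_XnM_le _ M).
  have -> : 'X^M * (lam r - gpoly n.+1 * drop_poly M E) = L + gpoly n.+1 * take_poly M E.
    rewrite mulrBr -[X in X - _](subrK L) eE -{1}[E](poly_take_drop M).
    by move: (take_poly M E) (drop_poly M E) (gpoly n.+1) 'X^M => a b c x; ring.
  apply: size_add_leq.
    apply: leq_trans sL _; apply: (leq_trans (leq_add sr (leqnn _))).
    by rewrite eM mulnS; move: (d.+1 * n)%N => x; lia.
  apply: (leq_trans (size_gpolyM_le _)); rewrite [X in (_ <= X)%N]addnC.
  by apply: leq_add => //; apply: size_take_poly.
by rewrite kdelE rhoB rhoM rho_lam rho_gpoly mul0r subr0.
Qed.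

Hypothesis hk : 2%N \notin [pchar k].

Lemma Hermite_eq0 g n d (f : {poly R n}) : (n + d = g.+1)%N -> phomog d f ->
  (forall S : {set 'I_g.+1}, #|S| = n -> Hermite (desc S) f = 0) -> f = 0.
Proof.
move=> nd hf h; apply/polyP => j; rewrite coef0.
apply: (hermite_inj hk nd (hf j)) => S cS.
by rewrite -coef_Hermite h // coef0.
Qed.

Lemma size_Hermite_le g n d N (f : {poly R n}) : (n + d = g.+1)%N -> phomog d f ->
  (forall S : {set 'I_g.+1}, #|S| = n -> (size (Hermite (desc S) f) <= N)%N) -> (size f <= N)%N.
Proof.
move=> nd hf h; apply/leq_sizeP => j Nj.
apply: (hermite_inj hk nd (hf j)) => S cS.
by rewrite -coef_Hermite nth_default // (leq_trans (h S cS)).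
Qed.

Lemma size_Hermite n l (f : {poly R n}) : (size (Hermite l f) <= size f)%N.
Proof.
by apply/leq_sizeP => j Nj; rewrite coef_Hermite nth_default // hermite0.
Qed.

Lemma Hermite_surj g n d N (G : {set 'I_g.+1} -> {poly k}) : (n + d = g.+1)%N ->
  (forall S : {set 'I_g.+1}, #|S| = n -> (size (G S) <= N)%N) ->
  exists f : {poly R n}, [/\ phomog d f, (size f <= N)%N &
    forall S : {set 'I_g.+1}, #|S| = n -> Hermite (desc S) f = G S].
Proof.
move=> nd hG; pose c j := sval (cid2 (@hermite_surj k hk g n d (fun S => (G S)`_j) nd)).
have hc j : c j \is d.-homog by rewrite /c; case: cid2.
have ec j (S : {set 'I_g.+1}) : #|S| = n -> hermite (desc S) (c j) = (G S)`_j.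
  by move=> cS; rewrite /c; case: cid2 => x _ h /=; rewrite h.
exists (\poly_(j < N) c j); split.
- by move=> j; rewrite coef_poly; case: ifP => // _; rewrite dhomog0.
- exact: size_poly.
move=> S cS; apply/polyP => j; rewrite coef_Hermite coef_poly; case: (ltnP j N) => jN.
  exact: ec.
by rewrite hermite0 nth_default // (leq_trans (hG S cS)).
Qed.

Lemma HermiteCM n l (c : k) (f : {poly R n}) : Hermite l ((c%:MP)%:P * f) = c%:P * Hermite l f.
Proof.
by apply/polyP => j; rewrite coef_Hermite !coefCM coef_Hermite mul_mpolyC hermiteZ.
Qed.

Lemma psi_linear n c (F G : {ffun 'I_n.+3 -> R n.+2}) :
  psi (c *: F + G) = (c%:MP)%:P * psi F + psi G.
Proof.
rewrite /psi; have -> : fhat (c *: F + G) = (c%:MP)%:P * fhat F + fhat G.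
  apply/polyP => j; rewrite coefD coefCM !coef_poly; case: ifP => _; last by rewrite mulr0 addr0.
  by rewrite !ffunE mul_mpolyC.
have -> : gpoly n.+2 * ((c%:MP)%:P * fhat F + fhat G) =
    (c%:MP)%:P * (gpoly n.+2 * fhat F) + gpoly n.+2 * fhat G.
  by move: (fhat F) (fhat G) (gpoly n.+2) (c%:MP)%:P => a b x y; ring.
have -> (X Y : {poly R n.+2}) : drop_poly n.+3 ((c%:MP)%:P * X + Y) =
    (c%:MP)%:P * drop_poly n.+3 X + drop_poly n.+3 Y.
  by apply/polyP => j; rewrite coefD coefCM !coef_drop_poly coefD coefCM.
by rewrite rhoD rhoM rhoC rho0C rhoD rhoM rhoC rho0C.
Qed.

End Differential.

Lemma ffun_subE (I : finType) (V : zmodType) (x y : {ffun I -> V}) i : (x - y) i = x i - y i.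
Proof. by rewrite !ffunE. Qed.

Lemma ffun_linE (I : finType) (A : nzRingType) (V : lmodType A) a (x y : {ffun I -> V}) i :
  (a *: x + y) i = a *: x i + y i.
Proof. by rewrite !ffunE. Qed.

Lemma ffun0E (I : finType) (V : zmodType) i : (0 : {ffun I -> V}) i = 0.
Proof. by rewrite ffunE. Qed.

(** * Morphism laws for bare functions, applied to [dehom] *)

Section RmorphGen.
Variables (A B : comNzRingType) (f : A -> B).
Hypotheses (fz : zmod_morphism f) (fm : monoid_morphism f).

Lemma morph0 : f 0 = 0.
Proof. by rewrite -(subrr 0) fz subrr. Qed.

Lemma morphN x : f (- x) = - f x.
Proof. by rewrite -[- x]sub0r fz morph0 sub0r. Qed.

Lemma morphD x y : f (x + y) = f x + f y.
Proof. by rewrite -[y]opprK fz !morphN opprK. Qed.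

Lemma morph_sign n : f ((-1) ^+ n) = (-1) ^+ n.
Proof. by elim: n => [|n ih]; rewrite ?expr0 ?exprS ?mulN1r ?morphN ?ih // fm.1. Qed.

Lemma morph_sum I r (P : pred I) (F : I -> A) :
  f (\sum_(i <- r | P i) F i) = \sum_(i <- r | P i) f (F i).
Proof. exact: (big_morph f morphD morph0). Qed.

End RmorphGen.

Section Dehom.
Variable k : fieldType.
Implicit Types P Q : {poly {poly k}}.

Lemma dehomD P Q : dehom (P + Q) = dehom P + dehom Q.
Proof. exact (morphD (@dehom_zmod k) P Q). Qed.

Lemma dehomB P Q : dehom (P - Q) = dehom P - dehom Q.
Proof. exact: dehom_zmod. Qed.

Lemma dehomM P Q : dehom (P * Q) = dehom P * dehom Q.
Proof. exact ((@dehom_monoid k).2 P Q). Qed.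

Lemma dehom_sign n : dehom ((-1) ^+ n) = (-1) ^+ n :> tuv_field k.
Proof. exact (morph_sign (@dehom_zmod k) (@dehom_monoid k) n). Qed.

Lemma dehom_sum I r (P : pred I) (F : I -> {poly {poly k}}) :
  dehom (\sum_(i <- r | P i) F i) = \sum_(i <- r | P i) dehom (F i).
Proof. exact (morph_sum (@dehom_zmod k) r P F). Qed.

End Dehom.

(** * Koszul chains as families of polynomials in t and v *)

Section KoszulChains.
Variables (k : fieldType) (g : nat).
Hypotheses (hk : 2%N \notin [pchar k]) (hg : (3 <= g)%N).
Local Notation R n := {mpoly k[n.+1]}.
Local Notation phi := (@tangent_param_fraction k g).
Local Notation KR := (koszul_resolution k g.+1).
Local Notation sec := (@sections k g).
Implicit Type Q : {set 'I_g.+1} -> {poly {poly k}}.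

Lemma sections_mul d e (p : {mpoly k[g.+1]}) (x : tuv_field k) :
  p \is e.-homog -> x \in sec d -> x * phi p \in sec (d + e)%N.
Proof.
move=> hp /subspace_ofP hx; apply/subspace_ofP => i; have [N [r hr er]] := hx i.
exists N, (r * p); first by rewrite addnAC dhomogM.
by rewrite mulrAC er rmorphM.
Qed.

(** A chain with values in O_T(j), written in the chart u = 1. Q is defined on all subsets so that
    [kd] applies to it; its values on m-subsets determine the chain. *)
Definition chain_of m j Q : {ffun rbasis KR m -> tuv_field k} :=
  [ffun B : kset g.+1 m => uloc k ^+ j * dehom (Q (val B))].

Lemma kset_val m (S : {set 'I_g.+1}) : #|S| = m -> exists B : kset g.+1 m, val B = S.
Proof. by move=> /eqP cS; exists (kmk cS). Qed.

Lemma card_kset m (B : kset g.+1 m) : #|val B| = m.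
Proof. exact: (eqP (valP B)). Qed.

Lemma chain_ofE m j Q (B : kset g.+1 m) : chain_of m j Q B = uloc k ^+ j * dehom (Q (val B)).
Proof. by rewrite /chain_of ffunE. Qed.

Lemma eq_chain_of m j Q Q' : (forall S : {set 'I_g.+1}, #|S| = m -> Q S = Q' S) ->
  chain_of m j Q = chain_of m j Q'.
Proof.
move=> h; apply/ffunP => B; rewrite (chain_ofE j Q B) (chain_ofE j Q' B).
congr (_ * dehom _); exact: h (card_kset B).
Qed.

Lemma chain_of_inj m j Q Q' : chain_of m j Q = chain_of m j Q' ->
  forall S : {set 'I_g.+1}, #|S| = m -> Q S = Q' S.
Proof.
move=> e S /kset_val[B <-]; apply: dehom_inj.
have := congr1 (fun F : {ffun _} => F B) e.
rewrite (chain_ofE j Q B) (chain_ofE j Q' B).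
by move/(mulfI (expf_neq0 j (uloc_neq0 k))).
Qed.

Lemma chain_ofB m j Q Q' : chain_of m j Q - chain_of m j Q' = chain_of m j (fun S => Q S - Q' S).
Proof.
apply/ffunP => B; rewrite ffun_subE (chain_ofE j Q B) (chain_ofE j Q' B).
by rewrite (chain_ofE j (fun S => Q S - Q' S) B) dehomB mulrBr.
Qed.

Lemma chain_of_linear m j a Q Q' :
  chain_of m j (fun S => a%:P%:P * Q S + Q' S) = a *: chain_of m j Q + chain_of m j Q'.
Proof.
apply/ffunP => B; rewrite ffun_linE (chain_ofE j Q B) (chain_ofE j Q' B).
rewrite (chain_ofE j (fun S => a%:P%:P * Q S + Q' S) B) dehomD dehomZ mulrDr.
by rewrite -scalerAr.
Qed.

Lemma tensor_diff_chain_of m j Q :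
  tensor_diff (F := KR) phi (chain_of m.+1 j Q) = chain_of m j.+1 (kdiff Q).
Proof.
apply/ffunP => C; rewrite /tensor_diff (@free_map_kmat k g.+1 (tuv_field k) phi).
rewrite (chain_ofE j.+1 (kdiff Q) C) /kdiff /kd dehom_sum mulr_sumr; apply: eq_bigr => s sC.
have [B eB] : exists B : kset g.+1 m.+1, val B = s |: val C.
  by apply: kset_val; rewrite cardsU1 sC card_kset.
rewrite -eB kext_val (chain_ofE j Q B).
rewrite -[LHS]/((-1) ^+ ksgn s (val C) * (@tangent_param_fraction k g 'X_s *
  (uloc k ^+ j * dehom (Q (val B))))).
rewrite dehom_zc (dehomM (_ ^+ _)) dehom_sign dehomM.
have gen (F : fieldType) (x u a b c : F) : x * (u * a * (b * c)) = u * b * (x * (a * c)).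
  by ring.
by rewrite gen exprS.
Qed.

Lemma tensor_chain_of m j d Q : (m <= d)%N -> j = (d - m)%N ->
  (forall S : {set 'I_g.+1}, #|S| = m -> is_section g j (uloc k ^+ j * dehom (Q S))) ->
  tensor_chain (F := KR) sec d (chain_of m j Q).
Proof.
move=> md ej h B /=; rewrite md -ej (chain_ofE j Q B); apply/subspace_ofP; apply: h; exact: card_kset.
Qed.

Lemma chain_of_ex m j d (v : {ffun rbasis KR m -> tuv_field k}) : (m <= d)%N -> j = (d - m)%N ->
  tensor_chain (F := KR) sec d v -> exists2 Q, v = chain_of m j Q &
  forall S : {set 'I_g.+1}, #|S| = m ->
    [/\ (size (Q S) <= j.+1)%N, (Q S)`_1 = ((Q S)`_0)^`(),
      (size ((Q S)`_0)%R <= (g * j).+1)%N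
    & j = 2 -> (Q S)`_0 = 0 -> (size ((Q S)`_2)%R <= 2 * g - 3)%N].
Proof.
move=> md ej hv.
have hQ (B : kset g.+1 m) : is_section g j (v B).
  by have := hv B; rewrite /= md -ej => /subspace_ofP.
pose q B := sval (cid (sectionP hg (hQ B))).
have hq B : [/\ v B = uloc k ^+ j * dehom (q B), (size (q B) <= j.+1)%N, (q B)`_1 = ((q B)`_0)^`(),
      (size ((q B)`_0)%R <= (g * j).+1)%N
    & j = 2 -> (q B)`_0 = 0 -> (size ((q B)`_2)%R <= 2 * g - 3)%N].
  exact: (svalP (cid (sectionP hg (hQ B)))).
exists (fun S => if insub S is Some B then q B else 0).
  apply/ffunP => B; rewrite (chain_ofE j _ B) valK; by have [] := hq B.
move=> S /kset_val[B <-]; rewrite valK; by have [] := hq B.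
Qed.

Lemma chain_of0 m j : chain_of m j (fun=> 0) = 0.
Proof.
apply/ffunP => B; rewrite (chain_ofE j (fun=> 0) B) (morph0 (@dehom_zmod k)) mulr0.
by rewrite ffun0E.
Qed.

End KoszulChains.

Section WeymanCycles.
Variables (k : fieldType) (g : nat).
Hypotheses (hk : 2%N \notin [pchar k]) (hg : (3 <= g)%N).
Local Notation R n := {mpoly k[n.+1]}.
Local Notation phi := (@tangent_param_fraction k g).
Local Notation KR := (koszul_resolution k g.+1).
Local Notation sec := (@sections k g).
Local Notation chain_of := (@chain_of k g).
Local Notation gfam f0 f1 f2 := (@fam k _ g.+1 f0 f1 f2).

Lemma poly2E (Q : {poly {poly k}}) : (size Q <= 2)%N -> Q = (Q`_0)%:P + (Q`_1)%:P * 'X.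
Proof.
move=> sQ; apply/polyP => -[|[|j]]; rewrite coefD coefC coefCM coefX ?mulr0n ?mulr1n /=.
- by rewrite mulr0 addr0.
- by rewrite mulr1 add0r.
by rewrite mulr0 addr0 nth_default // (leq_trans sQ).
Qed.

Lemma poly3E (Q : {poly {poly k}}) : (size Q <= 3)%N ->
  Q = (Q`_0)%:P + (Q`_1)%:P * 'X + (Q`_2)%:P * 'X^2.
Proof.
move=> sQ; apply/polyP => -[|[|[|j]]]; rewrite !coefD coefC !coefCM coefX coefXn /= ?mulr0n ?mulr1n.
- by rewrite !mulr0 !addr0.
- by rewrite mulr1 add0r mulr0 addr0.
- by rewrite mulr0 mulr1 !add0r.
by rewrite !mulr0 !addr0 nth_default // (leq_trans sQ).
Qed.

Lemma coef_poly4 (a b c e : {poly k}) (Q := a%:P + b%:P * 'X + c%:P * 'X^2 + e%:P * 'X^3) :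
  [/\ Q`_0 = a, Q`_1 = b, Q`_2 = c & Q`_3 = e].
Proof.
by rewrite /Q; split; rewrite !coefD coefC !coefCM coefX !coefXn /=
   ?mulr0 ?mulr1 ?add0r ?addr0.
Qed.

Lemma phomog_kdel n d (f : {poly R n.+1}) : phomog d f -> phomog d.+1 (kdel f).
Proof. by move=> h; rewrite kdelE; apply: phomog_gpolyM; apply: phomog_rho. Qed.

Lemma phomog_kdel' n d (f : {poly R n.+1}) : phomog d f -> phomog d.+1 (kdel' f).
Proof.
move=> h; rewrite kdel'.unlock; apply: phomogB.
  by apply: phomog_deriv; apply: phomog_kdel.
by apply: phomog_kdel; apply: phomog_deriv.
Qed.

(** Injectivity of Hermite reciprocity turns vanishing on all n-subsets into equations between
    polynomials, read off at 1, v^2 and v^3. *)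
Lemma kdiff_fam_eq0 n d (f0 f1 f2 : {poly R n.+1}) : (n + d = g)%N ->
  phomog d f0 -> phomog d f1 -> phomog d f2 ->
  (forall S : {set 'I_g.+1}, #|S| = n -> kdiff (gfam f0 f1 f2) S = 0) ->
  [/\ kdel f0 = 0, kdel f2 + kdel' f1 = 0 & kdel' f2 = 0].
Proof.
move=> nd h0 h1 h2 h.
have nd' : (n + d.+1 = g.+1)%N by rewrite addnS nd.
have e (S : {set 'I_g.+1}) (cS : #|S| = n) : [/\ Hermite (desc S) (kdel f0) = 0,
   Hermite (desc S) (kdel f2 + kdel' f1) = 0 & Hermite (desc S) (kdel' f2) = 0].
  have := h S cS; rewrite (kdiff_fam hk nd cS h0 h1 h2 (fun _ _ => erefl)) /fam.
  move: (Hermite _ _) (Hermite _ _) (Hermite _ _) (Hermite _ _) => e c b a.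
  have [ea _ ec ee] := coef_poly4 a b c e.
  by move=> e0; rewrite e0 !coef0 in ea ec ee.
split; apply: (Hermite_eq0 hk nd'); try by move=> S /e[].
- exact: phomog_kdel.
- by apply: phomogD; [exact: phomog_kdel|exact: phomog_kdel'].
- exact: phomog_kdel'.
Qed.

Lemma section_boundary n d (G : {poly R n.+1}) : (n + d = g)%N -> phomog d G -> (size G <= g.+1)%N ->
  tor_boundary (F := KR) phi sec (n + 2)
    (chain_of n 2 (gfam (kdel G) (kdel G)^`() (kdel' G^`()))).
Proof.
move=> nd hG sG; exists (chain_of n.+1 1 (gfam G G^`() 0)).
  apply: tensor_chain_of; rewrite ?addn2 //; first by rewrite subSS subSn ?subnn.
  move=> S cS; rewrite expr1 /fam Hermite0 mul0r addr0 Hermite_deriv.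
  by apply: section1; apply: leq_trans sG; apply: size_Hermite.
rewrite tensor_diff_chain_of; apply: eq_chain_of => S cS.
have hG' := phomog_deriv hG.
rewrite (kdiff_fam hk nd cS hG hG' (phomog0 _ _ _) (fun _ _ => erefl)).
by rewrite kdel_deriv kdel0 add0r kdel'0 Hermite0 mul0r addr0.
Qed.

(* A chain with values in H^0(O_T(1)) is G + G' v; if the part of its boundary
   that is free of v vanishes, then G is a multiple P_(n+1) s. *)
Lemma boundaryP n q (r : {poly R n}) : (n + q.+3 = g)%N -> phomog q.+4 r ->
  tor_boundary (F := KR) phi sec (n + 2) (chain_of n 2 (gfam 0 0 r)) <->
  exists s, [/\ phomog q.+2 s, (size s <= q.+3)%N & r = gpoly n ^+ 2 * syzd s].
Proof.
move=> nq hr; split=> [[w hw ew]|[s [hs ss ->]]]; last first.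
  have := @section_boundary n q.+3 (gpoly n.+1 * s) nq (phomog_gpolyM hs).
  rewrite kdel_gpolyM deriv0 kdel'_syzd; apply.
  apply: (leq_trans (size_gpolyM_le _)); apply: leq_trans (leq_add (leqnn _) ss) _.
  by rewrite -nq addSn.
have [||Q eQ hQ] := @chain_of_ex k g hg n.+1 1 (n + 2) w _ _ hw; rewrite ?addn2 //.
  by rewrite subSS subSn ?subnn.
have nq' : (n.+1 + q.+3 = g.+1)%N by rewrite addSn nq.
have [|G [hG sG eG]] := @Hermite_surj k hk g n.+1 q.+3 g.+1 (fun S => (Q S)`_0) nq'.
  by move=> S /hQ[_ _ h _]; rewrite muln1 in h.
have nd' : (n + q.+4 = g.+1)%N by rewrite addnS nq.
have eQ' (S : {set 'I_g.+1}) : #|S| = n.+1 -> Q S = gfam G G^`() 0 S.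
  move=> cS; have [s2 q1 _ _] := hQ S cS.
  by rewrite (poly2E s2) q1 /fam Hermite0 mul0r addr0 Hermite_deriv eG.
move: ew; rewrite eQ tensor_diff_chain_of => /chain_of_inj ew.
have {}ew (S : {set 'I_g.+1}) (cS : #|S| = n) : Hermite (desc S) (kdel G) = 0 /\
   Hermite (desc S) (r - kdel' G^`()) = 0.
  have := ew S cS; have hG' := phomog_deriv hG.
  rewrite (kdiff_fam hk nq cS hG hG' (phomog0 _ _ _) eQ') kdel0 add0r /fam !Hermite0 HermiteB.
  move: (Hermite _ _) (Hermite _ _) (Hermite _ _) (Hermite _ _) (Hermite _ _) => f e c b a.
  rewrite mul0r !add0r => eab.
  have [h0 _ h2 _] := coef_poly4 b c e f.
  by rewrite -eab ?coefCM ?coefXn ?mulr0 ?mulr1 /= in h0 h2; split=> //; rewrite -h2 ?subrr.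
have kG : kdel G = 0.
  by apply: (Hermite_eq0 hk nd') => [|S /ew[]//]; apply: phomog_kdel.
have [s hs es] := kdel_eq0 hG kG.
exists s; split=> //.
  by apply: (@size_gpolyM_leq k n.+1); rewrite -es nq'.
rewrite -kdel'_syzd -es; apply/eqP; rewrite -subr_eq0; apply/eqP.
apply: (Hermite_eq0 hk nd') => [|S /ew[]//].
by apply: phomogB => //; apply: phomog_kdel'; apply: phomog_deriv.
Qed.

End WeymanCycles.

(** * The isomorphism *)

Lemma sub_shuffle (V : zmodType) (x y z : V) : x - y = z - (y - (x - z)).
Proof. by rewrite opprB addrA [z + (x - z)]addrC subrK. Qed.

Section WeymanIso.
Variables (k : fieldType) (g : nat).
Hypotheses (hk : 2%N \notin [pchar k]) (hg : (3 <= g)%N).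
Local Notation R n := {mpoly k[n.+1]}.
Local Notation phi := (@tangent_param_fraction k g).
Local Notation KR := (koszul_resolution k g.+1).
Local Notation sec := (@sections k g).
Local Notation chain_of := (@chain_of k g).
Local Notation gfam f0 f1 f2 := (@fam k _ g.+1 f0 f1 f2).

Lemma fam00E n (f : {poly R n}) (S : {set 'I_g.+1}) :
  gfam 0 0 f S = (Hermite (desc S) f)%:P * 'X^2.
Proof. by rewrite /fam Hermite0 mul0r !add0r. Qed.

Definition weyman_chain n (F : {ffun 'I_n.+3 -> R n.+2}) : {ffun rbasis KR n -> tuv_field k} :=
  chain_of n 2 (gfam 0 0 (gpoly n ^+ 2 * psi F)).

Lemma weyman_chain_linear n a (F G : {ffun 'I_n.+3 -> R n.+2}) :
  weyman_chain (a *: F + G) = a *: weyman_chain F + weyman_chain G.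
Proof.
rewrite /weyman_chain -chain_of_linear; apply: eq_chain_of => S _.
rewrite !fam00E psi_linear mulrDr [gpoly n ^+ 2 * (_ * psi F)]mulrCA HermiteD HermiteCM polyCD polyCM.
by rewrite mulrDl !mulrA.
Qed.

Lemma phomog_weyman n q (F : {ffun 'I_n.+3 -> R n.+2}) : koszul_num q F ->
  phomog q.+4 (gpoly n ^+ 2 * psi F).
Proof.
move=> [hF _]; rewrite expr2 -mulrA; apply: phomog_gpolyM; apply: phomog_gpolyM.
exact: phomog_psi.
Qed.

(** The factor P_(n+1)^2 is killed by both [kdel] and [kdel']. The degree is at most 2(n+1) + 2q + 2
    = 2g - 4, as [section2] requires. *)
Lemma weyman_chain_cycle n q (F : {ffun 'I_n.+4 -> R n.+3}) : (n.+1 + q.+3 = g)%N ->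
  koszul_num q F -> tor_cycle (F := KR) phi sec (n.+1 + 2) (weyman_chain F).
Proof.
move=> nq hF; have hr := phomog_weyman hF; split.
  apply: tensor_chain_of; rewrite ?leq_addr ?addKn //.
  move=> S cS; rewrite fam00E; apply: (section2 hg hk).
  apply: (leq_trans (size_Hermite _ _)); rewrite expr2 -mulrA.
  apply: (leq_trans (size_gpolyM_le _)); apply: (leq_trans (leq_add (leqnn _) (size_gpolyM_le _))).
  apply: (leq_trans (leq_add (leqnn _) (leq_add (leqnn _) (size_psi hF)))).
  by clear -nq; lia.
rewrite tensor_diff_chain_of.
have nd : (n + q.+4 = g)%N by clear -nq; lia.
rewrite -[RHS](chain_of0 k g n 3); apply: eq_chain_of => S cS.
rewrite (kdiff_fam hk nd cS (phomog0 _ _ _) (phomog0 _ _ _) hr (fun _ _ => erefl)).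
rewrite kdel'_gpoly2M expr2 -mulrA kdel_gpolyM kdel0 kdel'0 !addr0 fam00E.
by rewrite !Hermite0 !mul0r addr0.
Qed.

Lemma weyman_chain_boundary n q (F : {ffun 'I_n.+3 -> R n.+2}) : (n + q.+3 = g)%N ->
  koszul_num q F -> tor_boundary (F := KR) phi sec (n + 2) (weyman_chain F) <->
    koszul_den (weyman_space k n.+2) q F.
Proof.
move=> nq hF; have hr := phomog_weyman hF.
rewrite (boundaryP hk hg nq hr); split=> [[s [hs ss es]]|].
  apply: (psi_inj hF hs ss); apply: (@gpolyI k n); apply: (@gpolyI k n).
  by rewrite !mulrA -!expr2.
move=> /(@den_bil k n.+2 q (2 * n.+2) F (leqnn _))[C hC eF].
rewrite -window_weyman_poly // in eF.
have [|_ [s [hs ss es]]] := @psi_weyman_poly k n q (2 * n.+2) C _ hC.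
  by rewrite leq_pmull.
by exists s; split=> //; rewrite eF es.
Qed.

(* A boundary makes the part F_0 + F_0' v of a cycle vanish; the remaining v^2 f
   is a cycle only if P_n^2 divides f. *)
Lemma cycle_weyman_chain n q (v : {ffun rbasis KR n.+1 -> tuv_field k}) : (n.+1 + q.+3 = g)%N ->
  tor_cycle (F := KR) phi sec (n.+1 + 2) v -> exists2 F : {ffun 'I_n.+4 -> R n.+3},
  koszul_num q F & tor_boundary (F := KR) phi sec (n.+1 + 2) (v - weyman_chain F).
Proof.
move=> nq cv; have nd : (n + q.+4 = g)%N by clear -nq; lia.
have nd' : (n.+1 + q.+4 = g.+1)%N by clear -nq; lia.
have [||Q eQ hQ] := @chain_of_ex k g hg n.+1 2 (n.+1 + 2) v _ _ (proj1 cv).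
- exact: leq_addr.
- by rewrite addKn.
have [|f0 [h0 s0 e0]] := @Hermite_surj k hk g n.+1 q.+4 (g * 2).+1 (fun S => (Q S)`_0) nd'.
  by move=> S /hQ[_ _ h _].
have [N hN] : exists N, forall S : {set 'I_g.+1}, #|S| = n.+1 -> (size ((Q S)`_2)%R <= N)%N.
  by exists (\max_(S : {set 'I_g.+1}) size ((Q S)`_2)%R) => S _; apply: leq_bigmax.
have [f2 [h2 _ e2]] := @Hermite_surj k hk g n.+1 q.+4 N (fun S => (Q S)`_2) nd' hN.
have {}eQ : v = chain_of n.+1 2 (gfam f0 f0^`() f2).
  rewrite eQ; apply: eq_chain_of => S cS; have [s3 q1 _ _] := hQ S cS.
  by rewrite (poly3E s3) q1 /fam Hermite_deriv e0 // e2.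
have cyc0 (u0 u1 u2 : {poly R n.+1}) : phomog q.+4 u0 -> phomog q.+4 u1 -> phomog q.+4 u2 ->
    tor_cycle (F := KR) phi sec (n.+1 + 2) (chain_of n.+1 2 (gfam u0 u1 u2)) ->
    [/\ kdel u0 = 0, kdel u2 + kdel' u1 = 0 & kdel' u2 = 0].
  move=> a0 a1 a2 [_]; rewrite tensor_diff_chain_of -(chain_of0 k g n 3) => /chain_of_inj e.
  exact: (kdiff_fam_eq0 hk nd a0 a1 a2 e).
have [k0 _ _] : [/\ kdel f0 = 0, kdel f2 + kdel' f0^`() = 0 & kdel' f2 = 0].
  by apply: cyc0; rewrite -?eQ //; apply: phomog_deriv.
have [r hr er] := kdel_eq0 h0 k0.
(* Since g - (n+1) = q + 3, the bound 2g on the degree of f0 = P_(n+1) r is exactly the one that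
   [kdel_lift] asks of r. *)
have [||G [hG sG eG]] := @kdel_lift k n.+1 q.+2 g r _ hr.
- by rewrite -nq leq_addr.
- apply: (@size_gpolyM_leq k n.+1); rewrite -er; apply: (leq_trans s0).
  by clear -nq; lia.
rewrite -er in eG.
have bG := section_boundary hk nq hG sG; rewrite eG in bG.
have [f hf ef] : exists2 f : {poly R n.+1}, phomog q.+4 f &
    v - chain_of n.+1 2 (gfam f0 f0^`() (kdel' G^`())) = chain_of n.+1 2 (gfam 0 0 f).
  exists (f2 - kdel' G^`()).
    by apply: phomogB => //; apply: phomog_kdel'; apply: phomog_deriv.
  rewrite eQ chain_ofB; apply: eq_chain_of => S _; rewrite fam00E HermiteB /fam.
  move: (Hermite _ _) (Hermite _ _) (Hermite _ _) (Hermite _ _) => a b c d.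
  by rewrite polyCB; ring.
have cf : tor_cycle (F := KR) phi sec (n.+1 + 2) (chain_of n.+1 2 (gfam 0 0 f)).
  rewrite -ef; apply/(subspace_ofP (tor_cycle_subspace phi sec KR n.+1 (n.+1 + 2))).
  apply: submod_rpredB; apply/subspace_ofP; first exact: cv.
  by apply: tor_boundary_cycle bG; apply: sections_mul.
have [_ kf kf'] := cyc0 0 0 f (phomog0 _ _ _) (phomog0 _ _ _) hf cf.
rewrite kdel'0 addr0 in kf.
(* f has no v-free part, so the sharper bound at infinity from [sectionP] applies. *)
have sf : (size f <= 2 * g - 3)%N.
  have [||Q' eQ' hQ'] := @chain_of_ex k g hg n.+1 2 (n.+1 + 2) _ _ _ (proj1 cf).
  - exact: leq_addr.
  - by rewrite addKn.
  apply: (size_Hermite_le hk nd' hf) => S cS; have [_ _ _ hs] := hQ' S cS.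
  have eS := chain_of_inj eQ' cS; rewrite fam00E in eS.
  rewrite -eS !coefCM !coefXn /= mulr0 mulr1 in hs; exact: hs.
(* [kdel f = 0] yields one factor P_(n+1), and [kdel' f = 0] then yields the second. *)
have [r1 hr1 er1] := kdel_eq0 hf kf.
have kr1 : kdel r1 = 0.
  have := kf'; rewrite er1 kdel'_gpolyM expr2 -mulrA => /eqP; rewrite oppr_eq0 => /eqP e.
  by rewrite kdelE; apply: (@gpolyI k n); rewrite e mulr0.
have [r2 hr2 er2] := kdel_eq0 hr1 kr1.
have ef2 : f = gpoly n.+1 ^+ 2 * r2 by rewrite er1 er2 mulrA -expr2.
have [|F [s [hF hs ss es]]] := psi_surj hr2.
  apply: (@size_gpolyM_leq k n.+1); apply: (@size_gpolyM_leq k n.+1).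
  rewrite mulrA -expr2 -ef2; apply: (leq_trans sf); clear -nq; lia.
exists F => //.
have eF : weyman_chain F - chain_of n.+1 2 (gfam 0 0 f) =
    chain_of n.+1 2 (gfam 0 0 (gpoly n.+1 ^+ 2 * syzd s)).
  rewrite /weyman_chain chain_ofB; apply: eq_chain_of => S _; rewrite !fam00E -mulrBl.
  rewrite -polyCB -HermiteB ef2 es -mulrBr; congr ((Hermite _ (_ * _))%:P * _).
  by rewrite opprB addrC subrK.
have -> : v - weyman_chain F = chain_of n.+1 2 (gfam f0 f0^`() (kdel' G^`())) -
    (weyman_chain F - chain_of n.+1 2 (gfam 0 0 f)).
  by rewrite -ef; exact: sub_shuffle.
apply/(subspace_ofP (tor_boundary_subspace phi sec KR n.+1 (n.+1 + 2))).
apply: submod_rpredB; apply/subspace_ofP; first exact: bG.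
rewrite eF; apply/(boundaryP hk hg nq); last by exists s.
rewrite expr2 -mulrA; apply: phomog_gpolyM; apply: phomog_gpolyM.
rewrite (_ : syzd s = psi F - r2); first by apply: phomogB => //; apply: (phomog_psi (proj1 hF)).
by rewrite es opprB addrC subrK.
Qed.

Lemma koszul_weyman_iso n q : (n.+1 + q.+3 = g)%N ->
  exists f : {linear weyman k (n.+1 + 2) q -> tor phi sec KR n.+1 (n.+1 + 2)}, bijective f.
Proof.
(* [n.+1 + 2] does not reduce to [n.+3], the index in the type of [weyman_chain], so the index is
   generalised first. *)
move=> nq; suff iso d : d = n.+3 ->
    exists f : {linear weyman k d q -> tor phi sec KR n.+1 (n.+1 + 2)}, bijective f.
  by apply: iso; rewrite addn2.
move=> ->; apply: (@subquotient_iso _ _ _ _ _ _ _ (@weyman_chain n.+1)).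
- exact: weyman_chain_linear.
- by move=> F /subspace_ofP hF; apply/subspace_ofP; apply: weyman_chain_cycle hF.
- move=> F /subspace_ofP hF; have [h1 h2] := weyman_chain_boundary nq hF.
  by apply/subspace_ofP/subspace_ofP.
move=> v /subspace_ofP hv; have [F hF hB] := cycle_weyman_chain nq hv.
by exists F; apply/subspace_ofP.
Qed.

End WeymanIso.

Lemma linear_iso_inverse (k : fieldType) (U V : lmodType k) (f : {linear U -> V}) :
  bijective f -> exists h : {linear V -> U}, bijective h.
Proof.
move=> [h fh hf]; pose h' : {linear V -> U} :=
  HB.pack h (GRing.isLinear.Build _ _ _ _ h (can2_linear fh hf)).
by exists h', f.
Qed.

Lemma linear_iso_comp (k : fieldType) (U V W : lmodType k) (f : {linear U -> V}) (h : {linear V -> W}) :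
  bijective f -> bijective h -> exists e : {linear U -> W}, bijective e.
Proof. by move=> bf bh; exists (h \o f); apply: bij_comp. Qed.

Theorem theorem1p7 (k : fieldType) (hk : 2%N \notin [pchar k])
    (g : nat) (hg : (3 <= g)%N)
    (i : nat) (hi1 : (1 <= i)%N) (hi2 : (i <= g - 3)%N) :
  inhabited (free_resolution k g.+1) /\
  forall F : free_resolution k g.+1,
    exists f : {linear tangential_koszul F i 2 -> weyman k (i + 2) (g - 3 - i)},
      bijective f.
Proof.
split=> [|F]; first exact: (inhabits (koszul_resolution k g.+1)).
case: i hi1 hi2 => // n _ ng.
have nq : (n.+1 + (g - 3 - n.+1).+3 = g)%N by clear -hg ng; lia.
have [f bf] := koszul_weyman_iso hk hg nq; have [h bh] := linear_iso_inverse bf.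
have [e be] := tor_comparison (@sections_mul k g) F (koszul_resolution k g.+1) n.+1 (n.+1 + 2).
exact: linear_iso_comp be bh.
Qed.
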